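(* Let $\mathbb X^{(1)},\mathbb X^{(2)}$ be $\Omega_T^p$-valued random variables and $\theta\ge0$ a random variable, mutually independent. Then the concatenated process $$\mathbb X_{0,t}=\mathbf 1_{\{t<\theta\}}\,\mathbb X^{(1)}_{0,t}+\mathbf 1_{\{t\ge\theta\}}\,\big(\mathbb X^{(1)}_{0,\theta}\otimes\mathbb X^{(2)}_{\theta,t}\big),\qquad t\in[0,T],$$ is almost surely a geometric $p$-rough path, i.e. $\mathbb X\in\Omega_T^p$ almost surely.
   Context: Fix $d\ge1$, $p\ge1$, $T>0$, $N=\lfloor p\rfloor$. $G^N(\mathbb R^d)$ is the free step-$N$ nilpotent group inside the truncated tensor algebra, with product $\otimes$ and identity $\mathbf 1$; $S_N(x)_{s,t}$ is the step-$N$ truncated signature (iterated integrals) of a continuous bounded variation path $x$ over $[s,t]$. The Carnot–Carathéodory norm is $\|g\|_{CC}=\inf\{\text{length}(\gamma):\gamma\in C^{1\text{-var}}([0,1],\mathbb R^d),\ S_N(\gamma)_{0,1}=g\}$ and $d_{CC}(g,h)=\|g^{-1}\otimes h\|_{CC}$. For continuous $\mathbb X,\mathbb Y:[0,T]\to G^N(\mathbb R^d)$ with $\mathbb X_0=\mathbb Y_0=\mathbf 1$, $\mathbb X_{s,t}:=\mathbb X_s^{-1}\otimes\mathbb X_t$, $d_{p\text{-var};[s,t]}(\mathbb X,\mathbb Y)=\big(\sup_{\mathcal D\subset[s,t]}\sum_i d_{CC}(\mathbb X_{t_i,t_{i+1}},\mathbb Y_{t_i,t_{i+1}})^p\big)^{1/p}$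 over partitions $\mathcal D$ of $[s,t]$, and $\|\mathbb X\|_{p\text{-var};[0,T]}=\big(\sup_{\mathcal D}\sum_i\|\mathbb X_{t_i,t_{i+1}}\|_{CC}^p\big)^{1/p}$. A geometric $p$-rough path is a continuous $\mathbb X:[0,T]\to G^N(\mathbb R^d)$ with $\mathbb X_0=\mathbf 1$, $\|\mathbb X\|_{p\text{-var};[0,T]}<\infty$, for which there exist bounded variation paths $x^m$ in $\mathbb R^d$ with $d_{p\text{-var};[0,T]}(S_N(x^m),\mathbb X)\to0$. The set of these is $\Omega_T^p$. The underlying probability space is $\bar\Omega=\Omega^p_T\times\Omega^p_T\times[0,\infty)$ with $\mathbb P=\mu_1\otimes\mu_2\otimes\nu$, where $\mu_1\ne\mu_2$ are the laws of $\mathbb X^{(1)},\mathbb X^{(2)}$ and $\nu$ is the law of $\theta$ (finite mean). *)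

(* Defs.v *)
From HB Require Import structures.
From mathcomp Require Import all_boot all_order all_algebra.
From mathcomp Require Import all_classical all_reals all_analysis.

Set Implicit Arguments.
Unset Strict Implicit.
Unset Printing Implicit Defensive.

Import Order.TTheory GRing.Theory Num.Theory.
Import numFieldNormedType.Exports.

Local Open Scope classical_set_scope.
Local Open Scope ring_scope.

(* Step-N truncated tensor algebra over R^d: the coefficient of e_i1 ... e_ik
   (k <= N) is the value at the word [:: i1; ...; ik]. *)
Notation ttensor R d N := {ffun N.-bseq 'I_d -> (R : Type)}.

Section truncated_tensor_algebra.
Context {R : realType} {d N : nat}.
Implicit Types a b g : ttensor R d N.

Definition tone : ttensor R d N := [ffun w : N.-bseq 'I_d => (size w == 0%N)%:R].

(* Prefixes and suffixes of w have length <= N, so insub_bseq leaves them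
   unchanged. *)
Definition tmul a b : ttensor R d N :=
  [ffun w : N.-bseq 'I_d =>
    \sum_(i < (size w).+1) a (insub_bseq N (take i w)) * b (insub_bseq N (drop i w))].

Definition tpow a (k : nat) : ttensor R d N := iter k (tmul a) tone.

(* Neumann series: the inverse of g whenever the scalar component of g is 1. *)
Definition tinv g : ttensor R d N := \sum_(k < N.+1) tpow (tone - g) k.

Definition texp a : ttensor R d N := \sum_(k < N.+1) (k`!%:R)^-1 *: tpow a k.

Definition tletter (i : 'I_d) : ttensor R d N :=
  [ffun w : N.-bseq 'I_d => (val w == [:: i])%:R].

(* Free step-N nilpotent Lie algebra: the smallest Lie subalgebra, for the
   bracket a (x) b - b (x) a, containing R^d. *)
Inductive free_nilpotent_lie : ttensor R d N -> Prop :=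
| FnLie_letter i : free_nilpotent_lie (tletter i)
| FnLie_0 : free_nilpotent_lie 0
| FnLie_D a b : free_nilpotent_lie a -> free_nilpotent_lie b ->
    free_nilpotent_lie (a + b)
| FnLie_Z (c : R) a : free_nilpotent_lie a -> free_nilpotent_lie (c *: a)
| FnLie_bracket a b : free_nilpotent_lie a -> free_nilpotent_lie b ->
    free_nilpotent_lie (tmul a b - tmul b a).

Definition free_nilpotent_group : set (ttensor R d N) :=
  [set texp a | a in free_nilpotent_lie].

Definition incr (X : R -> ttensor R d N) (s t : R) : ttensor R d N :=
  tmul (tinv (X s)) (X t).

End truncated_tensor_algebra.

Section paths.
Context {R : realType} {d : nat}.

(* f, g : Riemann-Stieltjes sums over tagged partitions
   a = t_0 < ... < t_n = b converge to I as the mesh goes to 0. *)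
Definition is_RS_integral (f g : R -> R) (a b I : R) : Prop :=
  forall e : R, 0 < e -> exists2 delta : R, 0 < delta &
    forall (s : seq R) (xi : nat -> R),
      itv_partition a b s ->
      let u := nth b (a :: s) in
      (forall i, (i < size s)%N ->
         u i.+1 - u i < delta /\ u i <= xi i <= u i.+1) ->
      `| \sum_(i < size s) f (xi i) * (g (u i.+1) - g (u i)) - I | < e.

Definition RS_integral (f g : R -> R) (a b : R) : R :=
  xget 0 [set I | is_RS_integral f g a b I].

(* Sup over partitions s = t_0 < ... < t_n = t of the sums of F t_i t_(i+1). *)
Definition partition_sup (F : R -> R -> \bar R) (s t : R) : \bar R :=
  ereal_sup [set (\sum_(i < size D)
                     F (nth t (s :: D) i) (nth t (s :: D) i.+1))%E
            | D in itv_partition s t].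

Definition eucl_norm (v : 'rV[R]_d) : R := Num.sqrt (\sum_(i < d) v 0 i ^+ 2).

Definition path_length (a b : R) (x : R -> 'rV[R]_d) : \bar R :=
  partition_sup (fun s t => (eucl_norm (x t - x s))%:E) a b.

Definition continuous_bv (a b : R) (x : R -> 'rV[R]_d) : Prop :=
  {within `[a, b], continuous x} /\ (path_length a b x < +oo)%E.

(* Words are read from their last letter, which carries the outermost
   integral. *)
Fixpoint iterated_integral (x : R -> 'rV[R]_d) (s : R) (w : seq 'I_d) (t : R)
    : R :=
  if w is i :: w' then
    RS_integral (iterated_integral x s w') (fun u => x u 0 i) s t
  else 1.

Definition signature (N : nat) (x : R -> 'rV[R]_d) (s t : R) : ttensor R d N :=
  [ffun w : N.-bseq 'I_d => iterated_integral x s (rev w) t].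

Definition cc_norm (N : nat) (g : ttensor R d N) : \bar R :=
  ereal_inf [set path_length 0 1 x | x in
    [set x | continuous_bv 0 1 x /\ signature N x 0 1 = g]].

Definition cc_dist (N : nat) (g h : ttensor R d N) : \bar R :=
  cc_norm (tmul (tinv g) h).

Definition pvar_norm (N : nat) (p s t : R) (X : R -> ttensor R d N) : \bar R :=
  (partition_sup (fun u v => cc_norm (incr X u v) `^ p) s t `^ p^-1)%E.

Definition pvar_dist (N : nat) (p s t : R) (X Y : R -> ttensor R d N)
    : \bar R :=
  (partition_sup (fun u v => cc_dist (incr X u v) (incr Y u v) `^ p) s t
     `^ p^-1)%E.

(* A path on [0, T] is a function on R of which only the restriction to
   [0, T] matters. Coordinatewise continuity is continuity for the topology
   of the truncated tensor algebra. *)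
Definition geometric_rough_path (p T : R)
    (X : R -> ttensor R d (Num.truncn p)) : Prop :=
  [/\ X 0 = tone,
      forall t, t \in `[0, T] -> free_nilpotent_group (X t),
      forall w, {within `[0, T], continuous (fun t => X t w)},
      (pvar_norm p 0 T X < +oo)%E &
      exists x : nat -> R -> 'rV[R]_d,
        (forall m, continuous_bv 0 T (x m)) /\
        pvar_dist p 0 T (signature (Num.truncn p) (x m) 0) X
          @[m --> \oo] --> 0%E].

End paths.

Arguments geometric_rough_path {R d} p T X.

Section trivial_rough_path.
Context {R : realType} {d : nat}.

Lemma tmul0 N (a : ttensor R d N) : tmul 0 a = 0.
Proof.
by apply/ffunP => w; rewrite !ffunE big1// => i _; rewrite ffunE mul0r.
Qed.

Lemma tmul1 N (a : ttensor R d N) : tmul tone a = a.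
Proof.
have vE (v : seq 'I_d) : (size v <= N)%N ->
    bseqval (insub_bseq N v) = v.
  by move=> vN; rewrite -[LHS]/(val _) val_insubd vN.
apply/ffunP => w; rewrite ffunE big_ord_recl big1 => [|i _].
  rewrite addr0 ffunE /= take0 drop0 vE// eqxx mul1r; congr (a _).
  by apply/val_inj; rewrite /= vE// size_bseq.
rewrite ffunE vE; last by rewrite size_take_min geq_min size_bseq orbT.
rewrite size_take_min /= /bump leq0n; have := ltn_ord i.
move=> iw; rewrite (_ : minn _ _ == 0%N = false) ?mul0r//.
by apply/negbTE; rewrite -lt0n leq_min /= (leq_ltn_trans (leq0n i) iw).
Qed.

Lemma tpow0 N (k : nat) : tpow (0 : ttensor R d N) k.+1 = 0.
Proof. exact: tmul0. Qed.

Lemma tinv1 N : tinv (tone : ttensor R d N) = tone.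
Proof.
by rewrite /tinv subrr big_ord_recl big1 ?addr0// => i _; rewrite tpow0.
Qed.

Lemma texp0 N : texp (0 : ttensor R d N) = tone.
Proof.
rewrite /texp big_ord_recl big1 => [|i _]; last by rewrite tpow0 scaler0.
by rewrite addr0 invr1 scale1r.
Qed.

Lemma fine_partition (a b delta : R) : a <= b -> 0 < delta ->
  exists2 s, itv_partition a b s &
    forall i, (i < size s)%N ->
      0 <= nth b (a :: s) i.+1 - nth b (a :: s) i < delta.
Proof.
rewrite le_eqVlt => /predU1P[<- _|ab delta0].
  by exists [::] => //; split => /=.
pose n := (Num.truncn ((b - a) / delta)).+1.
have n0 : (0 : R) < n%:R by rewrite ltr0n.
pose h := (b - a) / n%:R.
have h0 : 0 < h by rewrite divr_gt0// subr_gt0.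
have hd : h < delta.
  by rewrite ltr_pdivrMr// mulrC -ltr_pdivrMr// truncnS_gt.
pose f (i : nat) := a + i%:R * h.
pose s := [seq f i | i <- iota 1 n].
have sE : a :: s = [seq f i | i <- iota 0 n.+1].
  by rewrite /s /= /f mul0r addr0.
have nthE i : (i <= n)%N -> nth b (a :: s) i = f i.
  by move=> ni; rewrite sE (nth_map 0%N) ?size_iota// nth_iota.
exists s.
  split.
    have : sorted <%R (a :: s).
      rewrite sE; apply: (homo_sorted (e := ltn)); last exact: iota_ltn_sorted.
      by move=> i j ij; rewrite /f ltrD2l ltr_pM2r// ltr_nat.
    by [].
  have -> : last a s = nth b (a :: s) n.
    by rewrite -[in RHS](_ : size s = n) ?nth_last// size_map size_iota.
  rewrite nthE// /f /h mulrCA divff ?lt0r_neq0// mulr1.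
  by rewrite [eqbLHS]addrC subrK.
move=> i; rewrite size_map size_iota => ni.
rewrite !nthE//; last exact: ltnW.
by rewrite /f opprD addrACA subrr add0r -mulrBl -natr1 addrAC subrr add0r mul1r
  hd ltW.
Qed.

Lemma RS_integral_unique (f g : R -> R) (a b I J : R) : a <= b ->
  is_RS_integral f g a b I -> is_RS_integral f g a b J -> I = J.
Proof.
move=> ab fI fJ; apply/eqP; rewrite -subr_eq0 -normr_le0.
apply/ler_addgt0Pr => e e0; rewrite add0r.
have e20 : 0 < e / 2 by rewrite divr_gt0.
have [d1 d10 {}fI] := fI _ e20; have [d2 d20 {}fJ] := fJ _ e20.
have dd : 0 < Num.min d1 d2 by rewrite lt_min d10.
have [s ps hs] := fine_partition ab dd.
pose xi := nth b (a :: s).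
have := fI s xi ps; have := fJ s xi ps => /=.
set S := (X in `|X - J|) => J1 I1.
rewrite -(subrKA S) (le_trans (ler_normD _ _))// [e]splitr lerD//.
  rewrite distrC ltW// I1// => i /hs /andP[].
  by rewrite lt_min subr_ge0 => H /andP[-> _]; rewrite /xi lexx H.
rewrite ltW// J1// => i /hs /andP[].
by rewrite lt_min subr_ge0 => H /andP[_ ->]; rewrite /xi lexx H.
Qed.

Lemma RS_integralE (f g : R -> R) (a b I : R) : a <= b ->
  is_RS_integral f g a b I -> RS_integral f g a b = I.
Proof.
move=> ab fI; rewrite /RS_integral; apply: xget_unique => //= J fJ.
exact: RS_integral_unique ab fJ fI.
Qed.

Lemma signature0 N (s t : R) : s <= t ->
  signature N (fun=> 0 : 'rV[R]_d) s t = tone.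
Proof.
move=> st; apply/ffunP => w; rewrite !ffunE -size_rev.
case: (rev w) => [//|i v] /=; apply: RS_integralE => // e e0.
exists 1 => // D xi _ _ _.
by rewrite big1 => [|j _]; rewrite ?subrr ?normr0// mulr0.
Qed.

Lemma partition_sup0 (F : R -> R -> \bar R) (s t : R) : s < t ->
  (forall u v, s <= u -> u <= v -> v <= t -> F u v = 0%E) ->
  partition_sup F s t = 0%E.
Proof.
move=> st F0; rewrite /partition_sup [X in ereal_sup X](_ : _ = [set 0%E]).
  by rewrite ereal_sup1.
apply/seteqP; split => [_ [D pD <-]|_ ->] /=.
  have le_nth i j : (i <= j)%N -> (j <= size D)%N ->
      nth t (s :: D) i <= nth t (s :: D) j.
    move=> ij jD; case: pD => pD _.
    have sD : sorted <=%R (s :: D) by apply: sub_path pD => ? ? /ltW.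
    by apply: (sorted_leq_nth le_trans lexx t sD) => //;
      rewrite inE /= ltnS// (leq_trans ij).
  apply: big1 => i _; apply: F0.
  - by have := le_nth 0%N i (leq0n _) (ltnW (ltn_ord i)).
  - exact: (le_nth i i.+1 (leqnSn _) (ltn_ord i)).
  - have := le_nth i.+1 (size D) (ltn_ord i) (leqnn _).
    by rewrite -[X in _ <= X -> _]/(nth t (s :: D) (size (s :: D)).-1)
         nth_last /=; case: pD => _ /eqP ->.
exists [:: t]; first by split => //=; rewrite andbT.
by rewrite big_ord1 /= F0 // ltW.
Qed.

Lemma path_length0 (a b : R) : a < b ->
  path_length a b (fun=> 0 : 'rV[R]_d) = 0%E.
Proof.
move=> ab; apply: partition_sup0 => // u v _ _ _.
rewrite /eucl_norm subrr big1 ?sqrtr0// => i _.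
by rewrite mxE expr0n.
Qed.

Lemma continuous_bv0 (a b : R) : a < b ->
  continuous_bv a b (fun=> 0 : 'rV[R]_d).
Proof.
move=> ab; split; last by rewrite path_length0 ?ltry.
by move=> ?; exact: cvg_cst.
Qed.

Lemma cc_norm1 N : cc_norm (tone : ttensor R d N) = 0%E.
Proof.
apply/eqP; rewrite eq_le; apply/andP; split.
  apply: ereal_inf_lbound; exists (fun=> 0); last exact: path_length0.
  by split; [exact: continuous_bv0|exact: signature0].
apply/le_ereal_inf_tmp => _ [x _ <-]; rewrite /path_length /partition_sup.
apply: ereal_sup_ge; exists (eucl_norm (x 1 - x 0))%:E; last first.
  by rewrite lee_fin sqrtr_ge0.
exists [:: 1]; last by rewrite big_ord1.
by split => //=; rewrite ltr01.
Qed.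

Lemma geometric_rough_path1 (p T : R) : 1 <= p -> 0 < T ->
  geometric_rough_path p T (fun=> tone : ttensor R d (Num.truncn p)).
Proof.
move=> p1 T0; have p0 : p != 0 by rewrite gt_eqF// (lt_le_trans ltr01).
have I1 N : tmul (tinv (tone : ttensor R d N)) tone = tone.
  by rewrite tinv1 tmul1.
split => //.
- by move=> t _; exists 0; [exact: FnLie_0|exact: texp0].
- by move=> w ?; exact: cvg_cst.
- rewrite /pvar_norm partition_sup0 ?poweR0r ?invr_neq0 ?ltry// => u v _ _ _.
  by rewrite /incr I1 cc_norm1 poweR0r.
- exists (fun=> fun=> 0); split; first by move=> _; exact: continuous_bv0.
  rewrite (_ : (fun _ => _) = fun=> 0%E); first exact: cvg_cst.
  apply/funext => m; rewrite /pvar_dist partition_sup0 ?poweR0r ?invr_neq0//.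
  move=> u v u0 uv vT.
  rewrite /incr /cc_dist !signature0 ?(le_trans u0 uv)//.
  by rewrite !I1 cc_norm1 poweR0r.
Qed.

End trivial_rough_path.

Record grough_path {R : realType} (d : nat) (p T : R) (p1 : 1 <= p)
    (T0 : 0 < T) := GRoughPath {
  grough_val :> R -> ttensor R d (Num.truncn p) ;
  groughP : geometric_rough_path p T grough_val }.

Section rough_path_space.
Context {R : realType} (d : nat) (p T : R) (p1 : 1 <= p) (T0 : 0 < T).
Local Notation space := (grough_path d p1 T0).

HB.instance Definition _ := gen_eqMixin space.
HB.instance Definition _ := gen_choiceMixin space.
HB.instance Definition _ := isPointed.Build space
  (GRoughPath p1 T0 (geometric_rough_path1 p1 T0)).

Definition pvar_open (U : set space) : Prop :=
  forall X : space, U X -> exists2 e : R, 0 < e &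
    forall Y : space, (pvar_dist p 0 T X Y < e%:E)%E -> U Y.

Lemma pvar_openT : pvar_open setT.
Proof. by move=> X _; exists 1. Qed.

Lemma pvar_openI : setI_closed pvar_open.
Proof.
move=> U V oU oV X [/oU[e e0 eU] /oV[f f0 fV]].
exists (Num.min e f); first by rewrite lt_min e0.
by move=> Y; rewrite EFin_min lt_min => /andP[/eU ? /fV ?]; split.
Qed.

Lemma pvar_open_bigU (I : Type) (f : I -> set space) :
  (forall i, pvar_open (f i)) -> pvar_open (\bigcup_i f i).
Proof.
by move=> of_ X [i _ /of_[e e0 eU]]; exists e => // Y /eU; exists i.
Qed.

HB.instance Definition _ :=
  isOpenTopological.Build space pvar_openT pvar_openI pvar_open_bigU.

(* Borel sigma-algebra of the p-variation topology. *)
HB.instance Definition _ := @isMeasurable.Build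
  (sigma_display (@open space)) space <<s (@open space) >>
  (@sigma_algebra0 _ setT (@open space))
  (@sigma_algebraC _ (@open space))
  (@sigma_algebra_bigcup _ setT (@open space)).

End rough_path_space.

Definition same_law {R : realType} {d d'} {W : measurableType d}
    {E : measurableType d'} (P : probability W R) (X Y : {RV P >-> E}) : Prop :=
  forall A : set E, measurable A -> distribution P X A = distribution P Y A.

Definition mutually_independent3 {R : realType} {d d1 d2 d3}
    {W : measurableType d} {E1 : measurableType d1} {E2 : measurableType d2}
    {E3 : measurableType d3} (P : probability W R)
    (X : {RV P >-> E1}) (Y : {RV P >-> E2}) (Z : {RV P >-> E3}) : Prop :=
  forall (A : set E1) (B : set E2) (C : set E3),
    measurable A -> measurable B -> measurable C ->
    P (X @^-1` A `&` Y @^-1` B `&` Z @^-1` C) =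
    (P (X @^-1` A) * P (Y @^-1` B) * P (Z @^-1` C))%E.

Definition concatenation {R : realType} {d N : nat}
    (X1 X2 : R -> ttensor R d N) (theta t : R) : ttensor R d N :=
  (t < theta)%R%:R *: incr X1 0 t
  + (theta <= t)%R%:R *: tmul (incr X1 0 theta) (incr X2 theta t).

(* Main.v *)
Require Import Defs.
From HB Require Import structures.
From mathcomp Require Import all_boot all_order all_algebra.
From mathcomp Require Import all_classical all_reals all_analysis.
From mathcomp Require Import ring lra.

(** The claim holds for every outcome: if X1 and X2 are geometric rough
paths and 0 <= th <= T, then the path X that follows X1 up to th and then
X1(th) X2(th)^-1 X2 is a geometric rough path (when theta exceeds T, it agrees
with th = T on [0, T]). An increment of X is an increment of X1 to the left of
th, an increment of X2 to the right of th, and a product g h of one of each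
across th. A partition has at most one interval that straddles th, so the
p-variation of X is controlled by those of X1 and X2 and by the norm of one
product, and the Carnot-Caratheodory norm is subadditive ([cc_normM]). For the
approximation, paste approximating paths of X1 and X2 at th: by Chen's
identity ([chen_identity]) the increments of the pasted signature factor in
the same way.

The delicate point is again the straddling interval. There the distance from
g1 h1 to g2 h2 is at most |h1^-1 h2| + |h2^-1 k h2| with k = g1^-1 g2
([cc_distM]). Both |h1^-1 h2| and |k| are small, but the norm is not invariant
under conjugation, so conjugation by bounded group elements has to be shown
continuous at the identity ([cc_norm_conj]). A small norm gives small
coordinates, conjugation is polynomial in coordinates, and conversely a group
element with small coordinates has a small norm ([chow]). That last fact is
proved degree by degree: the lowest-degree part of a group element is a
combination of iterated brackets, with coefficients read off by the Dynkin
operator, and a bracket is, up to higher degree, the signature of a short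
polygonal path made of commutators.

Two facts about the group support this. Products of exponentials of Lie
elements are exponentials of Lie elements, the Baker-Campbell-Hausdorff
property: with delta the derivation that multiplies degree n by n, the group
consists exactly of the g with constant term 1 such that g^-1 delta(g) is Lie
([grouplike_group], [group_grouplike]). And signatures lie in the group
([tsig_group]), because delta(S) = S D(S) with D the Dynkin operator.

All the calculus is done with one notion. A path Z in the tensor algebra solves
dZ = Z dx when Z(v) - Z(u) - Z(u) (x(v) - x(u)) is uniformly o(w(u, v)) for a
superadditive control w. Solutions are unique ([solves_unique]) and the
signature is one ([tsig_solves]), after the existence of the Riemann-Stieltjes
integrals is established ([indefinite_integral_exists],
[indefinite_integral_RS]). Chen's identity, invariance under
reparametrisation, the signature of a segment and membership in the group then
all follow from uniqueness. *)

Set Implicit Arguments.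
Unset Strict Implicit.
Unset Printing Implicit Defensive.

Import Order.TTheory GRing.Theory Num.Theory.
Import numFieldNormedType.Exports.

Local Open Scope classical_set_scope.
Local Open Scope ring_scope.

(** * The truncated tensor algebra as a ring *)

(** A separate name, because the underlying type of finite functions already
carries the pointwise product as its ring multiplication. *)
Definition tens (R : realType) (d N : nat) : Type := ttensor R d N.

HB.instance Definition _ (R : realType) (d N : nat) :=
  GRing.Lmodule.copy (tens R d N) {ffun N.-bseq 'I_d -> R}.

Section convolution.
Context {R : comNzRingType} {I : Type}.
Implicit Types a b c : seq I -> R.

(** Concatenation product of coefficient functions on words of any length, by
recursion on the word: with the left factor generalised, associativity is a
plain induction. *)
Fixpoint conv a b w : R :=
  a [::] * b w + (if w is i :: w' then conv (fun v => a (i :: v)) b w' else 0).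

Lemma convE a b w :
  conv a b w = \sum_(i < (size w).+1) a (take i w) * b (drop i w).
Proof.
elim: w a => [|i w IH] a /=; first by rewrite big_ord1 addr0.
by rewrite big_ord_recl take0 drop0 IH.
Qed.

Lemma eq_conv a a' b b' w :
  (forall v, (size v <= size w)%N -> a v = a' v) ->
  (forall v, (size v <= size w)%N -> b v = b' v) ->
  conv a b w = conv a' b' w.
Proof.
move=> aa bb; rewrite !convE; apply: eq_bigr => i _.
by rewrite aa ?bb// ?size_drop ?leq_subr// size_take_min geq_minr.
Qed.

Lemma convDl a a' b w : conv (fun v => a v + a' v) b w = conv a b w + conv a' b w.
Proof.
elim: w a a' => [|i w IH] a a' /=; first by ring.
by rewrite IH; ring.
Qed.

Lemma convZl k a b w : conv (fun v => k * a v) b w = k * conv a b w.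
Proof.
elim: w a => [|i w IH] a /=; first by ring.
by rewrite IH; ring.
Qed.

Lemma convA a b c w : conv a (conv b c) w = conv (conv a b) c w.
Proof.
elim: w a => [|i w IH] a; first by rewrite /=; ring.
rewrite -[LHS]/(a [::] * (b [::] * c (i :: w) + conv (fun v => b (i :: v)) c w)
  + conv (fun v => a (i :: v)) (conv b c) w).
rewrite -[RHS]/((a [::] * b [::] + 0) * c (i :: w)
  + conv (fun v => a [::] * b (i :: v) + conv (fun u => a (i :: u)) b v) c w).
by rewrite IH convDl convZl; ring.
Qed.

End convolution.

Section tensor_ring.
Context {R : realType} {d N : nat}.
Local Notation A := (tens R d N).
Implicit Types a b c : A.
Local Notation ins := (@insub_bseq N 'I_d).

Lemma insE (v : seq 'I_d) : (size v <= N)%N -> val (ins v) = v.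
Proof. by move=> vN; rewrite val_insubd vN. Qed.

Lemma ins_val (w : N.-bseq 'I_d) : ins w = w.
Proof. by apply/val_inj; rewrite insE// size_bseq. Qed.

Definition tens_one : A := tone.
Definition tens_mul a b : A := tmul a b.

Lemma tens_mulE a b w : tens_mul a b w = conv (a \o ins) (b \o ins) w.
Proof. by rewrite convE ffunE. Qed.

Lemma tens_mulA : associative tens_mul.
Proof.
move=> a b c; apply/ffunP => w; rewrite !tens_mulE.
transitivity (conv (a \o ins) (conv (b \o ins) (c \o ins)) w).
  apply: eq_conv => // v vw /=.
  by rewrite tens_mulE insE// (leq_trans vw)// size_bseq.
rewrite convA; apply: eq_conv => // v vw /=.
by rewrite tens_mulE insE// (leq_trans vw)// size_bseq.
Qed.

Lemma tens_mul1l : left_id tens_one tens_mul.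
Proof. exact: tmul1. Qed.

Lemma tens_mul1r : right_id tens_one tens_mul.
Proof.
move=> a; apply/ffunP => w; rewrite ffunE big_ord_recr /= take_size drop_size.
rewrite big1 ?add0r => [|[i iw] _ /=].
  by rewrite ffunE insE// mulr1 ins_val.
rewrite ffunE insE.
  by rewrite size_drop subn_eq0 leqNgt iw mulr0.
by rewrite size_drop (leq_trans (leq_subr _ _))// size_bseq.
Qed.

Lemma tens_mulDl : left_distributive tens_mul +%R.
Proof.
move=> a b c; apply/ffunP => w; rewrite !ffunE -big_split/=.
by apply: eq_bigr => i _; rewrite ffunE mulrDl.
Qed.

Lemma tens_mulDr : right_distributive tens_mul +%R.
Proof.
move=> a b c; apply/ffunP => w; rewrite !ffunE -big_split/=.
by apply: eq_bigr => i _; rewrite ffunE mulrDr.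
Qed.

Lemma tens_one_neq0 : tens_one != 0.
Proof.
apply/eqP => /ffunP/(_ [bseq]); rewrite !ffunE /= => /eqP.
by rewrite oner_eq0.
Qed.

HB.instance Definition _ := GRing.Zmodule_isNzRing.Build A
  tens_mulA tens_mul1l tens_mul1r tens_mulDl tens_mulDr tens_one_neq0.

Lemma scale_mull (k : R) a b : k *: (a * b) = (k *: a) * b.
Proof.
apply/ffunP => w; rewrite !ffunE /GRing.scale/= mulr_sumr.
by apply: eq_bigr => i _; rewrite ffunE mulrA.
Qed.

Lemma scale_mulr (k : R) a b : k *: (a * b) = a * (k *: b).
Proof.
apply/ffunP => w; rewrite !ffunE /GRing.scale/= mulr_sumr.
by apply: eq_bigr => i _; rewrite ffunE mulrCA.
Qed.

HB.instance Definition _ := GRing.Lmodule_isLalgebra.Build R A scale_mull.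
HB.instance Definition _ := GRing.Lalgebra_isAlgebra.Build R A scale_mulr.

Lemma tmulE a b : tmul a b = a * b. Proof. by []. Qed.
Lemma tpowE a k : tpow a k = a ^+ k.
Proof. by elim: k => //= k IH; rewrite exprS -IH. Qed.

Lemma texpE a : texp a = \sum_(k < N.+1) (k`!%:R)^-1 *: a ^+ k :> A.
Proof. by apply: eq_bigr => k _; rewrite tpowE. Qed.

Lemma tinvE a : tinv a = \sum_(k < N.+1) (1 - a) ^+ k :> A.
Proof. by apply: eq_bigr => k _; rewrite tpowE. Qed.

Lemma tens_coefM a b (w : N.-bseq 'I_d) :
  (a * b) w = \sum_(i < (size w).+1) a (ins (take i w)) * b (ins (drop i w)).
Proof. exact: ffunE. Qed.

Lemma size_take_ins (w : N.-bseq 'I_d) i : (i <= size w)%N ->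
  size (ins (take i w)) = i.
Proof.
move=> iw; have s : size (take i w) = i by apply: size_takel.
by rewrite insE s// (leq_trans iw)// size_bseq.
Qed.

Lemma size_drop_ins (w : N.-bseq 'I_d) i :
  size (ins (drop i w)) = (size w - i)%N.
Proof.
by rewrite insE size_drop// (leq_trans (leq_subr _ _))// size_bseq.
Qed.

(** The filtration by powers of the augmentation ideal. *)
Definition deg_ge n a := forall w : N.-bseq 'I_d, (size w < n)%N -> a w = 0.

Lemma deg_ge_le m n a : (m <= n)%N -> deg_ge n a -> deg_ge m a.
Proof. by move=> mn an w wm; apply: an; apply: leq_trans wm mn. Qed.

Lemma deg_ge00 a : deg_ge 0 a. Proof. by []. Qed.

Lemma deg_ge0 n : deg_ge n 0. Proof. by move=> w _; rewrite ffunE. Qed.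

Lemma deg_geD n a b : deg_ge n a -> deg_ge n b -> deg_ge n (a + b).
Proof. by move=> ha hb w wn; rewrite ffunE ha// hb// addr0. Qed.

Lemma deg_geN n a : deg_ge n a -> deg_ge n (- a).
Proof. by move=> ha w wn; rewrite ffunE ha// oppr0. Qed.

Lemma deg_geB n a b : deg_ge n a -> deg_ge n b -> deg_ge n (a - b).
Proof. by move=> ha hb; apply: deg_geD => //; apply: deg_geN. Qed.

Lemma deg_geZ n (k : R) a : deg_ge n a -> deg_ge n (k *: a).
Proof. by move=> ha w wn; rewrite ffunE ha// /GRing.scale/= mulr0. Qed.

Lemma deg_ge_sum n (J : Type) (r : seq J) (Q : pred J) (F : J -> A) :
  (forall j, Q j -> deg_ge n (F j)) -> deg_ge n (\sum_(j <- r | Q j) F j).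
Proof.
move=> FJ; elim/big_ind: _ => //; [exact: deg_ge0|move=> *; exact: deg_geD].
Qed.

Lemma deg_geM m n a b : deg_ge m a -> deg_ge n b -> deg_ge (m + n) (a * b).
Proof.
move=> ha hb w wmn; rewrite tens_coefM big1// => i _.
have iw : (i <= size w)%N by rewrite -ltnS.
have [im|mi] := ltnP i m; first by rewrite ha ?mul0r// size_take_ins.
rewrite hb ?mulr0// size_drop_ins ltn_subLR//.
by rewrite (leq_trans wmn)// leq_add2r.
Qed.

Lemma deg_geMl n a b : deg_ge n b -> deg_ge n (a * b).
Proof. by move=> hb; rewrite -[n]add0n; apply: deg_geM. Qed.

Lemma deg_geMr n a b : deg_ge n a -> deg_ge n (a * b).
Proof. by move=> hb; rewrite -[n]addn0; apply: deg_geM. Qed.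

Lemma deg_geX k a : deg_ge 1 a -> deg_ge k (a ^+ k).
Proof.
move=> ha; elim: k => [|k IH]; first exact: deg_ge00.
by rewrite exprS -add1n; apply: deg_geM.
Qed.

Lemma deg_ge_eq0 a : deg_ge N.+1 a -> a = 0.
Proof. by move=> ha; apply/ffunP => w; rewrite ha ?ffunE// ltnS size_bseq. Qed.

Lemma deg_ge1P a : deg_ge 1 a <-> a [bseq] = 0.
Proof.
split=> [/(_ [bseq])->//|a0 w]; rewrite ltnS leqn0 => /nilP w0.
by rewrite -[RHS]a0; congr (a _); apply/val_inj.
Qed.

Lemma coef_one : (1 : A) [bseq] = 1. Proof. by rewrite ffunE. Qed.

Lemma coefM0 a b : (a * b) [bseq] = a [bseq] * b [bseq].
Proof.
rewrite tens_coefM big_ord1 /=.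
by have -> : ins [::] = [bseq] by apply/val_inj; rewrite /= insE.
Qed.

Lemma nilpotent a k : deg_ge 1 a -> (N < k)%N -> a ^+ k = 0.
Proof.
move=> ha Nk; apply: deg_ge_eq0; apply: deg_ge_le Nk _; exact: deg_geX.
Qed.

Lemma subr1_deg_ge1 a : a [bseq] = 1 -> deg_ge 1 (a - 1).
Proof. by move=> a1; apply/deg_ge1P; rewrite !ffunE/= a1 subrr. Qed.

(** The Neumann series in [1 - a] telescopes and its remainder is a power of a
nilpotent element. *)
Lemma mulVt a : a [bseq] = 1 -> (tinv a : A) * a = 1.
Proof.
move=> a1; rewrite tinvE; set y := 1 - a; have -> : a = 1 - y.
  by rewrite /y opprB addrC subrK.
have y1 : deg_ge 1 y by rewrite /y -opprB; apply/deg_geN/subr1_deg_ge1.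
have : (\sum_(k < N.+1) y ^+ k) * (1 - y) = 1 - y ^+ N.+1.
  rewrite mulrBr mulr1 mulr_suml big_ord_recl expr0 -addrA; congr (1 + _).
  rewrite (eq_bigr (fun i : 'I_N.+1 => y ^+ i.+1)); last first.
    by move=> i _; rewrite exprSr.
  by rewrite (big_ord_recr N)/= opprD addrA subrr add0r.
by move=> ->; rewrite (nilpotent y1)// subr0.
Qed.

Lemma coef_tinv a : a [bseq] = 1 -> (tinv a : A) [bseq] = 1.
Proof.
move=> a1; have := congr1 (fun b : A => b [bseq]) (mulVt a1).
by rewrite /= coefM0 a1 mulr1 coef_one.
Qed.

Lemma mulrVt a : a [bseq] = 1 -> a * tinv a = 1.
Proof.
move=> a1; rewrite -[LHS](@mul1r A) -(mulVt (coef_tinv a1)).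
by rewrite -mulrA (mulrA (tinv a : A) a) mulVt// mul1r.
Qed.

Lemma tinv_eq a b : a [bseq] = 1 -> b * a = 1 -> tinv a = b :> A.
Proof. by move=> a1 ba; rewrite -[LHS](@mul1r A) -ba -mulrA mulrVt// mulr1. Qed.

Lemma tinvM a b : a [bseq] = 1 -> b [bseq] = 1 ->
  tinv (a * b) = (tinv b : A) * tinv a :> A.
Proof.
move=> a1 b1; apply: tinv_eq; first by rewrite coefM0 a1 b1 mulr1.
by rewrite mulrA -(mulrA (tinv b : A)) mulVt// mulr1 mulVt.
Qed.

Lemma tinvK a : a [bseq] = 1 -> tinv (tinv a) = a :> A.
Proof. by move=> a1; apply: tinv_eq; rewrite ?coef_tinv// mulrVt. Qed.

End tensor_ring.

(** Jacobi identity: bracketing by b and then by c, minus the other order, is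
bracketing by [b, c]. *)
Lemma jacobi (V : pzRingType) (x b c : V) :
  (x * b - b * x) * c - c * (x * b - b * x) -
    ((x * c - c * x) * b - b * (x * c - c * x)) =
  x * (b * c - c * b) - (b * c - c * b) * x.
Proof.
rewrite !(mulrBl, mulrBr) !mulrA !opprD !opprK !addrA.
rewrite [LHS](ACl (1*5*8*4*(2*7)*(3*6)))/= addNr addr0 addNr addr0.
by rewrite -!addrA; congr (_ + (_ + _)); rewrite addrC.
Qed.

(** * Brackets, the Dynkin operator and the grading *)

Section lie.
Context {R : realType} {d N : nat}.
Local Notation A := (tens R d N).
Implicit Types a b c : A.
Local Notation ins := (@insub_bseq N 'I_d).
Local Notation lie := (@free_nilpotent_lie R d N).

(** The basis tensor of a word; it vanishes for words longer than N, which
makes [wordM] hold without side condition. *)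
Definition word (v : seq 'I_d) : A :=
  [ffun w : N.-bseq 'I_d => (val w == v)%:R].

Lemma tletterE i : tletter i = word [:: i]. Proof. by []. Qed.

Lemma word_nil : word [::] = 1.
Proof. by apply/ffunP => w; rewrite !ffunE -size_eq0. Qed.

Lemma word_deg v : deg_ge (size v) (word v).
Proof.
move=> w wv; rewrite ffunE; case: eqP => // e.
by rewrite -e ltnn in wv.
Qed.

Lemma word_big v : (N < size v)%N -> word v = 0.
Proof.
by move=> Nv; apply: deg_ge_eq0; apply: deg_ge_le Nv _; exact: word_deg.
Qed.

Lemma wordM u v : word u * word v = word (u ++ v).
Proof.
apply/ffunP => w; rewrite tens_coefM.
rewrite (eq_bigr (fun i : 'I_(size w).+1 =>
  ((take i w == u) && (drop i w == v))%:R)); last first.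
  move=> i _; have sw := size_bseq w.
  have st : (size (take i w) <= N)%N.
    by rewrite (leq_trans _ sw)// size_take_min geq_minr.
  have sd : (size (drop i w) <= N)%N.
    by rewrite size_drop (leq_trans (leq_subr _ _)).
  by rewrite !ffunE (insE st) (insE sd) -natrM mulnb.
rewrite [RHS]ffunE; case: eqP => [we|we].
  have uw : (size u < (size w).+1)%N by rewrite we size_cat ltnS leq_addr.
  rewrite (bigD1 (Ordinal uw))//= [_ && _](_ : _ = true); last first.
    by rewrite we take_size_cat// drop_size_cat// !eqxx.
  rewrite big1 ?addr0// => i iu.
  case: eqP => //= tw; case/eqP: iu; apply/val_inj => /=.
  by rewrite -tw size_takel// -ltnS.
rewrite big1// => i _; case: eqP => //= tw; case: eqP => //= dw.
by case: we; rewrite -tw -dw cat_take_drop.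
Qed.

Lemma word_decomp a : a = \sum_(w : N.-bseq 'I_d) a w *: word w.
Proof.
apply/ffunP => v; rewrite sum_ffunE (bigD1 v)//= !ffunE eqxx /GRing.scale/= mulr1.
rewrite big1 ?addr0// => w wv; rewrite !ffunE.
by rewrite eq_sym -val_eqE in wv; rewrite (negbTE wv) /GRing.scale/= mulr0.
Qed.

(** The derivation delta that generates the dilations. *)
Definition grade a : A := [ffun w : N.-bseq 'I_d => (size w)%:R * a w].

Lemma grade_linear : linear grade.
Proof.
move=> k a b; apply/ffunP => w; rewrite !ffunE /GRing.scale/=; ring.
Qed.
HB.instance Definition _ := GRing.isLinear.Build R A A *:%R grade grade_linear.

Lemma gradeM a b : grade (a * b) = grade a * b + a * grade b.
Proof.
apply/ffunP => w; rewrite ffunE [RHS]ffunE !tens_coefM mulr_sumr -big_split/=.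
apply: eq_bigr => i _; have iw : (i <= size w)%N by rewrite -ltnS.
rewrite !ffunE size_take_ins// size_drop_ins natrB//; ring.
Qed.

Lemma grade1 : grade 1 = 0.
Proof.
by apply/ffunP => w; rewrite !ffunE; case: (size w) => [|n]; rewrite ?mul0r ?mulr0.
Qed.

Lemma grade_letter i : grade (word [:: i]) = word [:: i].
Proof.
apply/ffunP => w; rewrite !ffunE; case: eqP => [->|_]; rewrite ?mulr0//=.
by rewrite mulr1.
Qed.

(** The left-nested bracket [..[[i1, i2], i3].., in] of the word i1 .. in,
with the word given in reverse order. *)
Fixpoint rbracket (w : seq 'I_d) : A :=
  match w with
  | [::] => 0
  | [:: i] => word [:: i]
  | i :: w' => rbracket w' * word [:: i] - word [:: i] * rbracket w'
  end.

Lemma rbracket_cons i w :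
  rbracket (i :: w) = rbracket w * word [:: i] - word [:: i] * rbracket w
    + (w == [::])%:R *: word [:: i].
Proof.
by case: w => [|j w]; rewrite /rbracket /= ?scale0r ?addr0// mul0r mulr0 subrr scale1r add0r.
Qed.

Arguments rbracket : simpl never.

(** The Dynkin operator, which replaces each word by its left-nested bracket.
*)
Definition dynkin_op a : A := \sum_(w : N.-bseq 'I_d) a w *: rbracket (rev w).

Lemma dynkin_linear : linear dynkin_op.
Proof.
move=> k a b; rewrite /dynkin_op scaler_sumr -big_split/=; apply: eq_bigr => w _.
by rewrite !ffunE scalerDl scalerA.
Qed.
HB.instance Definition _ := GRing.isLinear.Build R A A *:%R dynkin_op dynkin_linear.

Lemma rbracket_deg w : deg_ge (size w) (rbracket w).
Proof.
elim: w => [|i w IH]; first exact: deg_ge00.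
rewrite rbracket_cons; apply: deg_geD; last first.
  case: w {IH} => [|j w]; last by rewrite scale0r; exact: deg_ge0.
  by apply: deg_geZ; exact: word_deg.
apply: deg_geB; last first. exact: (deg_geM (@word_deg [:: i]) IH).
by have := deg_geM IH (@word_deg [:: i]); rewrite addn1.
Qed.

Lemma dynkin_word w : dynkin_op (word w) = rbracket (rev w).
Proof.
have [Nw|wN] := ltnP N (size w).
  rewrite word_big// linear0; apply/esym/deg_ge_eq0.
  by apply: deg_ge_le Nw _; rewrite -size_rev; exact: rbracket_deg.
rewrite /dynkin_op (bigD1 (Bseq wN))//= ffunE eqxx scale1r big1 ?addr0// => v vw.
by rewrite ffunE -val_eqE in vw *; rewrite (negbTE vw) scale0r.
Qed.

Lemma dynkin1 : dynkin_op 1 = 0.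
Proof. by rewrite -word_nil dynkin_word. Qed.

Lemma word_coef0 w : word w [bseq] = (w == [::])%:R.
Proof. by rewrite ffunE eq_sym. Qed.

Lemma dynkin_letter a i :
  dynkin_op (a * word [:: i]) =
  dynkin_op a * word [:: i] - word [:: i] * dynkin_op a + a [bseq] *: word [:: i].
Proof.
rewrite [in LHS](word_decomp a) [in dynkin_op a](word_decomp a) -[_ a [bseq]]/(a [bseq]).
have -> : a [bseq] = \sum_(w : N.-bseq 'I_d) a w * word w [bseq].
  rewrite [in LHS](word_decomp a) sum_ffunE; apply: eq_bigr => w _.
  by rewrite ffunE.
rewrite mulr_suml !linear_sum mulr_suml mulr_sumr -sumrB scaler_suml -big_split/=.
apply: eq_bigr => w _; rewrite -scalerAl !linearZ/= wordM !dynkin_word.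
rewrite cats1 rev_rcons rbracket_cons -scalerAl -scalerAr -scalerBr -scalerA.
rewrite word_coef0 -scalerDr; congr (_ *: (_ + _ *: _)).
by rewrite -[in RHS](revK w); case: (rev w) => [|j v]//; rewrite rev_cons; case: (rev v).
Qed.

Definition vec (v : 'I_d -> R) : A := \sum_i v i *: word [:: i].

(** Appending a letter to a nonempty word brackets with that letter; the empty
word contributes the letter itself. *)
Lemma dynkin_vec a v :
  dynkin_op (a * vec v) = dynkin_op a * vec v - vec v * dynkin_op a + a [bseq] *: vec v.
Proof.
rewrite /vec mulr_sumr linear_sum mulr_sumr mulr_suml scaler_sumr -sumrB.
rewrite -big_split/=; apply: eq_bigr => i _.
by rewrite -scalerAr linearZ/= dynkin_letter !scalerDr scalerN -scalerAr -scalerAl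
  !scalerA (mulrC (v i)).
Qed.

Lemma lie_deg1 a : lie a -> deg_ge 1 a.
Proof.
elim=> {a} [i||a b _ ha _ hb|k a _ ha|a b _ ha _ hb].
- exact: (@word_deg [:: i]).
- exact: deg_ge0.
- exact: deg_geD.
- exact: deg_geZ.
- exact: (deg_geB (deg_geMr b ha) (deg_geMr a hb)).
Qed.

Lemma lie_bracket a b : lie a -> lie b -> lie (a * b - b * a).
Proof. exact: FnLie_bracket. Qed.

Lemma lieN a : lie a -> lie (- a).
Proof. by move=> ha; rewrite -scaleN1r; exact: FnLie_Z. Qed.

Lemma lie_sum (J : Type) (r : seq J) (Q : pred J) (F : J -> A) :
  (forall j, Q j -> lie (F j)) -> lie (\sum_(j <- r | Q j) F j).
Proof.
move=> FJ; elim/big_ind: _ => //; [exact: FnLie_0|move=> *; exact: FnLie_D].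
Qed.

Lemma lie_rbracket w : lie (rbracket w).
Proof.
elim: w => [|i w IH]; first exact: FnLie_0.
rewrite rbracket_cons; apply: FnLie_D; last by apply: FnLie_Z; exact: FnLie_letter.
by apply: lie_bracket => //; exact: FnLie_letter.
Qed.

Lemma lie_dynkin a : lie (dynkin_op a).
Proof. by apply: lie_sum => w _; apply: FnLie_Z; exact: lie_rbracket. Qed.

Lemma lie_vec v : lie (vec v).
Proof. by apply: lie_sum => i _; apply: FnLie_Z; exact: FnLie_letter. Qed.

(** On tensors without constant term, right multiplication by a Lie element c
becomes bracketing with c. For letters this is the definition of the Dynkin
operator, and brackets are handled by the Jacobi identity. *)
Lemma dynkin_mul_lie c : lie c -> forall a, a [bseq] = 0 ->
  dynkin_op (a * c) = dynkin_op a * c - c * dynkin_op a.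
Proof.
elim=> {c} [i||b c lb IHb lc IHc|k c lc IHc|b c lb IHb lc IHc] a a0.
- by rewrite tletterE dynkin_letter a0 scale0r addr0.
- rewrite -[X in a * X]/(0 : A) -[X in _ * X - _]/(0 : A).
  rewrite -[X in _ = _ - X * _]/(0 : A).
  by rewrite !mulr0 mul0r linear0 subr0.
- rewrite -[b + c]/((b : A) + (c : A)).
  rewrite mulrDr linearD/= IHb// IHc// mulrDr mulrDl opprD addrACA; by [].
- rewrite -[k *: c]/(k *: (c : A)).
  by rewrite -scalerAr linearZ/= IHc// scalerBr scalerAr scalerAl.
- rewrite -[tmul b c - _]/((b : A) * (c : A) - (c : A) * (b : A)).
  have ab0 (e : A) : (a * e) [bseq] = 0 by rewrite coefM0 a0 mul0r.
  rewrite mulrBr linearB/= !mulrA IHc ?ab0// IHb// IHb ?ab0// IHc//.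
  exact: jacobi.
Qed.

End lie.

(** * The free nilpotent group *)

Section group.
Context {R : realType} {d N : nat}.
Local Notation A := (tens R d N).
Implicit Types a b c g : A.
Local Notation lie := (@free_nilpotent_lie R d N).
Local Notation G := (@free_nilpotent_group R d N).

(** The Dynkin-Specht-Wever theorem. By [dynkin_mul_lie] the Dynkin operator
is a derivation of the Lie algebra, as [grade] is, and the two agree on
letters. *)
Lemma dynkin_specht_wever c : lie c -> dynkin_op c = grade c.
Proof.
elim=> {c} [i||b c lb IHb lc IHc|k c lc IHc|b c lb IHb lc IHc].
- by rewrite tletterE dynkin_word grade_letter.
- by rewrite -[X in dynkin_op X]/(0 : A) !linear0.
- by rewrite -[b + c]/((b : A) + (c : A)) !linearD/= IHb IHc.
- by rewrite -[k *: c]/(k *: (c : A)) !linearZ/= IHc.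
- rewrite -[tmul b c - _]/((b : A) * (c : A) - (c : A) * (b : A)).
  have b0 := (deg_ge1P _).1 (lie_deg1 lb); have c0 := (deg_ge1P _).1 (lie_deg1 lc).
  rewrite !linearB/= !dynkin_mul_lie// !gradeM IHb IHc.
  rewrite !opprB !opprD !addrA.
  by rewrite [RHS](ACl (1*4*2*3)).
Qed.

Lemma grade_rbracket w : grade (rbracket w : A) = (size w)%:R *: rbracket w.
Proof.
elim: w => [|i w IH]; first by rewrite linear0 scaler0.
rewrite rbracket_cons; case: w IH => [|j w] IH.
  by rewrite !mul0r !mulr0 subrr add0r !scale1r grade_letter.
rewrite scale0r addr0 linearB/= !gradeM IH !grade_letter.
rewrite -scalerAl -scalerAr -[in RHS]natr1 scalerDl scale1r scalerBr.
by rewrite opprD [X in _ + X = _]addrC addrACA.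
Qed.

(** A bracket of n letters is an eigenvector of [grade] for n. *)
Lemma rbracket_homog w (v : N.-bseq 'I_d) : size v != size w ->
  (rbracket w : A) v = 0.
Proof.
move=> vw; have := congr1 (fun a : A => a v) (grade_rbracket w).
rewrite /= !ffunE => /eqP; rewrite /GRing.scale/= -subr_eq0 -mulrBl mulf_eq0.
by rewrite subr_eq0 eqr_nat (negbTE vw) => /eqP.
Qed.

Definition homog_part n a : A := [ffun w : N.-bseq 'I_d => if size w == n then a w else 0].

(** The degree-n part of the Dynkin-Specht-Wever theorem: it writes the
homogeneous parts of Lie elements explicitly in brackets, the coefficients
being, up to a factor, the coordinates. *)
Lemma homog_partE n a : lie a ->
  n%:R *: homog_part n a =
  \sum_(w : N.-bseq 'I_d | size w == n) a w *: rbracket (rev w).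
Proof.
move=> la; apply/ffunP => v; rewrite !ffunE /GRing.scale/= sum_ffunE.
have [vn|vn] := eqVneq.
  have := congr1 (fun a : A => a v) (dynkin_specht_wever la).
  rewrite /= [RHS]ffunE vn => <-.
  rewrite sum_ffunE [LHS](bigID (fun w : N.-bseq 'I_d => size w == n))/=.
  rewrite [X in _ + X]big1 ?addr0// => w wn.
  by rewrite ffunE rbracket_homog ?scaler0// size_rev vn eq_sym.
rewrite mulr0 big1// => w /eqP wn.
by rewrite ffunE rbracket_homog ?scaler0// size_rev wn.
Qed.

Lemma lie_homog_part n a : (0 < n)%N -> lie a -> lie (homog_part n a).
Proof.
move=> n0 la; have -> : homog_part n a = n%:R^-1 *: (n%:R *: homog_part n a).
  by rewrite scalerA mulVf ?scale1r// pnatr_eq0 -lt0n.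
rewrite homog_partE//; apply: FnLie_Z; apply: lie_sum => w _; apply: FnLie_Z.
exact: lie_rbracket.
Qed.

Definition exp_term a k : A := (k`!%:R)^-1 *: a ^+ k.
(** The exponential of t a as a polynomial in a formal time t. The formal
derivative turns identities between exponentials into recursions on
coefficients. *)
Definition exp_poly a : {poly A} := \poly_(k < N.+1) exp_term a k.

Lemma exp_term_big a k : deg_ge 1 a -> (N < k)%N -> exp_term a k = 0.
Proof. by move=> ha Nk; rewrite /exp_term nilpotent// scaler0. Qed.

Lemma coef_exp_poly a k : deg_ge 1 a -> (exp_poly a)`_k = exp_term a k.
Proof.
by move=> ha; rewrite coef_poly ltnS; case: leqP => // kN; rewrite exp_term_big.
Qed.

Lemma exp_termS a k : exp_term a k.+1 *+ k.+1 = exp_term a k * a.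
Proof.
rewrite /exp_term -scaler_nat scalerA factS natrM invfM mulrA.
by rewrite divff ?pnatr_eq0// mul1r exprSr scalerAl.
Qed.

Lemma exp_term_comm a k : a * exp_term a k = exp_term a k * a.
Proof. by rewrite /exp_term -scalerAr -scalerAl -exprS -exprSr. Qed.

Lemma deriv_exp_poly a : deg_ge 1 a -> (exp_poly a)^`() = exp_poly a * a%:P.
Proof.
by move=> ha; apply/polyP => k; rewrite coef_deriv coefMC !coef_exp_poly// exp_termS.
Qed.

Lemma exp_poly_comm a : deg_ge 1 a -> exp_poly a * a%:P = a%:P * exp_poly a.
Proof.
by move=> ha; apply/polyP => k; rewrite coefMC coefCM !coef_exp_poly// exp_term_comm.
Qed.

Lemma horner_exp_poly a : (exp_poly a).[1] = texp a :> A.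
Proof.
by rewrite texpE horner_poly; apply: eq_bigr => k _; rewrite expr1n mulr1.
Qed.

Lemma mulrn_inj (x y : A) k : x *+ k.+1 = y -> x = (k.+1%:R)^-1 *: y.
Proof. by move=> <-; rewrite -(@scaler_nat R A) scalerA mulVf ?pnatr_eq0// scale1r. Qed.

(** H = e^(-ta) e^(ta) satisfies H' = [H, a] and H(0) = 1, which forces all
higher coefficients to vanish. *)
Lemma exp_polyNM a : deg_ge 1 a -> exp_poly (- a) * exp_poly a = 1.
Proof.
move=> ha; have hN := deg_geN ha; set H := _ * _.
have dH : H^`() = H * a%:P - a%:P * H.
  rewrite derivM !deriv_exp_poly// (exp_poly_comm hN) polyCN -mulrA.
  by rewrite mulNr !mulrA addrC.
have H0 : H`_0 = 1.
  by rewrite coef0M !coef_exp_poly// /exp_term !expr0 !invr1 !scale1r mul1r.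
apply/polyP => k; rewrite poly.coef1; case: k => // k.
elim: k => [|k IH]; have := congr1 (fun p : {poly A} => p`_0) dH => /=.
  rewrite coef_deriv coefB coefMC coefCM H0 mulr1 mul1r subrr => /mulrn_inj ->.
  by rewrite scaler0.
move=> _; have := congr1 (fun p : {poly A} => p`_k.+1) dH => /=.
rewrite coef_deriv coefB coefMC coefCM IH mulr0 mul0r subr0 => /mulrn_inj ->.
by rewrite scaler0.
Qed.

(** The equation F' = [F, a] + c determines each coefficient of F as a
multiple of a Lie expression in the preceding one. *)
Lemma lie_poly_ode a c (F : {poly A}) : lie a -> lie c -> lie F`_0 ->
  F^`() = F * a%:P - a%:P * F + c%:P -> lie F.[1].
Proof.
move=> la lc F0 dF; have Fk k : lie F`_k.
  elim: k => // k IH; have := congr1 (fun p : {poly A} => p`_k) dF => /=.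
  rewrite coef_deriv coefD coefB coefMC coefCM coefC => /mulrn_inj ->.
  apply: FnLie_Z; apply: FnLie_D; first exact: lie_bracket.
  by case: ifP => // _; exact: FnLie_0.
by rewrite horner_coef; apply: lie_sum => k _; rewrite expr1n mulr1.
Qed.

Lemma hornerM1 (p q : {poly A}) : (p * q).[1] = p.[1] * q.[1].
Proof. by rewrite hornerM_comm//; rewrite /comm_poly mulr1 mul1r. Qed.

Lemma texpNM a : deg_ge 1 a -> (texp (- a) : A) * texp a = 1.
Proof. by move=> ha; rewrite -!horner_exp_poly -hornerM1 exp_polyNM// hornerC. Qed.

Lemma texpMN a : deg_ge 1 a -> (texp a : A) * texp (- a) = 1.
Proof. by move=> ha; rewrite -{1}[a]opprK texpNM//; exact: deg_geN. Qed.

Lemma texp_deg a n : deg_ge n.+1 a -> deg_ge n.+1 ((texp a : A) - 1).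
Proof.
move=> ha; rewrite texpE big_ord_recl/= expr0 fact0 invr1 scale1r [1 + _]addrC addrK.
apply: deg_ge_sum => k _; apply: deg_geZ; rewrite /bump leq0n add1n exprS.
exact: deg_geMr.
Qed.

Lemma coef_texp a : deg_ge 1 a -> (texp a : A) [bseq] = 1.
Proof.
move=> /texp_deg/deg_ge1P; rewrite ffunE [X in _ + X]ffunE coef_one => /eqP.
by rewrite subr_eq0 => /eqP.
Qed.

(** e^(-ta) c e^(ta) solves F' = [F, a]. *)
Lemma lie_conj_texp a c : lie a -> lie c -> lie ((texp (- a) : A) * c * texp a).
Proof.
move=> la lc; have ha := lie_deg1 la; have hN := deg_geN ha.
rewrite -!horner_exp_poly -(hornerC c 1) -!hornerM1.
apply: (@lie_poly_ode a (0 : A) _ la); first exact: FnLie_0.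
  rewrite !coef0M !coef_exp_poly// /exp_term coefC/= !expr0 !invr1 !scale1r.
  by rewrite mul1r mulr1.
rewrite polyC0 addr0 !derivM derivC mulr0 addr0 !deriv_exp_poly//.
by rewrite (exp_poly_comm hN) polyCN !mulNr !mulrA addrC.
Qed.

(** e^(-ta) delta(e^(ta)) solves F' = [F, a] + delta(a). *)
Lemma lie_maurer_cartan a : lie a -> lie ((texp (- a) : A) * grade (texp a : A)).
Proof.
move=> la; have ha := lie_deg1 la; have hN := deg_geN ha.
pose GE := \poly_(k < N.+1) grade (exp_term a k).
have GEk k : GE`_k = grade (exp_term a k).
  rewrite coef_poly ltnS; case: leqP => // kN.
  by rewrite exp_term_big// linear0.
have -> : grade (texp a : A) = GE.[1].
  rewrite texpE linear_sum horner_poly; apply: eq_bigr => k _.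
  by rewrite expr1n mulr1.
have lg : lie (grade a) by rewrite -dynkin_specht_wever//; exact: lie_dynkin.
rewrite -horner_exp_poly -hornerM1; apply: (lie_poly_ode la lg).
  rewrite coef0M GEk /exp_term expr0 invr1 scale1r grade1 mulr0.
  exact: FnLie_0.
have dGE : GE^`() = GE * a%:P + exp_poly a * (grade a)%:P.
  apply/polyP => k; rewrite coef_deriv coefD !coefMC !GEk coef_exp_poly//.
  by rewrite -raddfMn/= exp_termS gradeM.
rewrite derivM dGE deriv_exp_poly// (exp_poly_comm hN) polyCN !mulNr !mulrDr.
by rewrite !mulrA exp_polyNM// mul1r addrA; congr (_ + _); rewrite addrC.
Qed.

(** The logarithmic derivative of g along dilations is Lie. This condition is
stable under products for simple reasons and turns out to characterise the
group, which is how the Baker-Campbell-Hausdorff formula is avoided. *)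
Definition grouplike g := g [bseq] = 1 /\ exists2 c, lie c & grade g = g * c.

Lemma grouplike_texp a : lie a -> grouplike (texp a).
Proof.
move=> la; have ha := lie_deg1 la; split; first exact: coef_texp.
exists ((texp (- a) : A) * grade (texp a : A)); first exact: lie_maurer_cartan.
by rewrite mulrA texpMN// mul1r.
Qed.

(** Leibniz rule for delta: the logarithmic derivative of g e^a is that of e^a
plus the conjugate by e^a of that of g. *)
Lemma grouplike_mul_texp g a : grouplike g -> lie a -> grouplike (g * texp a).
Proof.
move=> [g1 [c lc gc]] la; have ha := lie_deg1 la.
have [e1 [b lb eb]] := grouplike_texp la.
split; first by rewrite coefM0 g1 e1 mulr1.
exists ((texp (- a) : A) * c * texp a + b).
  by apply: FnLie_D => //; exact: lie_conj_texp.
rewrite gradeM gc eb mulrDr !mulrA; congr (_ + _).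
by rewrite -!mulrA (mulrA (texp a : A) (texp (- a))) texpMN// mul1r.
Qed.

(** Here c and delta(r) differ by r c, whose degree is at least that of r plus
that of c, and delta multiplies the part of degree n + 1 by n + 1. *)
Lemma grouplike_lead n r c : lie c -> deg_ge n.+1 r -> grade (1 + r) = (1 + r) * c ->
  deg_ge n.+1 c /\ deg_ge n.+2 (n.+1%:R *: r - c).
Proof.
move=> lc hr; rewrite linearD/= grade1 add0r mulrDl mul1r => e.
have hg : deg_ge n.+1 (grade r) by move=> w wn; rewrite ffunE hr// mulr0.
have hc : deg_ge n.+1 c.
  have -> : c = grade r - r * c by rewrite e addrK.
  by apply: deg_geB => //; exact: deg_geMr.
split=> // w; rewrite ltnS => wn.
have hrc : (r * c) w = 0.
  by have := deg_geM hr hc; apply; rewrite (leq_ltn_trans wn)// addSn ltnS leq_addl.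
have := congr1 (fun a : A => a w) e; rewrite /= [LHS]ffunE [RHS]ffunE hrc addr0 => rc.
rewrite !ffunE -rc /GRing.scale/=; move: wn; rewrite leq_eqVlt => /predU1P[->|wn].
  by rewrite subrr.
by rewrite hr// !mulr0 subrr.
Qed.

Lemma expD_deg n a c k : deg_ge 1 a -> deg_ge n.+1 c ->
  deg_ge (n.+1 + k) ((a + c) ^+ k.+1 - a ^+ k.+1).
Proof.
move=> ha hc; elim: k => [|k IH]; first by rewrite !expr1 addn0 addrC addKr.
have -> : (a + c) ^+ k.+2 - a ^+ k.+2 =
    (a + c) * ((a + c) ^+ k.+1 - a ^+ k.+1) + c * a ^+ k.+1.
  rewrite [in LHS]exprS [a ^+ k.+2]exprS mulrBr -addrA; congr (_ + _).
  by rewrite mulrDl opprD -addrA addNr addr0.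
apply: deg_geD; last by apply: deg_geM => //; exact: deg_geX.
rewrite addnS -add1n; apply: deg_geM => //; apply: deg_geD => //.
exact: deg_ge_le hc.
Qed.

(** Only the linear term of the series contributes c itself: in the others, c
is multiplied by tensors of degree at least 1. *)
Lemma texpD_deg n a c : deg_ge 1 a -> deg_ge n.+1 c ->
  deg_ge n.+2 ((texp (a + c) : A) - texp a - c).
Proof.
move=> ha hc; rewrite !texpE -sumrB.
have [N0|N0] := posnP N.
  have -> : c = 0 by apply: deg_ge_eq0; apply: deg_ge_le hc; rewrite N0.
  rewrite big1 ?subr0; first exact: deg_ge0.
  by move=> k _; rewrite addr0 subrr.
have N1 : (1 < N.+1)%N by rewrite ltnS.
rewrite (bigD1 (Ordinal N1))//= invr1 !scale1r !expr1 [a + c]addrC addrK.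
rewrite [c + _]addrC addrK; apply: deg_ge_sum => -[[|[|k]] kN]//= _.
  by rewrite !expr0 subrr; exact: deg_ge0.
rewrite -scalerBr; apply: deg_geZ; rewrite [c + a]addrC.
apply: deg_ge_le (@expD_deg n a c k.+1 ha hc).
by rewrite addnS ltnS leq_addr.
Qed.

(** The logarithm is built degree by degree: if g e^(-Z) = 1 + r with r of
degree at least n + 1, the lowest-degree part c of r is Lie by
[grouplike_lead], and Z + c agrees with the logarithm one degree further. *)
Lemma grouplike_group g : grouplike g -> G g.
Proof.
move=> gg; have g1 := gg.1.
suff /(_ N)[Z lZ gZ] : forall n, exists2 Z : A, lie Z & deg_ge n.+1 (g * texp (- Z) - 1).
  exists Z => //; move/deg_ge_eq0/eqP: gZ; rewrite subr_eq0 => /eqP gZ.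
  by rewrite -[LHS](@mul1r A) -gZ -mulrA texpNM ?mulr1//; exact: lie_deg1.
elim=> [|n [Z lZ hZ]].
  exists 0; first exact: FnLie_0.
  rewrite -[X in texp (- X)]/(0 : A) oppr0.
  by rewrite [texp _]texp0 -[tone]/(1 : A) mulr1; exact: subr1_deg_ge1.
have hZ1 := lie_deg1 lZ.
have [_ [L lL gL]] := grouplike_mul_texp gg (lieN lZ).
set r := _ - 1 in hZ; have e : g * texp (- Z) = 1 + r by rewrite addrC subrK.
clearbody r.
rewrite e in gL; have [hL hrL] := grouplike_lead lL hZ gL.
pose c := (n.+1%:R)^-1 *: homog_part n.+1 L.
have lc : lie c by apply: FnLie_Z; exact: lie_homog_part.
have hrc : deg_ge n.+2 (r - c).
  move=> w wn; have := hrL w wn; rewrite !ffunE /GRing.scale/= => /eqP.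
  rewrite subr_eq0 => /eqP <-; case: eqP => [_|/eqP wn1].
    by rewrite mulKf ?pnatr_eq0// subrr.
  by rewrite mulr0 subr0 hZ// ltn_neqAle wn1.
have hc : deg_ge n.+1 c.
  apply: deg_geZ => w wn; rewrite ffunE; case: eqP => // wn1.
  by rewrite wn1 ltnn in wn.
exists (Z + c); first exact: FnLie_D.
have -> : g * texp (- (Z + c)) - 1 =
    g * ((texp (- Z - c) : A) - texp (- Z) - (- c)) + (r - c) - (g - 1) * c.
  rewrite opprD !mulrBr e mulrN opprK mulrBl mul1r.
  set X := g * _; set Y := g * c.
  rewrite opprB -addrA subrKA [X - _ + Y + _]addrA [X - _ + Y + r]addrAC addrK.
  by rewrite opprD addrA subrK.
apply: deg_geB; last first.
  by rewrite -[n.+2]add1n; apply: deg_geM => //; exact: subr1_deg_ge1.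
apply: deg_geD => //; apply: deg_geMl.
by apply: texpD_deg; [exact: deg_geN|exact: deg_geN].
Qed.

Lemma group_grouplike g : G g -> grouplike g.
Proof. by move=> [a la <-]; exact: grouplike_texp. Qed.

Lemma group_coef g : G g -> g [bseq] = 1.
Proof. by move=> /group_grouplike[]. Qed.

(** The Baker-Campbell-Hausdorff property of the free nilpotent Lie algebra.
*)
Lemma groupM g h : G g -> G h -> G ((g : A) * (h : A)).
Proof.
move=> Gg [a la <-]; apply: grouplike_group; apply: grouplike_mul_texp => //.
exact: group_grouplike.
Qed.

Lemma tinv_texp a : lie a -> tinv (texp a) = texp (- a).
Proof.
by move=> la; apply: tinv_eq; [exact/coef_texp/lie_deg1|exact/texpNM/lie_deg1].
Qed.

Lemma groupV g : G g -> G (tinv g).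
Proof. by move=> [a la <-]; exists (- a); [exact: lieN|rewrite tinv_texp]. Qed.

Lemma group1 : G (1 : A).
Proof. by exists 0; [exact: FnLie_0|exact: texp0]. Qed.

(** In lowest degree, [grouplike_lead] identifies g - 1 with a multiple of a
Lie element, and [homog_partE] expands the latter in brackets. *)
Lemma group_lead n g : G g -> deg_ge n.+1 (g - 1 : A) ->
  deg_ge n.+2 (g - 1 - (n.+1%:R)^-1 *:
    \sum_(w : N.-bseq 'I_d | size w == n.+1) (g : A) w *: rbracket (rev w) : A).
Proof.
move=> /group_grouplike[g1 [c lc gc]]; set r : A := g - 1 => hr.
have e : g = 1 + r by rewrite addrC subrK.
rewrite e in gc; have [hc hrc] := grouplike_lead lc hr gc.
have n0 : n.+1%:R != 0 :> R by rewrite pnatr_eq0.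
have gr (w : N.-bseq 'I_d) : size w = n.+1 -> (g : A) w = r w.
  by move=> wn; rewrite e !ffunE wn add0r.
clearbody r.
have cr (w : N.-bseq 'I_d) : size w = n.+1 -> c w = n.+1%:R * (g : A) w.
  move=> wn; have := hrc w; rewrite wn ltnSn => /(_ isT) /eqP.
  by rewrite !ffunE /GRing.scale/= subr_eq0 => /eqP <-; rewrite gr.
have -> : \sum_(w : N.-bseq 'I_d | size w == n.+1) (g : A) w *: rbracket (rev w) =
    homog_part n.+1 c.
  apply: (scalerI n0); rewrite homog_partE// scaler_sumr; apply: eq_bigr => w /eqP wn.
  by rewrite scalerA cr.
move=> w wn; have := hrc w wn.
rewrite !ffunE /GRing.scale/= => /eqP; rewrite subr_eq0 => /eqP rc.
case: eqP => [_|/eqP wn1]; first by rewrite -rc mulKf// subrr.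
by rewrite mulr0 subr0 hr// ltn_neqAle wn1.
Qed.

End group.

(** * A norm on tensors *)

Section norm.
Context {R : realType} {d N : nat}.
Local Notation A := (tens R d N).
Implicit Types a b c g : A.

(** The l1 norm of the coordinates, which is submultiplicative. *)
Definition nrm a : R := \sum_w `|a w|.

Lemma nrm_ge0 a : 0 <= nrm a.
Proof. by apply: sumr_ge0. Qed.

Lemma coef_le_nrm a w : `|a w| <= nrm a.
Proof. by rewrite /nrm (bigD1 w)//= lerDl sumr_ge0. Qed.

Lemma nrm0 : nrm 0 = 0.
Proof. by rewrite /nrm big1// => w _; rewrite ffunE normr0. Qed.

Lemma nrmD a b : nrm (a + b) <= nrm a + nrm b.
Proof.
by rewrite /nrm -big_split; apply: ler_sum => w _; rewrite ffunE ler_normD.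
Qed.

Lemma nrmN a : nrm (- a) = nrm a.
Proof. by apply: eq_bigr => w _; rewrite ffunE normrN. Qed.

Lemma nrmB a b : nrm (a - b) <= nrm a + nrm b.
Proof. by rewrite -[nrm b]nrmN nrmD. Qed.

Lemma nrmZ (k : R) a : nrm (k *: a) = `|k| * nrm a.
Proof.
by rewrite /nrm mulr_sumr; apply: eq_bigr => w _; rewrite ffunE normrM.
Qed.

Lemma nrm_sum (J : Type) (r : seq J) (Q : pred J) (F : J -> A) :
  nrm (\sum_(j <- r | Q j) F j) <= \sum_(j <- r | Q j) nrm (F j).
Proof.
elim/big_ind2 : _ => //; first by rewrite nrm0.
by move=> x1 x2 y1 y2 h1 h2; rewrite (le_trans (nrmD _ _))// lerD.
Qed.

Lemma nrm_word w : nrm (word w : A) <= 1.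
Proof.
have [Nw|wN] := ltnP N (size w); first by rewrite word_big// nrm0.
rewrite /nrm (bigD1 (Bseq wN))//= ffunE eqxx normr1 big1 ?addr0// => v vw.
by rewrite ffunE -val_eqE in vw *; rewrite (negbTE vw) normr0.
Qed.

Lemma nrmM a b : nrm (a * b) <= nrm a * nrm b.
Proof.
rewrite {1}(word_decomp a) {1}(word_decomp b) mulr_suml (le_trans (nrm_sum _ _ _))//.
rewrite mulr_suml; apply: ler_sum => u _.
rewrite mulr_sumr (le_trans (nrm_sum _ _ _))// mulr_sumr; apply: ler_sum => v _.
rewrite -scalerAl -scalerAr wordM scalerA nrmZ normrM.
by rewrite -[leRHS]mulr1 ler_wpM2l// nrm_word.
Qed.

Lemma nrm_linear (f : {linear A -> A}) :
  exists2 C, 0 <= C & forall a, nrm (f a) <= C * nrm a.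
Proof.
exists (\sum_(w : N.-bseq 'I_d) nrm (f (word w))).
  by apply: sumr_ge0 => w _; exact: nrm_ge0.
move=> a; rewrite {1}(word_decomp a) linear_sum (le_trans (nrm_sum _ _ _))// mulr_suml.
apply: ler_sum => w _; rewrite linearZ/= nrmZ mulrC ler_wpM2l ?nrm_ge0//.
exact: coef_le_nrm.
Qed.

Lemma nrm_vec (v : 'I_d -> R) : nrm (vec v : A) <= \sum_i `|v i|.
Proof.
rewrite (le_trans (nrm_sum _ _ _))//; apply: ler_sum => i _.
by rewrite nrmZ -[leRHS]mulr1 ler_wpM2l// nrm_word.
Qed.

End norm.

Lemma common_delta {R : realType} (I : finType) (Q : I -> R -> R -> Prop) :
  (forall i, exists2 dl : R, 0 < dl & forall u v, v - u < dl -> Q i u v) ->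
  exists2 dl : R, 0 < dl & forall u v, v - u < dl -> forall i, Q i u v.
Proof.
move=> H; have {}H i : {dl : R | 0 < dl & forall u v, v - u < dl -> Q i u v}.
  by apply: cid2; exact: H.
exists (\big[Num.min/1]_i (s2val (H i))).
  by apply/bigmin_gtP; split=> // i _; case: (H i).
move=> u v uv i; have := s2valP' (H i); apply; apply: lt_le_trans uv _.
by rewrite (bigminD1 i)//= ge_min lexx.
Qed.

(** * Controls and increments of lower order *)

Section control.
Context {R : realType}.
Implicit Types (w : R -> R -> R) (a b u v z e : R).

Definition control w a b :=
  (forall u v, a <= u -> u <= v -> v <= b -> 0 <= w u v) /\
  (forall u v z, a <= u -> u <= v -> v <= z -> z <= b -> w u v + w v z <= w u z).

Definition ucont (f : R -> R) a b := forall e, 0 < e -> exists2 dl, 0 < dl &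
  forall u v, v - u < dl -> a <= u -> u <= v -> v <= b -> `|f v - f u| <= e.

Definition little_o w a b (r : R -> R -> R) := forall e, 0 < e -> exists2 dl, 0 < dl &
  forall u v, v - u < dl -> a <= u -> u <= v -> v <= b -> r u v <= e * w u v.

Lemma controlD w w' a b : control w a b -> control w' a b ->
  control (fun u v => w u v + w' u v) a b.
Proof.
move=> [w0 wS] [w'0 w'S]; split=> [u v au uv vb|u v z au uv vz zb].
  by rewrite addr_ge0// ?w0 ?w'0.
by rewrite addrACA lerD ?wS ?w'S.
Qed.

Lemma control_sub w a b a' b' : a <= a' -> b' <= b -> control w a b ->
  control w a' b'.
Proof.
move=> aa bb [w0 wS]; split=> [u v au uv vb|u v z au uv vz zb].
  by rewrite w0// ?(le_trans aa)// (le_trans vb).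
by rewrite wS// ?(le_trans aa)// (le_trans zb).
Qed.

Lemma control_le w a b u v u' v' : control w a b ->
  a <= u' -> u' <= u -> u <= v -> v <= v' -> v' <= b -> w u v <= w u' v'.
Proof.
move=> [w0 wS] au uu uv vv vb; have uv' := le_trans uv vv.
apply: (@le_trans _ _ (w u v')).
  rewrite (le_trans _ (wS u v v' _ _ _ _))// ?(le_trans au)//.
  by rewrite lerDl w0// (le_trans au)// (le_trans uu).
rewrite (le_trans _ (wS u' u v' _ _ _ _))//.
by rewrite lerDr w0// (le_trans uv').
Qed.

Lemma control_sum w a b (t : nat -> R) n : control w a b ->
  a <= t 0%N -> t n <= b -> (forall i, (i < n)%N -> t i <= t i.+1) ->
  \sum_(i < n) w (t i) (t i.+1) <= w (t 0%N) (t n).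
Proof.
move=> cw at0 + tS.
have t0i : forall i, (i <= n)%N -> t 0%N <= t i.
  elim=> // i IH; move=> iN; exact: le_trans (IH (ltnW iN)) (tS _ iN).
elim: n tS t0i => [|n IH] tS t0i tb.
  by rewrite big_ord0 cw.1.
have tn := tS n (ltnSn n).
rewrite big_ord_recr/= (le_trans _ (cw.2 _ (t n) _ _ _ _ _))// ?t0i//.
rewrite lerD2r IH// ?(le_trans tn)// => i iN; [apply: tS|apply: t0i];
  exact: leq_trans iN _.
Qed.

(** A local bound by a multiple of a control is a global one: cut [u, v] into
short pieces and add up, since F is subadditive and w is superadditive. *)
Lemma control_chain w a b (K dl : R) (F : R -> R -> R) : control w a b -> 0 < dl ->
  (forall u v z, a <= u -> u <= v -> v <= z -> z <= b -> F u z <= F u v + F v z) ->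
  (forall u v, v - u < dl -> a <= u -> u <= v -> v <= b -> F u v <= K * w u v) ->
  0 <= K ->
  forall u v, a <= u -> u <= v -> v <= b -> F u v <= K * w u v.
Proof.
move=> [w0 wS] dl0 FS Fw K0 u v au uv vb.
have [n nP] : exists n : nat, v - u < n%:R * (dl / 2).
  exists (Num.truncn ((v - u) / (dl / 2))).+1.
  by rewrite -ltr_pdivrMr ?divr_gt0// truncnS_gt.
elim: n v uv vb nP => [|n IH] v uv vb nP.
  by move: nP; rewrite mul0r subr_lt0 ltNge uv.
have [/Fw|dv] := ltP (v - u) dl; first exact.
(* The margin of one half keeps the last piece strictly shorter than dl. *)
set z := v - dl / 2.
have uz : u <= z by rewrite /z; lra.
have zv : z <= v by rewrite /z; lra.
have zb := le_trans zv vb.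
apply: (le_trans (FS _ z _ _ _ _ _)) => //.
apply: (@le_trans _ _ (K * (w u z + w z v))); last by rewrite ler_wpM2l ?wS.
rewrite mulrDr lerD//.
  by apply: IH => //; rewrite /z; move: nP; rewrite -natr1 mulrDl; lra.
by apply: Fw => //; [rewrite /z; lra|exact: le_trans uz].
Qed.

(** Increments that are o(w) add up to at most e w(a, t) for every positive e.
*)
Lemma little_o_const w a b (F : R -> R) : control w a b ->
  little_o w a b (fun u v => `|F v - F u|) ->
  forall t, a <= t -> t <= b -> F t = F a.
Proof.
move=> cw nF t ta tb; apply/eqP; rewrite -subr_eq0 -normr_le0.
have w0 : 0 <= w a t by apply: cw.1.
apply/ler_addgt0Pr => e e0; rewrite add0r.
have e1 : 0 < e / (w a t + 1) by rewrite divr_gt0// ltr_wpDl.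
have [dl dl0 H] := nF _ e1.
have := @control_chain w a b (e / (w a t + 1)) dl (fun u v => `|F v - F u|) cw dl0 _ H (ltW e1).
move=> /(_ _ a t (lexx _) ta tb) K; apply: (le_trans (K _)).
  move=> u v z _ _ _ _; rewrite [leRHS]addrC (le_trans _ (ler_normD _ _))//.
  by rewrite subrKA.
rewrite mulrAC ler_pdivrMr; last by rewrite ltr_wpDl.
by rewrite ler_pM2l// lerDl.
Qed.

End control.

(** * Riemann-Stieltjes integration against paths of bounded variation *)

Lemma real_complete {R : realType} (u : nat -> R) :
  (forall e : R, 0 < e -> exists n0, forall n m, (n0 <= n)%N -> (n0 <= m)%N ->
     `|u n - u m| <= e) ->
  exists l : R, forall e : R, 0 < e -> exists n0, forall n, (n0 <= n)%N -> `|u n - l| <= e.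
Proof.
move=> uC; have /cvg_ex[l ul] : cvgn u.
  apply/cauchy_cvgP/cauchy_ballP => e e0; have e20 : 0 < e / 2 by rewrite divr_gt0.
  have [n0 H] := uC _ e20.
  pose B := u @` [set n | (n0 <= n)%N].
  exists (B, B).
    by split; apply: filterS (nbhs_infty_ge n0) => n n0n; exists n.
  move=> [_ _] [/= [n n0n <-] [m n0m <-]].
  apply: le_lt_trans (H _ _ n0n n0m) _.
  by rewrite ltr_pdivrMr// ltr_pMr// ltr1n.
exists l => e e0; have /cvgrPdist_le/(_ _ e0)[n0 _ H] := ul.
by exists n0 => n n0n; rewrite distrC; apply: H.
Qed.

Section integral.
Context {R : realType}.
Implicit Types (w : R -> R -> R) (f g F : R -> R) (a b u v z e : R).

(** F is an integral of f with respect to g, expressed by its increments and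
without Riemann sums. *)
Definition indefinite_integral w a b f g F :=
  little_o w a b (fun u v => `|F v - F u - f u * (g v - g u)|).

Definition dominated w a b g :=
  forall u v, a <= u -> u <= v -> v <= b -> `|g v - g u| <= w u v.

Definition grid a h (j : nat) : R := a + j%:R * h.

(** Integrates exactly, with respect to g, the step function that freezes f at
the left end of each cell. *)
Definition step_integral f g a h (n : nat) (t : R) : R :=
  \sum_(j < n) f (grid a h j) *
    (g (Num.min t (grid a h j.+1)) - g (Num.min t (grid a h j))).

(** The terms at u and at v cancel in the cells that do not meet [u, v]; in
the others, what remains is the increment of g over the cell clipped to [u,
v]. *)
Lemma step_integral_incr f g a b h n u v : 0 < h -> a <= u -> u <= v -> v <= b ->
  b <= grid a h n ->
  let c j := Num.max u (Num.min v (grid a h j)) in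
  step_integral f g a h n v - step_integral f g a h n u - f u * (g v - g u) =
  \sum_(j < n) (f (grid a h j) - f u) * (g (c j.+1) - g (c j)).
Proof.
move=> h0 au uv vb bn c.
have cE j : g (Num.min v (grid a h j)) - g (Num.min u (grid a h j)) = g (c j) - g u.
  rewrite /c; set t := grid a h j; have [tu|ut] := leP t u.
    by rewrite (min_r (le_trans tu uv)) (max_l tu) !subrr.
  by rewrite max_r// le_min uv ltW.
have c0 : c 0%N = u by rewrite /c /grid mul0r addr0 max_l// ge_min au orbT.
have cn : c n = v by rewrite /c min_l ?max_r// (le_trans vb).
have -> : g v - g u = \sum_(j < n) (g (c j.+1) - g (c j)).
  by rewrite -(big_mkord xpredT (fun j => g (c j.+1) - g (c j)))
    (telescope_sumr (g \o c))//= c0 cn.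
rewrite /step_integral mulr_sumr -!sumrB; apply: eq_bigr => j _.
by have := cE j; have := cE j.+1; rewrite -mulrBr mulrBl => e1 e2; congr (_ * _ - _); lra.
Qed.

(** Only cells meeting [u, v] contribute to the sum in [step_integral_incr],
and at their left ends f is close to f u. *)
Lemma step_integralP w f g a b h n dl e : control w a b -> dominated w a b g ->
  0 < h -> h < dl -> b <= grid a h n -> 0 <= e ->
  (forall u v, v - u < dl -> a <= u -> u <= v -> v <= b -> `|f v - f u| <= e) ->
  forall u v, v - u < dl -> a <= u -> u <= v -> v <= b ->
  `|step_integral f g a h n v - step_integral f g a h n u - f u * (g v - g u)|
    <= e * w u v.
Proof.
move=> cw gw h0 hdl bn e0 fe u v uvdl au uv vb.
rewrite (step_integral_incr f g h0 au uv vb bn).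
pose c j := Num.max u (Num.min v (grid a h j)).
rewrite -[leLHS]/(`|\sum_(j < n) (f (grid a h j) - f u) * (g (c j.+1) - g (c j))|).
have uc j : u <= c j by rewrite /c le_max lexx.
have cv j : c j <= v by rewrite /c ge_max uv ge_min lexx.
have ac j : a <= c j := le_trans au (uc j).
have cb j : c j <= b := le_trans (cv j) vb.
have gS j : grid a h j <= grid a h j.+1.
  by rewrite /grid lerD2l ler_pM2r// ler_nat.
have cS j : c j <= c j.+1.
  rewrite /c ge_max le_max lexx/= le_max; apply/orP; right.
  by rewrite le_min !ge_min lexx/= gS orbT.
apply: (@le_trans _ _ (\sum_(j < n) e * w (c j) (c j.+1))); last first.
  rewrite -mulr_sumr ler_wpM2l//.
  apply: le_trans (control_sum (t := c) cw (ac _) (cb _) (fun i _ => cS i)) _.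
  have -> : c 0%N = u by rewrite /c /grid mul0r addr0 max_l// ge_min au orbT.
  by have -> : c n = v by rewrite /c min_l ?max_r// (le_trans vb).
rewrite (le_trans (ler_norm_sum _ _ _))//; apply: ler_sum => j _; rewrite normrM.
have [cc|cc] := eqVneq (c j) (c j.+1).
  by rewrite -cc subrr normr0 mulr0 mulr_ge0// cw.1.
apply: ler_pM => //; last exact: gw.
have ag : a <= grid a h j by rewrite /grid lerDl mulr_ge0// ltW.
have gv : grid a h j < v.
  rewrite ltNge; apply/negP => vg; case/eqP: cc.
  by rewrite /c !min_l ?(le_trans vg).
have [ug|gu] := leP u (grid a h j).
  apply: fe => //; [|exact: le_trans (ltW gv) vb].
  by rewrite (lt_trans _ uvdl)// ltrD2r.
rewrite distrC; apply: fe => //; [|exact: ltW|exact: le_trans vb].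
apply: le_lt_trans hdl; rewrite lerBlDr addrC leNgt; apply/negP => gu'.
have gu1 : grid a h j.+1 < u by move: gu'; rewrite /grid -natr1 mulrDl mul1r addrA.
case/eqP: cc; rewrite /c !max_l// ge_min.
  by rewrite (ltW gu1) orbT.
by rewrite (ltW gu) orbT.
Qed.


Lemma grid_end a b (n : nat) : a <= b ->
  b <= grid a n.+1%:R^-1 (n.+1 * (Num.truncn (b - a)).+1).
Proof.
move=> ab; rewrite /grid natrM mulrAC divff ?pnatr_eq0// mul1r.
by rewrite -lerBlDl ltW// truncnS_gt.
Qed.

(** Step integrals over finer and finer grids. Two of them have increments
that agree up to a small multiple of w on short intervals, hence by
[control_chain] they are uniformly close; this replaces common refinements of
partitions. *)
Lemma indefinite_integral_exists w a b f g : a <= b -> control w a b ->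
  dominated w a b g -> ucont f a b ->
  exists2 F, F a = 0 & indefinite_integral w a b f g F.
Proof.
move=> ab cw gw uf; have wab0 : 0 <= w a b by apply: cw.1.
pose S (n : nat) := step_integral f g a n.+1%:R^-1 (n.+1 * (Num.truncn (b - a)).+1).
have Sa n : S n a = 0.
  rewrite /S /step_integral big1// => j _; rewrite !min_l ?subrr ?mulr0//;
  by rewrite /grid lerDl mulr_ge0// invr_ge0.
have Sf e : 0 < e -> exists2 dl, 0 < dl & exists n0, forall n, (n0 <= n)%N ->
    forall u v, v - u < dl -> a <= u -> u <= v -> v <= b ->
    `|S n v - S n u - f u * (g v - g u)| <= e * w u v.
  move=> e0; have [dl dl0 fe] := uf _ e0; exists dl => //.
  exists (Num.truncn dl^-1) => n n0n.
  apply: (step_integralP cw gw _ _ (grid_end n ab) (ltW e0) fe).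
    by rewrite invr_gt0.
  rewrite invf_plt ?posrE//; apply: lt_le_trans (truncnS_gt _) _.
  by rewrite ler_nat.
have SC t : exists l, a <= t -> t <= b -> forall e, 0 < e ->
    exists n0, forall n, (n0 <= n)%N -> `|S n t - l| <= e.
  have [[at_ tb]|nt] := pselect (a <= t /\ t <= b); last first.
    by exists 0 => at_ tb; case: nt.
  suff [l lP] : exists l : R, forall e : R, 0 < e ->
    exists n0, forall n, (n0 <= n)%N -> `|S n t - l| <= e by exists l.
  apply: real_complete => e e0.
  have e1 : 0 < e / (w a b + 1) / 2 by rewrite !divr_gt0// ltr_wpDl.
  have [dl dl0 [n0 Sn]] := Sf _ e1; exists n0 => n m n0n n0m.
  (* S n and S m both approximate the integral, so the increments of their
   difference are small. *)
pose Phi u v := `|(S n v - S m v) - (S n u - S m u)|.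
  have := @control_chain _ w a b (e / (w a b + 1)) dl Phi cw dl0 _ _ _ a t (lexx a) at_ tb.
  rewrite /Phi !Sa subr0 subr0 => H; apply: (le_trans (H _ _ _)).
  - move=> u v z _ _ _ _; rewrite [leRHS]addrC (le_trans _ (ler_normD _ _))//.
    by rewrite subrKA.
  - move=> u v uv au uv' vb.
    have -> : S n v - S m v - (S n u - S m u) =
      (S n v - S n u - f u * (g v - g u)) - (S m v - S m u - f u * (g v - g u)).
      by lra.
    rewrite (le_trans (ler_normB _ _))// [e / _]splitr mulrDl.
    by rewrite lerD// Sn.
  - by rewrite divr_ge0 ?addr_ge0// ltW.
  rewrite mulrAC ler_pdivrMr ?ltr_wpDl// ler_pM2l//.
  have := control_le cw (lexx a) (lexx a) at_ tb (lexx b); lra.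
have {}SC : forall t, {l | a <= t -> t <= b -> forall e, 0 < e ->
    exists n0, forall n, (n0 <= n)%N -> `|S n t - l| <= e}.
  by move=> t; apply: cid; exact: SC.
(* The limit is unconstrained where it is chosen, so its value at a is fixed
   by hand. *)
pose F t := if t == a then 0 else sval (SC t).
have FP t : a <= t -> t <= b -> forall e, 0 < e ->
    exists n0, forall n, (n0 <= n)%N -> `|S n t - F t| <= e.
  move=> at_ tb e e0; rewrite /F; case: eqP => [->|_].
    by exists 0%N => n _; rewrite Sa subrr normr0 ltW.
  exact: (svalP (SC t)).
exists F; first by rewrite /F eqxx.
move=> e e0; have [dl dl0 [n0 Sn]] := Sf _ e0; exists dl => // u v uv au uv' vb.
apply/ler_addgt0Pr => eta eta0; have eta2 : 0 < eta / 2 by rewrite divr_gt0.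
have [n1 H1] := FP u au (le_trans uv' vb) _ eta2.
have [n2 H2] := FP v (le_trans au uv') vb _ eta2.
pose n := maxn n0 (maxn n1 n2).
have {}H1 : `|S n u - F u| <= eta / 2 by apply: H1; rewrite !leq_max leqnn orbT.
have {}H2 : `|S n v - F v| <= eta / 2 by apply: H2; rewrite !leq_max leqnn !orbT.
have {Sn}H3 := Sn n (leq_maxl _ _) u v uv au uv' vb.
have -> : F v - F u - f u * (g v - g u) =
  (S n v - S n u - f u * (g v - g u)) + ((S n u - F u) - (S n v - F v)) by lra.
rewrite (le_trans (ler_normD _ _))// lerD// (le_trans (ler_normB _ _))//.
by rewrite [leRHS]splitr lerD.
Qed.

Lemma partition_nth a b (s : seq R) i : itv_partition a b s ->
  (i < size s)%N -> nth b (a :: s) i < nth b (a :: s) i.+1.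
Proof. by move=> [ps _] si; have /(pathP b) := ps; apply. Qed.

(** Summing the defining estimate of [indefinite_integral] along a partition
compares the Riemann-Stieltjes sum with the telescoping sum of F; a tag other
than the left end costs one more modulus of continuity of f. *)
Lemma indefinite_integral_RS w a b f g F : control w a b -> dominated w a b g ->
  ucont f a b -> indefinite_integral w a b f g F ->
  forall t, a <= t -> t <= b -> is_RS_integral f g a t (F t - F a).
Proof.
move=> cw gw uf IF t at_ tb e e0; have wt0 : 0 <= w a t by apply: cw.1.
have e1 : 0 < e / (w a t + 1) / 2 by rewrite !divr_gt0// ltr_wpDl.
have [d1 d10 H1] := uf _ e1; have [d2 d20 H2] := IF _ e1.
exists (Num.min d1 d2); first by rewrite lt_min d10.
move=> s xi ps /= H; set u := nth t (a :: s).
have un : u (size s) = t by exact: itv_partition_nth_size.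
have ab_ i : (i <= size s)%N -> a <= u i /\ u i <= t.
  by move=> si; split; [exact: itv_partition_nth_ge|exact: itv_partition_nth_le].
have uS i : (i < size s)%N -> u i <= u i.+1 by move=> si; exact/ltW/partition_nth.
have -> : F t - F a = \sum_(i < size s) (F (u i.+1) - F (u i)).
  by rewrite -(big_mkord xpredT (fun i => F (u i.+1) - F (u i)))
    (telescope_sumr (F \o u))//= un.
rewrite -sumrB; apply: (@le_lt_trans _ _
    (\sum_(i < size s) (e / (w a t + 1)) * w (u i) (u i.+1))).
  rewrite (le_trans (ler_norm_sum _ _ _))//; apply: ler_sum => -[i si] _ /=.
  have [] := H i si; rewrite lt_min => /andP[di1 di2] /andP[uxi xiu].
  have [au _] := ab_ i (ltnW si); have [_ ut] := ab_ i.+1 si.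
  have ub := le_trans ut tb.
  have -> : f (xi i) * (g (u i.+1) - g (u i)) - (F (u i.+1) - F (u i)) =
      (f (xi i) - f (u i)) * (g (u i.+1) - g (u i)) -
      (F (u i.+1) - F (u i) - f (u i) * (g (u i.+1) - g (u i))) by lra.
  rewrite (le_trans (ler_normB _ _))// (splitr (e / _)) [leRHS]mulrDl lerD//.
    rewrite normrM ler_pM//; last exact: gw (uS i si) ub.
    apply: H1 => //; [|exact: le_trans ub].
    by apply: le_lt_trans di1; rewrite lerD2r.
  exact: H2 (uS i si) ub.
rewrite -mulr_sumr (@le_lt_trans _ _ (e / (w a t + 1) * w a t))//.
  rewrite ler_wpM2l ?divr_ge0 ?addr_ge0 ?(ltW e0)//.
  rewrite -[in leRHS]un -[X in _ <= w X _]/(u 0%N).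
  by apply: (control_sum (t := u) cw) => //; rewrite un.
by rewrite mulrAC ltr_pdivrMr ?ltr_wpDl// ltr_pM2l// ltrDl.
Qed.

End integral.

(** * The signature as the solution of a linear equation *)

Section signature_equation.
Context {R : realType} {d N : nat}.
Local Notation A := (tens R d N).
Local Notation ins := (@insub_bseq N 'I_d).
Implicit Types (w : R -> R -> R) (a b u v t e : R) (x : R -> 'rV[R]_d).

Lemma coef_vec (y : 'I_d -> R) (v : N.-bseq 'I_d) :
  (vec y : A) v = if val v is [:: i] then y i else 0.
Proof.
rewrite /vec sum_ffunE (eq_bigr (fun i => y i * (val v == [:: i])%:R)); last first.
  by move=> i _; rewrite !ffunE.
case: (val v) => [|j [|k s]].
- by rewrite big1// => i _; rewrite mulr0.
- rewrite (bigD1 j)//= eqxx mulr1 big1 ?addr0// => i ij.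
  by rewrite eqseq_cons eq_sym (negbTE ij) mulr0.
- by rewrite big1// => i _; rewrite eqseq_cons andbF mulr0.
Qed.

Lemma coefM_vec_nil (c : A) (y : 'I_d -> R) (v : N.-bseq 'I_d) :
  val v = [::] -> (c * vec y) v = 0.
Proof.
move=> v0; have s0 : size v = 0%N by rewrite -[size v]/(size (val v)) v0.
have dv j : drop j v = [::] by rewrite -[bseqval v]/(val v) v0.
by rewrite tens_coefM big1// => i _; rewrite dv coef_vec insE// mulr0.
Qed.

(** Multiplying by a vector on the right only sees the last letter of a word;
this is the recursion of iterated integrals. *)
Lemma coefM_vec_rcons (c : A) (y : 'I_d -> R) (v : N.-bseq 'I_d) s i :
  val v = rcons s i -> (c * vec y) v = c (ins s) * y i.
Proof.
move=> vs; have sv : size v = (size s).+1.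
  by rewrite -[size v]/(size (val v)) vs size_rcons.
have sN : (size s < N)%N by rewrite -sv size_bseq.
rewrite tens_coefM sv big_ord_recr big_ord_recr/=.
rewrite big1 ?add0r => [|j _]; last first.
  rewrite coef_vec insE; last by rewrite size_drop (leq_trans (leq_subr _ _))// sv.
  have : (1 < size (drop j v))%N.
    by rewrite size_drop sv ltn_subRL addn1 ltnS.
  by case: (drop j v) => [|? []]//= *; rewrite mulr0.
rewrite -[bseqval v]/(val v) vs !coef_vec !insE.
- rewrite [drop (size s).+1 _]drop_oversize ?size_rcons// mulr0 addr0 -cats1 take_size_cat//.
  by rewrite drop_size_cat.
- by rewrite drop_oversize ?size_rcons.
- by rewrite size_drop size_rcons subSnn (leq_trans _ sN).
Qed.

Definition dx x u v : A := vec (fun i => x v 0 i - x u 0 i).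

(** What is needed of a path to drive a linear equation: bounded variation,
through a control, and uniform continuity. *)
Definition driver w x a b := [/\ control w a b,
  forall i, dominated w a b (fun t => x t 0 i) &
  forall i, ucont (fun t => x t 0 i) a b].

(** The linear equation dZ = Z dx, which the signature satisfies. *)
Definition solves w x a b (Z : R -> A) :=
  little_o w a b (fun u v => nrm (Z v - Z u - Z u * dx x u v)).

Lemma indefinite_integral_bound w a b f g F B : a <= b -> control w a b ->
  dominated w a b g -> (forall t, a <= t -> t <= b -> `|f t| <= B) ->
  indefinite_integral w a b f g F -> F a = 0 ->
  forall t, a <= t -> t <= b -> `|F t| <= B * w a b.
Proof.
move=> ab cw gw fB IF Fa t at_ tb.
have w0 : 0 <= w a b by apply: cw.1.
have B0 : 0 <= B by apply: le_trans (fB a _ _).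
apply/ler_addgt0Pr => e e0.
have e1 : 0 < e / (w a b + 1) by rewrite divr_gt0// ltr_wpDl.
have [dl dl0 H] := IF _ e1.
have := @control_chain _ w a b (e / (w a b + 1) + B) dl (fun u v => `|F v - F u|) cw dl0.
move=> C; have {}C : `|F t - F a| <= (e / (w a b + 1) + B) * w a t.
  apply: C => //; last by rewrite addr_ge0// ltW.
  - move=> u v z _ _ _ _; rewrite [leRHS]addrC (le_trans _ (ler_normD _ _))//.
    by rewrite subrKA.
  - move=> u v uv au uv' vb.
    rewrite -[F v - F u](subrK (f u * (g v - g u))) mulrDl.
    rewrite (le_trans (ler_normD _ _))// lerD//; first exact: H.
    by rewrite normrM ler_pM// ?gw// fB// (le_trans uv').
rewrite Fa subr0 in C; apply: (le_trans C).
have ww : w a t <= w a b by exact: control_le cw (lexx a) (lexx a) at_ tb (lexx b).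
apply: (@le_trans _ _ ((e / (w a b + 1) + B) * w a b)).
  by rewrite ler_wpM2l// addr_ge0// ltW.
rewrite mulrDl addrC lerD2l mulrAC ler_pdivrMr ?ltr_wpDl// ler_pM2l//.
by rewrite lerDl.
Qed.

Lemma indefinite_integral_ucont w a b f g F B : a <= b -> control w a b ->
  ucont g a b -> (forall t, a <= t -> t <= b -> `|f t| <= B) ->
  indefinite_integral w a b f g F -> ucont F a b.
Proof.
move=> ab cw ug fB IF e e0.
have w0 : 0 <= w a b by apply: cw.1.
have B0 : 0 <= B by apply: le_trans (fB a _ _).
have e1 : 0 < e / 2 / (w a b + 1) by rewrite !divr_gt0// ltr_wpDl.
have e2 : 0 < e / 2 / (B + 1) by rewrite !divr_gt0// ltr_wpDl.
have [d1 d10 H1] := IF _ e1; have [d2 d20 H2] := ug _ e2.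
exists (Num.min d1 d2); first by rewrite lt_min d10.
move=> u v; rewrite lt_min => /andP[uv1 uv2] au uv vb.
rewrite -[F v - F u](subrK (f u * (g v - g u))).
rewrite (le_trans (ler_normD _ _))// [leRHS]splitr lerD//.
  rewrite (le_trans (H1 _ _ uv1 au uv vb))// mulrAC ler_pdivrMr ?ltr_wpDl//.
  rewrite ler_pM2l ?divr_gt0//.
  have := control_le cw (lexx a) au uv vb (lexx b); lra.
rewrite normrM (@le_trans _ _ (B * (e / 2 / (B + 1))))//.
  by rewrite ler_pM// ?H2// fB// (le_trans uv).
rewrite mulrA ler_pdivrMr ?ltr_wpDl// mulrC ler_pM2l ?divr_gt0//.
by rewrite lerDl.
Qed.

(** Induction on the word: the previous iterated integral is continuous and
bounded, so it can be integrated again. *)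
Lemma iterated_integralP w x a b : a <= b -> driver w x a b ->
  forall l : seq 'I_d,
  [/\ ucont (iterated_integral x a l) a b,
      forall t, a <= t -> t <= b -> `|iterated_integral x a l t| <= w a b ^+ size l &
      if l is i :: l' then iterated_integral x a l a = 0 /\
        indefinite_integral w a b (iterated_integral x a l') (fun t => x t 0 i)
          (iterated_integral x a l) else True].
Proof.
move=> ab [cw xw ux]; elim=> [|i l [ul Bl _]].
  split=> //=; last by move=> *; rewrite normr1 expr0.
  by move=> e e0; exists 1 => // *; rewrite subrr normr0 ltW.
have [F Fa IF] := indefinite_integral_exists ab cw (xw i) ul.
set g := fun t => x t 0 i in IF *.
have E t : a <= t -> t <= b -> iterated_integral x a (i :: l) t = F t.
  move=> at_ tb; apply: RS_integralE => //.
  have := indefinite_integral_RS cw (xw i) ul IF at_ tb.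
  by rewrite Fa subr0.
have {}IF : indefinite_integral w a b (iterated_integral x a l) g
    (iterated_integral x a (i :: l)).
  move=> e /IF[dl dl0 H]; exists dl => // u v uv au uv' vb.
  by rewrite !E ?(le_trans uv')// ?(le_trans au)//; exact: H.
have Fa' : iterated_integral x a (i :: l) a = 0 by rewrite E.
split=> //.
- exact: indefinite_integral_ucont ab cw (ux i) Bl IF.
- move=> t at_ tb; rewrite [size _]/= exprSr.
  exact: indefinite_integral_bound ab cw (xw i) Bl IF Fa' t at_ tb.
Qed.

(** The signature as an element of the tensor algebra ring. *)
Definition tsig x a t : A := signature N x a t.

Lemma tsigE x a t (v : N.-bseq 'I_d) :
  tsig x a t v = iterated_integral x a (rev (val v)) t.
Proof. by rewrite ffunE. Qed.

Lemma coefB (p q : A) (v : N.-bseq 'I_d) : (p - q) v = p v - q v.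
Proof. by rewrite !ffunE. Qed.

Lemma tsig_coef0 x a t : tsig x a t [bseq] = 1.
Proof. by rewrite ffunE. Qed.

Lemma tsig_refl w x a b : a <= b -> driver w x a b -> tsig x a a = 1.
Proof.
move=> ab dr; apply/ffunP => v; rewrite !ffunE -size_rev.
case: (rev v) => [//|i l].
by have [_ _ [-> _]] := iterated_integralP ab dr (i :: l).
Qed.

(** Each integration multiplies the bound by the length of the path. *)
Lemma tsig_bound w x a b t (v : N.-bseq 'I_d) : driver w x a b ->
  a <= t -> t <= b -> `|tsig x a t v| <= w a b ^+ size v.
Proof.
move=> dr at_ tb; rewrite ffunE -[size v]size_rev.
by have [_ -> //] := iterated_integralP (le_trans at_ tb) dr (rev v).
Qed.

Lemma tsig_solves w x a b : a <= b -> driver w x a b -> solves w x a b (tsig x a).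
Proof.
move=> ab dr e e0.
have cw : control w a b by case: dr.
pose n : R := #|{: N.-bseq 'I_d}|%:R.
have n0 : 0 <= n by [].
have e1 : 0 < e / (n + 1) by rewrite divr_gt0// ltr_wpDl.
pose Q (l : N.-bseq 'I_d) u v := a <= u -> u <= v -> v <= b ->
  `|(tsig x a v - tsig x a u - tsig x a u * dx x u v) l| <= e / (n + 1) * w u v.
have [l|dl dl0 H] := @common_delta R _ Q.
  have [ls|[s [i ls]]] : val l = [::] \/ exists s i, val l = rcons s i.
    by case: (lastP (val l)) => [|s i]; [left|right; exists s, i].
    exists 1 => // u v _ au uv vb; rewrite !coefB coefM_vec_nil// !tsigE ls /=.
    by rewrite subrr subr0 normr0 mulr_ge0 ?(ltW e1)// cw.1.
  have sN : (size s <= N)%N.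
    by rewrite -ltnS -(size_rcons s i) -ls ltnW// ltnS size_bseq.
  have [_ _] := iterated_integralP ab dr (i :: rev s).
  move=> [_ /(_ _ e1)[dl dl0 H]]; exists dl => // u v uv au uv' vb.
  rewrite !coefB (coefM_vec_rcons _ _ ls). rewrite !tsigE ls rev_rcons insE//.
  exact: H.
exists dl => // u v uv au uv' vb; rewrite /nrm.
apply: (@le_trans _ _ (\sum_(l : N.-bseq 'I_d) e / (n + 1) * w u v)).
  by apply: ler_sum => l _; exact: H.
rewrite sumr_const -mulr_natr -/n mulrAC ler_wpM2r ?cw.1//.
rewrite mulrAC ler_pdivrMr ?ltr_wpDl// ler_pM2l//.
by rewrite lerDl.
Qed.

End signature_equation.

(** * Uniqueness, the Chen identity and segments *)

Section uniqueness.
Context {R : realType} {d N : nat}.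
Local Notation A := (tens R d N).
Implicit Types (w : R -> R -> R) (a b u v t e : R) (x y : R -> 'rV[R]_d).
Implicit Types (Z : R -> A).

Lemma dx_deg x u v : deg_ge 1 (dx x u v : A).
Proof. exact/lie_deg1/lie_vec. Qed.

Lemma solves_sub w x a b a' b' Z : a <= a' -> b' <= b ->
  solves w x a b Z -> solves w x a' b' Z.
Proof.
move=> aa bb sZ e /sZ[dl dl0 H]; exists dl => // u v uv au uv' vb.
by apply: H => //; [exact: le_trans au|exact: le_trans bb].
Qed.

Lemma dominated_sub w a b a' b' (g : R -> R) : a <= a' -> b' <= b ->
  dominated w a b g -> dominated w a' b' g.
Proof.
by move=> aa bb H u v au uv vb; apply: H => //; [exact: le_trans au|exact: le_trans bb].
Qed.

Lemma ucont_sub a b a' b' (g : R -> R) : a <= a' -> b' <= b ->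
  ucont g a b -> ucont g a' b'.
Proof.
move=> aa bb ug e /ug[dl dl0 H]; exists dl => // u v uv au uv' vb.
by apply: H => //; [exact: le_trans au|exact: le_trans bb].
Qed.

Lemma driver_sub w x a b a' b' : a <= a' -> b' <= b ->
  driver w x a b -> driver w x a' b'.
Proof.
move=> aa bb [cw xw ux]; split; first exact: control_sub cw.
  by move=> i; exact: dominated_sub (xw i).
by move=> i; exact: ucont_sub (ux i).
Qed.

Lemma solvesB w w' x a b Z Z' : control w a b -> control w' a b ->
  solves w x a b Z -> solves w' x a b Z' ->
  solves (fun u v => w u v + w' u v) x a b (fun t => Z t - Z' t).
Proof.
move=> cw cw' sZ sZ' e e0; have [d1 d10 H1] := sZ _ e0.
have [d2 d20 H2] := sZ' _ e0; exists (Num.min d1 d2); first by rewrite lt_min d10.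
move=> u v; rewrite lt_min => /andP[uv1 uv2] au uv vb.
have -> : Z v - Z' v - (Z u - Z' u) - (Z u - Z' u) * dx x u v =
  (Z v - Z u - Z u * dx x u v) - (Z' v - Z' u - Z' u * dx x u v).
  by rewrite mulrBl !opprD !opprK !addrA [LHS](ACl (1*3*5*2*4*6)).
by rewrite (le_trans (nrmB _ _))// mulrDr lerD// ?H1 ?H2.
Qed.

Lemma solvesMl w x a b Z (c : A) : control w a b -> solves w x a b Z ->
  solves w x a b (fun t => c * Z t).
Proof.
move=> cw sZ e e0; have c0 := nrm_ge0 c.
have e1 : 0 < e / (nrm c + 1) by rewrite divr_gt0// ltr_wpDl.
have [dl dl0 H] := sZ _ e1; exists dl => // u v uv au uv' vb.
rewrite -mulrA -!mulrBr (le_trans (nrmM _ _))//.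
rewrite (@le_trans _ _ (nrm c * (e / (nrm c + 1) * w u v)))//.
  by rewrite ler_wpM2l// H.
rewrite mulrA ler_wpM2r ?cw.1// mulrA ler_pdivrMr ?ltr_wpDl// mulrC.
by rewrite ler_pM2l// lerDl.
Qed.

(** Degree by degree: if Z vanishes below degree n, then Z dx vanishes up to
degree n, so that the coordinates of degree n have increments o(w). *)
Lemma solves_eq0 w x a b Z : control w a b -> solves w x a b Z -> Z a = 0 ->
  forall t, a <= t -> t <= b -> Z t = 0.
Proof.
move=> cw sZ Za t at_ tb; apply: deg_ge_eq0; move: t at_ tb.
elim: N.+1 => [|n IH] t at_ tb; first exact: deg_ge00.
move=> l; rewrite ltnS => ln.
have -> : 0 = Z a l by rewrite Za ffunE.
apply: (little_o_const (F := fun t => Z t l) cw) => // e e0.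
have [dl dl0 H] := sZ _ e0; exists dl => // u v uv au uv' vb.
apply: le_trans (H u v uv au uv' vb); apply: le_trans _ (coef_le_nrm _ l).
rewrite !coefB (_ : (Z u * _) l = 0) ?subr0//.
have := deg_geM (IH u au (le_trans uv' vb)) (dx_deg x u v); apply.
by rewrite addn1 ltnS.
Qed.

Lemma solves_unique w w' x a b Z Z' : control w a b -> control w' a b ->
  solves w x a b Z -> solves w' x a b Z' -> Z a = Z' a ->
  forall t, a <= t -> t <= b -> Z t = Z' t.
Proof.
move=> cw cw' sZ sZ' ZZ t at_ tb; apply/eqP; rewrite -subr_eq0; apply/eqP.
apply: (solves_eq0 (Z := fun t => Z t - Z' t) (controlD cw cw') (solvesB cw cw' sZ sZ')) => //.
by rewrite ZZ subrr.
Qed.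

(** As functions of t, both sides solve dZ = Z dx on [u, t] and agree at u. *)
Theorem chen_identity w x a b s u t : driver w x a b -> a <= s -> s <= u -> u <= t -> t <= b ->
  tsig x s t = tsig x s u * tsig x u t :> A.
Proof.
move=> dr as_ su ut tb; have st := le_trans su ut.
have drs : driver w x s t := driver_sub as_ tb dr.
have dru : driver w x u t := driver_sub su (lexx t) drs.
have [cws _ _] := drs; have [cwu _ _] := dru.
apply: (solves_unique (Z' := fun t => tsig x s u * tsig x u t) cwu cwu _ _ _ ut (lexx t)).
- exact: solves_sub su (lexx t) (tsig_solves st drs).
- by apply: solvesMl => //; exact: tsig_solves.
- by rewrite (tsig_refl ut dru) mulr1.
Qed.

Lemma tsig_ext w w' x y a b : a <= b -> driver w x a b -> driver w' y a b ->
  (forall u v, a <= u -> u <= v -> v <= b -> x v - x u = y v - y u) ->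
  tsig x a b = tsig y a b :> A.
Proof.
move=> ab drx dry xy; have [cw _ _] := drx; have [cw' _ _] := dry.
apply: (solves_unique cw cw' (x := y) _ (tsig_solves ab dry) _ ab (lexx b)).
  move=> e e0; have [dl dl0 H] := tsig_solves (N := N) ab drx e0.
  exists dl => // u v uv au uv' vb; have := H u v uv au uv' vb.
  rewrite (_ : dx x u v = dx y u v)//; congr vec; apply/funext => i.
  by have := congr1 (fun z : 'rV_d => z 0 i) (xy u v au uv' vb); rewrite !mxE.
by rewrite (tsig_refl ab drx) (tsig_refl ab dry).
Qed.

Lemma driver_affine w x a b p q : 0 < q -> driver w x (p + q * a) (p + q * b) ->
  driver (fun u v => w (p + q * u) (p + q * v)) (fun t => x (p + q * t)) a b.
Proof.
move=> q0 [[w0 wS] xw ux].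
have le_ u v : u <= v -> p + q * u <= p + q * v by rewrite lerD2l ler_pM2l.
split; first by split=> *; [apply: w0|apply: wS]; exact: le_.
  by move=> i u v *; apply: xw; exact: le_.
move=> i e e0; have [dl dl0 H] := ux i _ e0; exists (dl / q); first exact: divr_gt0.
move=> u v; rewrite ltr_pdivlMr// => uv *; apply: H; try exact: le_.
by rewrite (_ : _ - _ = (v - u) * q)//; ring.
Qed.

(** The reparametrised signature solves the equation driven by the
reparametrised path. *)
Lemma tsig_affine w x a b p q : 0 < q -> a <= b ->
  driver w x (p + q * a) (p + q * b) ->
  tsig (fun t => x (p + q * t)) a b = tsig x (p + q * a) (p + q * b) :> A.
Proof.
move=> q0 ab dr; have dr' := driver_affine q0 dr; have [cw' _ _] := dr'.
have le_ u v : u <= v -> p + q * u <= p + q * v by rewrite lerD2l ler_pM2l.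
apply: (solves_unique (Z' := fun t => tsig x (p + q * a) (p + q * t)) cw' cw'
  (tsig_solves ab dr') _ _ ab (lexx b)).
  move=> e e0; have [dl dl0 H] := tsig_solves (N := N) (le_ _ _ ab) dr e0.
  exists (dl / q); first exact: divr_gt0.
  move=> u v; rewrite ltr_pdivlMr// => uv *; apply: H; try exact: le_.
  by rewrite (_ : _ - _ = (v - u) * q)//; ring.
by rewrite (tsig_refl ab dr') (tsig_refl (le_ _ _ ab) dr).
Qed.

Lemma taylor_power (u v : R) k : 0 <= u -> u <= v -> v <= 1 ->
  `|v ^+ k - u ^+ k - k%:R * u ^+ k.-1 * (v - u)| <= k%:R ^+ 2 * (v - u) ^+ 2.
Proof.
move=> u0 uv v1; have v0 := le_trans u0 uv.
elim: k => [|k IH]; first by rewrite !expr0 subrr !mul0r subr0 normr0 expr0n mul0r.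
have -> : v ^+ k.+1 - u ^+ k.+1 - k.+1%:R * u ^+ k.+1.-1 * (v - u) =
    v * (v ^+ k - u ^+ k - k%:R * u ^+ k.-1 * (v - u)) +
    k%:R * u ^+ k.-1 * (v - u) ^+ 2.
  rewrite -natr1 succnK !exprS; case: k {IH} => [|k]; first by rewrite !expr0; ring.
  by rewrite succnK !exprS; ring.
rewrite (le_trans (ler_normD _ _))//.
apply: (@le_trans _ _ (k%:R ^+ 2 * (v - u) ^+ 2 + k%:R * (v - u) ^+ 2)).
  apply: lerD.
    rewrite normrM (ger0_norm v0); apply: le_trans IH.
    by rewrite ler_piMl.
  have uk : 0 <= k%:R * u ^+ k.-1 by rewrite mulr_ge0// exprn_ge0.
  have vu2 := sqr_ge0 (v - u).
  rewrite ger0_norm; last exact: mulr_ge0.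
  by rewrite ler_wpM2r// ler_piMr// exprn_ile1// (le_trans uv).
rewrite -mulrDl ler_wpM2r ?exprn_ge0 ?subr_ge0// -natr1.
have : 0 <= k%:R :> R by []. nra.
Qed.

Definition line (s : R) (i : 'I_d) (t : R) : 'rV[R]_d :=
  \row_j (if j == i then s * t else 0).

Lemma line_coord s i t j : line s i t 0 j = (j == i)%:R * s * t.
Proof. by rewrite mxE; case: eqP; rewrite ?mul1r ?mul0r. Qed.

Lemma driver_line s i : driver (fun u v => (`|s| + 1) * (v - u)) (line s i) 0 1.
Proof.
have K0 : 0 < `|s| + 1 by rewrite ltr_wpDl.
have D u v j : u <= v -> `|line s i v 0 j - line s i u 0 j| <= (`|s| + 1) * (v - u).
  move=> uv; rewrite !line_coord -mulrBr normrM [`|v - u|]ger0_norm ?subr_ge0//.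
  rewrite ler_wpM2r ?subr_ge0// normrM normr_nat.
  by case: eqP => _; rewrite ?mul1r ?mul0r ?lerDl// ltW.
split.
- split=> [u v _ uv _|u v z _ _ _ _]; first by rewrite mulr_ge0 ?subr_ge0// ltW.
  by rewrite -mulrDr ler_wpM2l ?(ltW K0)//; lra.
- by move=> j u v _ uv _; exact: D.
move=> j e e0; exists (e / (`|s| + 1)); first exact: divr_gt0.
move=> u v; rewrite ltr_pdivlMr// mulrC => uv _ uv' _; apply: le_trans (ltW uv).
exact: D.
Qed.

Lemma dx_line s i u v : dx (line s i) u v = (v - u) *: (s *: word [:: i]) :> A.
Proof.
rewrite /dx /vec (bigD1 i)//= !line_coord eqxx mul1r -mulrBr mulrC -scalerA.
rewrite big1 ?addr0// => j /negbTE ji.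
by rewrite !line_coord ji !mul0r subrr scale0r.
Qed.

(** The exponential of t s e_i solves the equation driven by the segment, the
remainder being quadratic in the time step. *)
Lemma tsig_line s i : tsig (line s i) 0 1 = texp (s *: word [:: i] : A) :> A.
Proof.
have dr := driver_line s i; have [cw _ _] := dr.
have ab := @ler01 R; set c : A := s *: _.
have hc : deg_ge 1 c by exact: deg_geZ (@word_deg _ _ _ [:: i]).
pose Z t : A := texp (t *: c).
have ZE t : Z t = \sum_(k < N.+1) t ^+ k *: exp_term c k.
  rewrite /Z texpE; apply: eq_bigr => k _.
  by rewrite exprZn /exp_term !scalerA mulrC.
have -> : texp c = Z 1 by rewrite /Z scale1r.
apply: (solves_unique cw cw (tsig_solves ab dr) _ _ ab (lexx 1)); last first.
  by rewrite (tsig_refl ab dr) /Z scale0r [texp _]texp0.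
pose C := \sum_(k < N.+1) k%:R ^+ 2 * nrm (exp_term c k).
have C0 : 0 <= C by apply: sumr_ge0 => k _; rewrite mulr_ge0// ?exprn_ge0// nrm_ge0.
move=> e e0; exists (e / (C + 1)); first by rewrite divr_gt0// ltr_wpDl.
move=> u v uv u0 uv' v1.
have -> : Z v - Z u - Z u * dx (line s i) u v =
  \sum_(k < N.+1) (v ^+ k - u ^+ k - k%:R * u ^+ k.-1 * (v - u)) *: exp_term c k.
  have -> : Z u * dx (line s i) u v =
      \sum_(k < N.+1) (k%:R * u ^+ k.-1 * (v - u)) *: exp_term c k.
    rewrite dx_line -/c ZE mulr_suml big_ord_recr/=.
    rewrite -scalerAl -scalerAr -exp_termS exp_term_big// mul0rn !scaler0 addr0.
    rewrite [RHS]big_ord_recl !mul0r scale0r add0r; apply: eq_bigr => k _.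
    rewrite -scalerAl -scalerAr -exp_termS -(@scaler_nat R) !scalerA.
    by rewrite lift0 succnK; congr (_ *: _); ring.
  rewrite !ZE -!sumrB; apply: eq_bigr => k _.
  by rewrite !scalerBl.
rewrite (le_trans (nrm_sum _ _ _))//.
apply: (@le_trans _ _ (C * (v - u) ^+ 2)).
  rewrite mulr_suml; apply: ler_sum => k _; rewrite nrmZ [leRHS]mulrAC.
  by rewrite ler_wpM2r ?nrm_ge0// taylor_power.
have vu0 : 0 <= v - u by rewrite subr_ge0.
apply: (@le_trans _ _ (e * (v - u))); last first.
  by rewrite ler_wpM2l ?(ltW e0)// -[leLHS]mul1r ler_wpM2r// lerDr.
rewrite expr2 mulrA ler_wpM2r//; move: uv; rewrite ltr_pdivlMr ?ltr_wpDl// => uv.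
nra.
Qed.

End uniqueness.

(** * Signatures belong to the group *)

Section signature_group.
Context {R : realType} {d N : nat}.
Local Notation A := (tens R d N).
Implicit Types (w : R -> R -> R) (a b u v t e : R) (x y : R -> 'rV[R]_d).

Lemma coefD (p q : A) (v : N.-bseq 'I_d) : (p + q) v = p v + q v.
Proof. by rewrite ffunE. Qed.

Lemma coefN (p : A) (v : N.-bseq 'I_d) : (- p) v = - p v.
Proof. by rewrite ffunE. Qed.

Lemma grade_vec (y : 'I_d -> R) : grade (vec y : A) = vec y.
Proof.
by rewrite /vec linear_sum; apply: eq_bigr => i _; rewrite linearZ/= grade_letter.
Qed.

(** One step of the equation for W = S D(S) - delta(S): if S is replaced by S
+ S v + r, then W becomes W + W v up to terms quadratic in v or linear in r.
The constant term 1 of S enters through [dynkin_vec]. *)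
Lemma maurer_cartan_step (s r : A) (y : 'I_d -> R) : s [bseq] = 1 ->
  let W (z : A) := z * dynkin_op z - grade z in
  let v : A := vec y in
  W (s + s * v + r) - W s - W s * v =
  s * (v * dynkin_op s * v - v * v * dynkin_op s + v * v) +
  (r * dynkin_op (s + s * v) + (s + s * v + r) * dynkin_op r - grade r).
Proof.
move=> s1 W v; rewrite /W !linearD/= gradeM grade_vec dynkin_vec s1 scale1r -/v.
set h := dynkin_op s; set g := grade s; set k := dynkin_op r; set f := grade r.
rewrite !(mulrDl, mulrDr, mulrN, mulNr) !mulrA.
apply/ffunP => l; rewrite !(coefD, coefN); ring.
Qed.

Lemma nrm_dx w x a b u v : driver w x a b -> a <= u -> u <= v -> v <= b ->
  nrm (dx x u v : A) <= d%:R * w u v.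
Proof.
move=> [_ xw _] au uv vb; rewrite (le_trans (nrm_vec _))//.
rewrite mulr_natl -[X in _ *+ X]card_ord -sumr_const.
by apply: ler_sum => i _; exact: xw.
Qed.

Lemma nrm_dx_small w x a b e : driver w x a b -> 0 < e ->
  exists2 dl, 0 < dl & forall u v, v - u < dl -> a <= u -> u <= v -> v <= b ->
    nrm (dx x u v : A) <= e.
Proof.
move=> [_ _ ux] e0; have e1 : 0 < e / (d%:R + 1) by rewrite divr_gt0// ltr_wpDl.
pose Q (i : 'I_d) u v := a <= u -> u <= v -> v <= b ->
  `|x v 0 i - x u 0 i| <= e / (d%:R + 1).
have [i|dl dl0 H] := @common_delta R _ Q; first exact: ux.
exists dl => // u v uv au uv' vb; rewrite (le_trans (nrm_vec _))//.
apply: (@le_trans _ _ (\sum_(i < d) e / (d%:R + 1))).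
  by apply: ler_sum => i _; exact: H.
rewrite sumr_const card_ord -[leLHS]mulr_natr mulrAC ler_pdivrMr ?ltr_wpDl//.
by rewrite ler_pM2l// lerDl.
Qed.

Lemma tsig_nrm_bound w x a b t : driver w x a b -> a <= t -> t <= b ->
  nrm (tsig x a t : A) <= \sum_(l : N.-bseq 'I_d) w a b ^+ size l.
Proof. by move=> dr at_ tb; apply: ler_sum => l _; exact: tsig_bound dr _ _. Qed.

(** The defect S D(S) - delta(S) starts at 0 and, by [maurer_cartan_step],
solves dW = W dx, so it vanishes. Thus S^-1 delta(S) is D(S), which is Lie. *)
Lemma tsig_grouplike w x a b : a <= b -> driver w x a b ->
  grouplike (tsig x a b : A).
Proof.
move=> ab dr; split; first exact: tsig_coef0.
exists (dynkin_op (tsig x a b : A)); first exact: lie_dynkin.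
apply/eqP; rewrite eq_sym -subr_eq0; apply/eqP.
pose W (z : A) := z * dynkin_op z - grade z.
have [cw _ _] := dr.
apply: (@solves_eq0 R d N w x a b (fun t => W (tsig x a t)) cw _ _ b ab (lexx b)); last first.
  by rewrite (tsig_refl ab dr) /W dynkin1 mulr0 grade1 subrr.
have [CD CD0 HD] := @nrm_linear R d N dynkin_op.
have [CG CG0 HG] := @nrm_linear R d N grade.
pose M := \sum_(l : N.-bseq 'I_d) w a b ^+ size l.
have M0 : 0 <= M by apply: sumr_ge0 => l _; rewrite exprn_ge0// cw.1.
(* K bounds the remainder of maurer_cartan_step relative to eta w(u, v); its
   first summand comes from the part quadratic in dx, the others from the
   error in one step of S. *)
pose K := M * ((2 * (CD * M) + 1) * d%:R) + (CD * M * 2 + M * CD + CG).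
have K0 : 0 <= K.
  by rewrite !(addr_ge0, mulr_ge0)// ?addr_ge0 ?mulr_ge0 ?addr_ge0 ?mulr_ge0.
move=> e e0; have e1 : 0 < e / (K + 1) by rewrite divr_gt0// ltr_wpDl.
pose eta := Num.min 1 (e / (K + 1)).
have eta0 : 0 < eta by rewrite lt_min ltr01.
have eta1 : eta <= 1 by rewrite ge_min lexx.
have etaK : eta * K <= e.
  apply: (@le_trans _ _ (e / (K + 1) * K)).
    by rewrite ler_wpM2r// ge_min lexx orbT.
  by rewrite mulrAC ler_pdivrMr ?ltr_wpDl// ler_pM2l// lerDl.
have [d1 d10 H1] := tsig_solves (N := N) ab dr eta0.
have [d2 d20 H2] := nrm_dx_small dr eta0.
exists (Num.min d1 d2); first by rewrite lt_min d10.
move=> u v; rewrite lt_min => /andP[uv1 uv2] au uv vb.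
have {}H1 := H1 u v uv1 au uv vb; have {}H2 := H2 u v uv2 au uv vb.
have H3 := nrm_dx dr au uv vb.
have Su : nrm (tsig x a u : A) <= M by apply: tsig_nrm_bound dr _ _; lra.
have Sv : nrm (tsig x a v : A) <= M by apply: tsig_nrm_bound dr _ _; lra.
have w0 : 0 <= w u v by apply: cw.1.
set s : A := tsig x a u in H1 Su *; set z : A := tsig x a v in H1 Sv *.
set q : A := dx x u v in H1 H2 H3 *; set r := z - s - s * q in H1.
have ze : z = s + s * q + r by rewrite /r addrC -[z - s - _]addrA -opprD subrK.
have -> : W z - W s - W s * q =
    s * (q * dynkin_op s * q - q * q * dynkin_op s + q * q) +
    (r * dynkin_op (s + s * q) + z * dynkin_op r - grade r).
  by rewrite ze; apply: maurer_cartan_step; exact: tsig_coef0.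
have q0 := nrm_ge0 q; have r0 := nrm_ge0 r; have s0 := nrm_ge0 s.
have Ds : nrm (dynkin_op s) <= CD * M by apply: le_trans (HD _) _; rewrite ler_wpM2l.
have qq : nrm q * nrm q <= eta * (d%:R * w u v) by exact: ler_pM.
have B1 : nrm (s * (q * dynkin_op s * q - q * q * dynkin_op s + q * q)) <=
    eta * w u v * (M * ((2 * (CD * M) + 1) * d%:R)).
  rewrite (le_trans (nrmM _ _))//.
  apply: (@le_trans _ _ (M * (nrm q * nrm q * (2 * (CD * M) + 1)))).
    apply: ler_pM => //; first exact: nrm_ge0.
    rewrite (le_trans (nrmD _ _))// mulrDr mulr1 lerD ?nrmM//.
    have -> : nrm q * nrm q * (2 * (CD * M)) =
      nrm q * (CD * M) * nrm q + nrm q * nrm q * (CD * M) by ring.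
    rewrite (le_trans (nrmB _ _))// lerD//.
      rewrite (le_trans (nrmM _ _))// ler_wpM2r//.
      by rewrite (le_trans (nrmM _ _))// ler_wpM2l.
    rewrite (le_trans (nrmM _ _))//; apply: ler_pM; rewrite ?nrm_ge0//.
    exact: nrmM.
  have : 0 <= M * (2 * (CD * M) + 1) by rewrite mulr_ge0// addr_ge0// !mulr_ge0.
  move/(ler_wpM2l)/(_ _ _ qq) => h; apply: le_trans (le_trans _ h) _; lra.
have B2 : nrm (r * dynkin_op (s + s * q)) <= eta * w u v * (CD * M * 2).
  rewrite (le_trans (nrmM _ _))//; apply: ler_pM; rewrite ?nrm_ge0//.
  rewrite (le_trans (HD _))// -mulrA ler_wpM2l// mulr_natr mulr2n.
  rewrite (le_trans (nrmD _ _))// lerD// (le_trans (nrmM _ _))//.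
  rewrite -[leRHS]mulr1; apply: ler_pM => //; exact: le_trans eta1.
have B3 : nrm (z * dynkin_op r) <= eta * w u v * (M * CD).
  rewrite (le_trans (nrmM _ _))// [leRHS]mulrC -mulrA.
  apply: ler_pM; rewrite ?nrm_ge0//.
  by rewrite (le_trans (HD _))// ler_wpM2l.
have B4 : nrm (grade r) <= eta * w u v * CG.
  by rewrite (le_trans (HG _))// mulrC ler_wpM2r.
apply: (@le_trans _ _ (eta * w u v * K)); last first.
  by rewrite mulrAC ler_wpM2r.
rewrite (le_trans (nrmD _ _))// /K [leRHS]mulrDr lerD//.
rewrite (le_trans (nrmB _ _))// [leRHS]mulrDr lerD//.
by rewrite (le_trans (nrmD _ _))// [leRHS]mulrDr lerD.
Qed.

Theorem tsig_group w x a b : a <= b -> driver w x a b ->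
  free_nilpotent_group (tsig x a b : A).
Proof. by move=> ab dr; apply: grouplike_group; exact: tsig_grouplike dr. Qed.

End signature_group.

(** * Suprema over partitions *)

Section partition_sums.
Context {R : realType}.
Implicit Types (F G : R -> R -> \bar R) (s t u v : R) (D : seq R).
Local Open Scope ereal_scope.

(** The sum in [partition_sup], by recursion on the partition. *)
Fixpoint psum F s D : \bar R :=
  if D is v :: D' then F s v + psum F v D' else 0.

Lemma psumE F s t D :
  \sum_(i < size D) F (nth t (s :: D) i) (nth t (s :: D) i.+1) = psum F s D.
Proof.
elim: D s => [|v D IH] s; first by rewrite big_ord0.
by rewrite big_ord_recl -[in RHS]/(psum F s (v :: D)) /= -IH.
Qed.

Lemma psum_cat F s D1 D2 : psum F s (D1 ++ D2) = psum F s D1 + psum F (last s D1) D2.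
Proof. by elim: D1 s => [|v D IH] s /=; rewrite ?add0e// IH addeA. Qed.

Lemma psum_ge0 F s D : (forall u v, 0 <= F u v) -> 0 <= psum F s D.
Proof. by move=> F0; elim: D s => //= v D IH s; rewrite adde_ge0. Qed.

Lemma psum_le_sup F s t D : itv_partition s t D -> psum F s D <= partition_sup F s t.
Proof. by move=> pD; apply: ereal_sup_ubound; exists D => //; rewrite psumE. Qed.

Lemma partition_sup_le F s t c :
  (forall D, itv_partition s t D -> psum F s D <= c) -> partition_sup F s t <= c.
Proof.
by move=> H; apply: ge_ereal_sup => _ [D pD <-]; rewrite psumE; exact: H.
Qed.

Lemma partition_exists s t : (s <= t)%R -> exists D, itv_partition s t D.
Proof.
rewrite le_eqVlt => /predU1P[<-|st]; first by exists [::].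
by exists [:: t]; exact: itv_partition1.
Qed.

Lemma partition_sup_ge0 F s t : (s <= t)%R -> (forall u v, 0 <= F u v) ->
  0 <= partition_sup F s t.
Proof.
move=> /partition_exists[D pD] F0.
by apply: le_trans (psum_le_sup F pD); exact: psum_ge0.
Qed.

Lemma partition_consP s t v D :
  itv_partition s t (v :: D) <-> (s < v)%R /\ itv_partition v t D.
Proof.
rewrite /itv_partition /=; split; first by case=> /andP[sv pD] l.
by case=> sv [pD l]; rewrite sv pD.
Qed.

Lemma psum_le F G s t D : itv_partition s t D ->
  (forall u v, (s <= u)%R -> (u < v)%R -> (v <= t)%R -> F u v <= G u v) ->
  psum F s D <= psum G s D.
Proof.
elim: D s => //= v D IH s /partition_consP[sv pD] FG; apply: leeD.
  by apply: FG => //; exact: itv_partition_le pD.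
by apply: IH pD _ => u v' vu; apply: FG; rewrite (le_trans (ltW sv)).
Qed.

Lemma control_psum (w : R -> R -> R) F s t D : control w s t -> itv_partition s t D ->
  (forall u v, (s <= u)%R -> (u < v)%R -> (v <= t)%R -> F u v <= (w u v)%:E) ->
  psum F s D <= (w s t)%:E.
Proof.
elim: D s => [|v D IH] s cw pD Fw /=.
  by rewrite lee_fin cw.1// (itv_partition_le pD).
have /partition_consP[sv pv] := pD; have vt := itv_partition_le pv.
apply: (@le_trans _ _ (w s v + w v t)%:E).
  rewrite EFinD leeD ?Fw//; apply: IH pv _; first exact: control_sub (ltW sv) _ cw.
  by move=> u v' vu; apply: Fw; rewrite (le_trans (ltW sv)).
by rewrite lee_fin cw.2// ltW.
Qed.

(** At most one interval of a partition straddles th. Replace it by its left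
part, closing a partition of [s, th], and its right part, opening a partition
of [th, t]. *)
Lemma psum_split F F1 F2 (C : \bar R) s th t D :
  (s <= th)%R -> (th <= t)%R -> 0 <= C ->
  (forall u v, 0 <= F1 u v) -> (forall u v, 0 <= F2 u v) ->
  (forall u v, (s <= u)%R -> (u < v)%R -> (v <= th)%R -> F u v <= F1 u v) ->
  (forall u v, (th <= u)%R -> (u < v)%R -> (v <= t)%R -> F u v <= F2 u v) ->
  (forall u v, (s <= u)%R -> (u < th)%R -> (th < v)%R -> (v <= t)%R ->
    F u v <= F1 u th + C + F2 th v) ->
  itv_partition s t D ->
  psum F s D <= partition_sup F1 s th + C + partition_sup F2 th t.
Proof.
move=> sth tht C0 F10 F20 H1 H2 H12 pD.
suff [D1 [D2 [p1 p2 H]]] : exists D1 D2, [/\ itv_partition s th D1,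
    itv_partition th t D2 & psum F s D <= psum F1 s D1 + C + psum F2 th D2].
  apply: (le_trans H); apply: leeD; last exact: psum_le_sup.
  by apply: leeD => //; exact: psum_le_sup.
elim: D s sth H1 H12 pD => [|v D IH] s; rewrite le_eqVlt => /predU1P[e|sth].
- subst s => H1 H12 pD; exists [::], [::]; split=> //=.
  by rewrite add0e adde0.
- move=> _ _ /itv_partition_nil e; subst t.
  by move: sth; rewrite ltNge tht.
- subst s => H1 H12 pD; exists [::], (v :: D); split=> //.
  by rewrite add0e; apply: le_trans (psum_le pD H2) _; rewrite leeDr.
move=> H1 H12 /partition_consP[sv pD]; have vt := itv_partition_le pD.
have [vth|thv] := leP v th.
  have [||D1 [D2 [p1 p2 H]]] := IH v vth _ _ pD.
  - by move=> u v' vu; apply: H1; rewrite (le_trans (ltW sv)).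
  - by move=> u v' vu; apply: H12; rewrite (le_trans (ltW sv)).
  exists (v :: D1), D2; split=> //; first exact/partition_consP.
  rewrite /= -!addeA leeD ?H1// addeA; exact: H.
exists [:: th], (v :: D); split; first exact: itv_partition1.
  exact/partition_consP.
rewrite /= adde0 addeA; apply: leeD; first exact: H12.
by apply: psum_le pD _ => u v' vu; apply: H2; rewrite (le_trans (ltW thv)).
Qed.

Lemma partition_sup_split F F1 F2 (C : \bar R) s th t :
  (s <= th)%R -> (th <= t)%R -> 0 <= C ->
  (forall u v, 0 <= F1 u v) -> (forall u v, 0 <= F2 u v) ->
  (forall u v, (s <= u)%R -> (u < v)%R -> (v <= th)%R -> F u v <= F1 u v) ->
  (forall u v, (th <= u)%R -> (u < v)%R -> (v <= t)%R -> F u v <= F2 u v) ->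
  (forall u v, (s <= u)%R -> (u < th)%R -> (th < v)%R -> (v <= t)%R ->
    F u v <= F1 u th + C + F2 th v) ->
  partition_sup F s t <= partition_sup F1 s th + C + partition_sup F2 th t.
Proof. by move=> *; apply: partition_sup_le => D; exact: psum_split. Qed.

Lemma partition_sup_superadd F s u t : (s <= u)%R -> (u <= t)%R ->
  (forall u v, 0 <= F u v) ->
  partition_sup F s u + partition_sup F u t <= partition_sup F s t.
Proof.
move=> su ut F0; have [->|fin] := eqVneq (partition_sup F s t) +oo; first exact: leey.
have c0 := partition_sup_ge0 (le_trans su ut) F0.
have key D1 D2 : itv_partition s u D1 -> itv_partition u t D2 ->
    psum F s D1 + psum F u D2 <= partition_sup F s t.
  move=> p1 p2; apply: le_trans (psum_le_sup F (itv_partition_cat p1 p2)).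
  by rewrite psum_cat; have [_ /eqP ->] := p1.
have fin_le (x : \bar R) : 0 <= x -> x <= partition_sup F s t -> x \is a fin_num.
  by move=> x0 xc; rewrite ge0_fin_numE// (le_lt_trans xc)// ltey.
have fin2 D2 : itv_partition u t D2 -> psum F u D2 \is a fin_num.
  move=> p2; apply: fin_le; first exact: psum_ge0.
  have [D1 p1] := partition_exists su; apply: le_trans (key _ _ p1 p2).
  by rewrite leeDr// psum_ge0.
have fin1 : partition_sup F s u \is a fin_num.
  apply: fin_le; first exact: partition_sup_ge0.
  apply: partition_sup_le => D1 p1; have [D2 p2] := partition_exists ut.
  by apply: le_trans (key _ _ p1 p2); rewrite leeDl// psum_ge0.
rewrite addeC -leeBrDr//; apply: partition_sup_le => D2 p2.
rewrite leeBrDr// addeC -leeBrDr ?fin2//; apply: partition_sup_le => D1 p1.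
by rewrite leeBrDr ?fin2//; exact: key.
Qed.

Lemma partition_sup_sub F s u v t : (s <= u)%R -> (u <= v)%R -> (v <= t)%R ->
  (forall u v, 0 <= F u v) -> partition_sup F u v <= partition_sup F s t.
Proof.
move=> su uv vt F0.
apply: le_trans (partition_sup_superadd su (le_trans uv vt) F0).
rewrite (le_trans _ (leeDr _ _)) ?partition_sup_ge0//.
apply: le_trans (partition_sup_superadd uv vt F0).
by rewrite leeDl ?partition_sup_ge0.
Qed.

Lemma partition_sup1 F s u v t : (s <= u)%R -> (u < v)%R -> (v <= t)%R ->
  (forall u v, 0 <= F u v) -> F u v <= partition_sup F s t.
Proof.
move=> su uv vt F0; apply: le_trans (partition_sup_sub su (ltW uv) vt F0).
by have := psum_le_sup F (itv_partition1 uv); rewrite /= adde0.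
Qed.

End partition_sums.

(** * The Euclidean norm *)

Section euclidean.
Context {R : realType} {d : nat}.
Implicit Types x y : 'rV[R]_d.

Lemma eucl_norm_ge0 x : 0 <= eucl_norm x.
Proof. exact: sqrtr_ge0. Qed.

Lemma eucl_norm_sqr x : eucl_norm x ^+ 2 = \sum_(i < d) x 0 i ^+ 2.
Proof. by rewrite sqr_sqrtr// sumr_ge0// => i _; exact: sqr_ge0. Qed.

Lemma coord_le_eucl x i : `|x 0 i| <= eucl_norm x.
Proof.
rewrite -(ler_pXn2r (n := 2))// ?nnegrE ?eucl_norm_ge0// eucl_norm_sqr.
rewrite real_normK ?num_real// (bigD1 i)//= lerDl sumr_ge0// => j _.
exact: sqr_ge0.
Qed.

(** Minkowski inequality, from the sum of the squares of b x_i - a y_i, where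
a and b are the norms of x and y. *)
Lemma eucl_normD x y : eucl_norm (x + y) <= eucl_norm x + eucl_norm y.
Proof.
have a0 := eucl_norm_ge0 x; have b0 := eucl_norm_ge0 y.
rewrite -(ler_pXn2r (n := 2))// ?nnegrE ?eucl_norm_ge0 ?addr_ge0//.
set a := eucl_norm x in a0 *; set b := eucl_norm y in b0 *.
pose S := \sum_(i < d) x 0 i * y 0 i.
have E : eucl_norm (x + y) ^+ 2 = a ^+ 2 + b ^+ 2 + 2 * S.
  rewrite !eucl_norm_sqr /S mulr_sumr -!big_split/=; apply: eq_bigr => i _.
  by rewrite mxE; ring.
have Q : 0 <= a * b * (a * b - S) *+ 2.
  have -> : a * b * (a * b - S) *+ 2 = \sum_(i < d) (b * x 0 i - a * y 0 i) ^+ 2.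
    rewrite [RHS](eq_bigr (fun i => b ^+ 2 * x 0 i ^+ 2 + a ^+ 2 * y 0 i ^+ 2
      - 2 * (a * b) * (x 0 i * y 0 i))); last by move=> i _; ring.
    rewrite sumrB big_split/= -!mulr_sumr -!eucl_norm_sqr -/a -/b -/S; ring.
  by apply: sumr_ge0 => i _; exact: sqr_ge0.
have S_le : S <= a * b.
  have [ab0|ab0] := ltP 0 (a * b).
    by move: Q; rewrite pmulrn_lge0// pmulr_rge0// subr_ge0.
  have {}ab0 : a * b = 0 by apply/le_anti; rewrite ab0 mulr_ge0.
  have /orP[/eqP z0|/eqP z0] : (a == 0) || (b == 0) by rewrite -mulf_eq0 ab0.
    rewrite /S big1 ?ab0// => i _; have := coord_le_eucl x i.
    by rewrite -/a z0 normr_le0 => /eqP ->; rewrite mul0r.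
  rewrite /S big1 ?ab0// => i _; have := coord_le_eucl y i.
  by rewrite -/b z0 normr_le0 => /eqP ->; rewrite mulr0.
rewrite E sqrrD mulr2n; lra.
Qed.

Lemma eucl_norm_line (s : R) i (u v : R) :
  eucl_norm (line s i v - line s i u : 'rV[R]_d) = `|s| * `|v - u|.
Proof.
rewrite /eucl_norm (bigD1 i)//= big1 ?addr0 => [|j ji].
  by rewrite !mxE eqxx -mulrBr sqrtr_sqr normrM.
by rewrite !mxE (negbTE ji) subrr expr0n.
Qed.

End euclidean.

(** * Continuity on a segment *)

Section continuity.
Context {R : realType}.
Implicit Types (a b c u v t e : R) (f : R -> R).

(** The Heine-Cantor theorem on a segment. *)
Lemma within_ucont f a b : {within `[a, b], continuous f} -> ucont f a b.
Proof.
move=> /subspace_continuousP cf e e0.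
have := (compact_near_coveringP _).1 (@segment_compact R a b).
pose P (dl z : R) := forall u v, `|u - z| < dl -> `|v - z| < dl ->
  a <= u -> u <= b -> a <= v -> v <= b -> `|f v - f u| <= e.
move=> /(_ R (0 : R)^'+ P _)[|dl0 /= dl0_gt0 H].
  move=> z zab; have e2 : 0 < e / 2 by rewrite divr_gt0.
  have /cvgrPdist_lt/(_ _ e2)/nbhs_ballP[r /= r0 zr] := cf z zab.
  exists (ball z (r / 2), [set x | x < r / 2]).
    split=> /=; first by apply: nbhsx_ballx; rewrite divr_gt0.
    by apply: nbhs_right_lt; rewrite divr_gt0.
  move=> [y dl] [/= zy dlr] u v uy vy au ub av vb.
  have near_z x : `|x - y| < dl -> a <= x -> x <= b -> `|f z - f x| < e / 2.
    move=> xy ax xb; apply: zr => /=; last by rewrite in_itv/= ax.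
    rewrite /ball/= -(subrKA y) (le_lt_trans (ler_normD _ _))//.
    rewrite [ltRHS]splitr ltrD// distrC (lt_trans xy)//.
  rewrite -(subrKA (f z)) (le_trans (ler_normD _ _))// [leRHS]splitr.
  by rewrite lerD// ?(distrC (f v)) ltW// near_z.
have dl1 : 0 < dl0 / 2 by rewrite divr_gt0.
have {}H : `[a, b]%classic `<=` P (dl0 / 2).
  apply: H => //=; rewrite /ball_ sub0r normrN ger0_norm ?ltW//.
  by rewrite ltr_pdivrMr// ltr_pMr// ltr1n.
exists (dl0 / 2) => // u v uv au uv' vb; have ub := le_trans uv' vb.
apply: (H u) => //=; rewrite ?in_itv/= ?au ?ub ?subrr ?normr0//.
  by rewrite ger0_norm// subr_ge0.
exact: le_trans uv'.
Qed.

Lemma ucont_within (d : nat) (x : R -> 'rV[R]_d) a b :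
  (forall i, ucont (fun t => x t 0 i) a b) -> {within `[a, b], continuous x}.
Proof.
move=> ux; apply/subspace_continuousP => z /=; rewrite in_itv/= => /andP[az zb].
move=> B [Q hQ QB].
suff : \forall t \near within `[a, b] (nbhs z), forall i j, Q i j (x t i j).
  by apply: filterS => t; exact: QB.
apply: filter_forall => i; apply: filter_forall => j.
have /nbhs_ballP[e /= e0 eQ] := hQ i j.
have e2 : 0 < e / 2 by rewrite divr_gt0.
have [dl dl0 H] := ux j _ e2; apply/nbhs_ballP; exists dl => //= t zt.
rewrite /= in_itv/= => /andP[at_ tb]; apply: eQ; rewrite (ord1 i) /ball/=.
apply: (@le_lt_trans _ _ (e / 2)); last by rewrite ltr_pdivrMr// ltr_pMr// ltr1n.
move: zt; rewrite /ball/=; have [zt|tz] := leP z t.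
  rewrite distrC ger0_norm ?subr_ge0// => zt'; rewrite distrC; exact: H.
rewrite ger0_norm ?subr_ge0 ?(ltW tz)// => zt'; apply: H => //; exact: ltW.
Qed.

Lemma within_coord (d : nat) (x : R -> 'rV[R]_d) a b i :
  {within `[a, b], continuous x} -> {within `[a, b], continuous (fun t => x t 0 i)}.
Proof.
move=> /subspace_continuousP cx; apply/subspace_continuousP => t tab.
apply: (@cvg_comp _ _ _ x (fun y : 'rV[R]_d => y 0 i) _ _ _ (cx t tab)).
exact: coord_continuous.
Qed.

Lemma ucont_paste f a c b : ucont f a c -> ucont f c b -> ucont f a b.
Proof.
move=> u1 u2 e e0; have e2 : 0 < e / 2 by rewrite divr_gt0.
have [d1 d10 H1] := u1 _ e2; have [d2 d20 H2] := u2 _ e2.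
have le2 : e / 2 <= e by rewrite ler_pdivrMr// ler_pMr// ler1n.
exists (Num.min d1 d2); first by rewrite lt_min d10.
move=> u v; rewrite lt_min => /andP[uv1 uv2] au uv vb.
have [vc|cv] := leP v c; first by apply: le_trans le2; exact: H1.
have [cu|uc] := leP c u; first by apply: le_trans le2; exact: H2.
rewrite -(subrKA (f c)) (le_trans (ler_normD _ _))// [leRHS]splitr lerD//.
  by apply: H2 => //; [apply: le_lt_trans uv2; rewrite lerD2l lerN2|]; exact: ltW.
by apply: H1 => //; [apply: le_lt_trans uv1; rewrite lerD2r|]; exact: ltW.
Qed.

Lemma ucont_ext f g a b : (forall u v, a <= u -> u <= v -> v <= b ->
  f v - f u = g v - g u) -> ucont f a b -> ucont g a b.
Proof.
move=> fg uf e /uf[dl dl0 H]; exists dl => // u v uv au uv' vb.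
by rewrite -fg//; exact: H.
Qed.

End continuity.

(** * Operations on paths of bounded variation *)

Section bv_paths.
Context {R : realType} {d : nat}.
Implicit Types (a b c u v t e : R) (x y : R -> 'rV[R]_d).

Lemma path_length_ge0 x a b : a <= b -> (0 <= path_length a b x)%E.
Proof. by move=> ab; apply: partition_sup_ge0 => // u v; rewrite lee_fin eucl_norm_ge0. Qed.

Lemma continuous_bvP x a b : a <= b -> continuous_bv a b x <->
  (forall i, ucont (fun t => x t 0 i) a b) /\ (path_length a b x < +oo)%E.
Proof.
move=> ab; split=> -[cx lx]; split=> //.
  by move=> i; apply: within_ucont; exact: within_coord.
exact: ucont_within.
Qed.

Definition plen x u v := fine (path_length u v x).

Lemma path_length_fin x a b u v : a <= u -> u <= v -> v <= b ->
  (path_length a b x < +oo)%E -> path_length u v x \is a fin_num.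
Proof.
move=> au uv vb lx; rewrite ge0_fin_numE ?path_length_ge0//.
apply: le_lt_trans lx; apply: partition_sup_sub => // u' v'.
by rewrite lee_fin eucl_norm_ge0.
Qed.

Lemma plenE x a b u v : a <= u -> u <= v -> v <= b ->
  (path_length a b x < +oo)%E -> path_length u v x = (plen x u v)%:E.
Proof. by move=> au uv vb lx; rewrite fineK//; exact: path_length_fin au uv vb lx. Qed.

(** The length is a control because it is superadditive. *)
Lemma continuous_bv_driver x a b : a <= b -> continuous_bv a b x ->
  driver (plen x) x a b.
Proof.
move=> ab /(continuous_bvP _ ab)[ux lx].
have N0 u v : (0%:E <= (eucl_norm (x v - x u))%:E)%E by rewrite lee_fin eucl_norm_ge0.
split=> //.
  split=> [u v au uv vb|u v z au uv vz zb].
    by rewrite fine_ge0// path_length_ge0.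
  rewrite -lee_fin EFinD -!(plenE _ _ _ lx)//.
  - exact: partition_sup_superadd.
  - exact: le_trans vz.
  - exact: le_trans uv.
  - exact: le_trans zb.
move=> i u v au uv vb; have [->|uv'] := eqVneq u v.
  by rewrite subrr normr0 fine_ge0// path_length_ge0.
have {uv'}uv' : u < v by rewrite lt_neqAle uv'.
rewrite -lee_fin -(plenE _ _ _ lx)//.
apply: (@le_trans _ _ (eucl_norm (x v - x u))%:E).
  by rewrite lee_fin; have := coord_le_eucl (x v - x u) i; rewrite !mxE.
exact: (@partition_sup1 _ (fun s t => (eucl_norm (x t - x s))%:E)).
Qed.

Lemma continuous_bv_sub x a b a' b' : a <= a' -> a' <= b' -> b' <= b ->
  continuous_bv a b x -> continuous_bv a' b' x.
Proof.
move=> aa ab bb; have ab' := le_trans (le_trans aa ab) bb.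
move=> /(continuous_bvP _ ab')[ux lx]; apply/continuous_bvP => //; split.
  by move=> i; exact: ucont_sub (ux i).
have := path_length_fin aa ab bb lx.
by rewrite ge0_fin_numE// path_length_ge0.
Qed.

Definition paste c x y t := if t <= c then x t else x c + (y t - y c).

Lemma pasteL c x y u v : u <= c -> v <= c ->
  paste c x y v - paste c x y u = x v - x u.
Proof. by rewrite /paste => -> ->. Qed.

Lemma pasteR c x y u v : c <= u -> c <= v ->
  paste c x y v - paste c x y u = y v - y u.
Proof.
have E t : c <= t -> paste c x y t = x c + (y t - y c).
  rewrite le_eqVlt => /predU1P[<-|ct]; first by rewrite /paste lexx subrr addr0.
  by rewrite /paste leNgt ct.
by move=> /E -> /E ->; rewrite opprD opprB addrACA subrr add0r addrA subrK.
Qed.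

Lemma paste_length x y a c b : a <= c -> c <= b ->
  (path_length a b (paste c x y) <= path_length a c x + path_length c b y)%E.
Proof.
move=> ac cb; have N0 (z : R -> 'rV[R]_d) u v : (0%:E <= (eucl_norm (z v - z u))%:E)%E.
  by rewrite lee_fin eucl_norm_ge0.
have := @partition_sup_split R
  (fun s t => (eucl_norm (paste c x y t - paste c x y s))%:E)
  (fun s t => (eucl_norm (x t - x s))%:E)
  (fun s t => (eucl_norm (y t - y s))%:E) 0%E a c b ac cb (lexx _) (N0 x) (N0 y).
rewrite adde0; apply.
- by move=> u v _ uv vc; rewrite pasteL// (le_trans (ltW uv)).
- by move=> u v cu uv _; rewrite pasteR// (le_trans cu)// ltW.
move=> u v _ uc cv _; rewrite adde0 -EFinD lee_fin.
rewrite -(subrKA (paste c x y c)) addrC.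
by rewrite (pasteL _ _ (ltW uc) (lexx c)) (pasteR _ _ (lexx c) (ltW cv)) eucl_normD.
Qed.

Lemma paste_bv x y a c b : a <= c -> c <= b -> continuous_bv a c x ->
  continuous_bv c b y -> continuous_bv a b (paste c x y).
Proof.
move=> ac cb; have ab := le_trans ac cb.
move=> /(continuous_bvP _ ac)[ux lx] /(continuous_bvP _ cb)[uy ly].
apply/continuous_bvP => //; split.
  move=> i; apply: (@ucont_paste _ _ _ c).
    apply: ucont_ext (ux i) => u v _ uv vc.
    have := congr1 (fun z : 'rV_d => z 0 i) (@pasteL c x y u v (le_trans uv vc) vc).
    by rewrite !mxE.
  apply: ucont_ext (uy i) => u v cu uv _.
  have := congr1 (fun z : 'rV_d => z 0 i) (@pasteR c x y u v cu (le_trans cu uv)).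
  by rewrite !mxE.
apply: le_lt_trans (paste_length _ _ ac cb) _.
by rewrite lte_add_pinfty.
Qed.

Lemma affine_length x a b p q : 0 < q ->
  (path_length a b (fun t => x (p + q * t)%R) <=
   path_length (p + q * a)%R (p + q * b)%R x)%E.
Proof.
move=> q0; apply: partition_sup_le => D pD.
apply: (@le_trans _ _ (psum (fun s t => (eucl_norm (x t - x s))%:E) (p + q * a)
  [seq p + q * t | t <- D])).
  by elim: D a {pD} => //= v D IH a; rewrite leeD.
apply: psum_le_sup; elim: D a pD => [|v D IH] a /=.
  by move=> /itv_partition_nil ->.
move=> /partition_consP[av /IH pv]; apply/partition_consP; split=> //.
by rewrite ltrD2l ltr_pM2l.
Qed.

Lemma affine_bv x a b p q : 0 < q -> a <= b ->
  continuous_bv (p + q * a) (p + q * b) x ->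
  continuous_bv a b (fun t => x (p + q * t)).
Proof.
move=> q0 ab cx; have ab' : p + q * a <= p + q * b by rewrite lerD2l ler_pM2l.
have [_ _ ux] := driver_affine q0 (continuous_bv_driver ab' cx).
apply/continuous_bvP => //; split=> //.
by apply: le_lt_trans (affine_length _ _ _ _ q0) _; case: cx.
Qed.

Lemma line_length (s : R) i : (path_length 0 1 (line s i : R -> 'rV[R]_d) <= `|s|%:E)%E.
Proof.
apply: partition_sup_le => D pD.
have := @control_psum R (fun u v => `|s| * (v - u))
  (fun s' t => (eucl_norm (line s i t - line s i s' : 'rV[R]_d))%:E) 0 1 D _ pD.
rewrite subr0 mulr1; apply.
  split=> [u v _ uv _|u v z _ _ _ _]; first by rewrite mulr_ge0// subr_ge0.
  by rewrite -mulrDr; apply: ler_wpM2l => //; lra.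
move=> u v _ uv _; rewrite lee_fin eucl_norm_line.
by rewrite [`|v - u|]ger0_norm// subr_ge0 ltW.
Qed.

Lemma line_bv (s : R) i : continuous_bv 0 1 (line s i : R -> 'rV[R]_d).
Proof.
apply/continuous_bvP => //; split; first by have [] := @driver_line R d s i.
exact: le_lt_trans (line_length s i) (ltry _).
Qed.

End bv_paths.

(** * The Carnot-Caratheodory norm *)

Section cc_norm.
Context {R : realType} {d N : nat}.
Local Notation A := (tens R d N).
Local Notation G := (@free_nilpotent_group R d N).
Local Notation cc := (@cc_norm R d N).
Implicit Types (x y : R -> 'rV[R]_d) (g h k : A).

Lemma cc_norm_ge0 g : (0 <= cc g)%E.
Proof. by apply: le_ereal_inf_tmp => _ [x _ <-]; exact: path_length_ge0. Qed.

Lemma cc_norm_le x : continuous_bv 0 1 x -> (cc (tsig x 0%R 1%R) <= path_length 0 1 x)%E.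
Proof. by move=> cx; apply: ereal_inf_lbound; exists x. Qed.

Lemma cc_norm_lt g c : (cc g < c)%E -> exists x, [/\ continuous_bv 0 1 x,
  tsig x 0 1 = g & (path_length 0 1 x < c)%E].
Proof. by move=> /ereal_inf_lt[_ [x [cx gx] <-] lx]; exists x. Qed.

(** Signatures lie in the group, so that an element outside of it is reached
by no path and has infinite norm. *)
Lemma cc_norm_group g : (cc g < +oo)%E -> G g.
Proof.
move=> /cc_norm_lt[x [cx <- _]].
exact: tsig_group (ler01) (continuous_bv_driver ler01 cx).
Qed.

Lemma tsig_paste x y a c b : a <= c -> c <= b -> continuous_bv a c x ->
  continuous_bv c b y -> tsig (paste c x y) a b = tsig x a c * tsig y c b :> A.
Proof.
move=> ac cb cx cy; have ab := le_trans ac cb.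
have cp := paste_bv ac cb cx cy.
rewrite (chen_identity (continuous_bv_driver ab cp) (lexx a) ac cb (lexx b)).
congr (_ * _).
  apply: (tsig_ext ac (continuous_bv_driver ac (continuous_bv_sub (lexx a) ac cb cp))
    (continuous_bv_driver ac cx)) => u v _ uv vc.
  by rewrite pasteL// (le_trans uv).
apply: (tsig_ext cb (continuous_bv_driver cb (continuous_bv_sub ac cb (lexx b) cp))
  (continuous_bv_driver cb cy)) => u v cu uv _.
by rewrite pasteR// (le_trans cu).
Qed.

(** Run a nearly optimal path for g on [0, 1/2] and one for h on [1/2, 1]. *)
Lemma cc_normM g h : (cc ((g : A) * (h : A))%R <= cc g + cc h)%E.
Proof.
have [goo|] := eqVneq (cc g) +oo%E.
  by rewrite goo addye ?leey// gt_eqF// (lt_le_trans _ (cc_norm_ge0 h)).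
have [hoo|] := eqVneq (cc h) +oo%E.
  by rewrite hoo addey ?leey// gt_eqF// (lt_le_trans _ (cc_norm_ge0 g)).
move=> hf gf; have {}gf : cc g \is a fin_num by rewrite ge0_fin_numE ?cc_norm_ge0// ltey.
have {}hf : cc h \is a fin_num by rewrite ge0_fin_numE ?cc_norm_ge0// ltey.
apply/lee_addgt0Pr => e e0; have e2 : 0 < e / 2 by rewrite divr_gt0.
have [x [cx gx lx]] : exists x, [/\ continuous_bv 0 1 x, tsig x 0 1 = g &
    (path_length 0 1 x < cc g + (e / 2)%:E)%E].
  by apply: cc_norm_lt; rewrite lteDl// lte_fin.
have [y [cy hy ly]] : exists y, [/\ continuous_bv 0 1 y, tsig y 0 1 = h &
    (path_length 0 1 y < cc h + (e / 2)%:E)%E].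
  by apply: cc_norm_lt; rewrite lteDl// lte_fin.
pose c : R := 2^-1.
have c0 : 0 <= c by rewrite invr_ge0.
have c1 : c <= 1 by rewrite invf_le1// ler1n.
have E1 : 0 + 2 * 0 = 0 :> R by lra.
have E2 : 0 + 2 * c = 1 by rewrite /c divff// add0r.
have E3 : -1 + 2 * c = 0 by rewrite /c divff// addNr.
have E4 : -1 + 2 * 1 = 1 :> R by lra.
have two0 : 0 < 2 :> R by [].
pose x' t := x (0 + 2 * t); pose y' t := y (-1 + 2 * t).
have cx' : continuous_bv 0 c x' by apply: affine_bv => //; rewrite E1 E2.
have cy' : continuous_bv c 1 y' by apply: affine_bv => //; rewrite E3 E4.
have sx : tsig x' 0 c = g.
  rewrite -gx -[in RHS]E2 -[X in _ = tsig _ X _]E1.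
  apply: (tsig_affine two0 c0 (w := plen x)).
  by rewrite E1 E2; exact: continuous_bv_driver.
have sy : tsig y' c 1 = h.
  rewrite -hy -[in RHS]E4 -[X in _ = tsig _ X _]E3.
  apply: (tsig_affine two0 c1 (w := plen y)).
  by rewrite E3 E4; exact: continuous_bv_driver.
have -> : g * h = tsig (paste c x' y') 0 1 by rewrite (tsig_paste c0 c1 cx' cy') sx sy.
apply: (le_trans (cc_norm_le (paste_bv c0 c1 cx' cy'))).
apply: (le_trans (paste_length _ _ c0 c1)).
have lx' := affine_length x 0 c 0 two0; rewrite E1 E2 in lx'.
have ly' := affine_length y c 1 (-1) two0; rewrite E3 E4 in ly'.
have -> : (cc g + cc h + e%:E = (cc g + (e / 2)%:E) + (cc h + (e / 2)%:E))%E.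
  by rewrite addeACA -EFinD -splitr.
by apply: leeD; [apply: le_trans lx' (ltW lx)|apply: le_trans ly' (ltW ly)].
Qed.

Lemma cc_norm_line (s : R) i : (cc (texp (s *: word [:: i] : A)%R) <= `|s|%:E)%E.
Proof.
rewrite -tsig_line; apply: le_trans (line_length s i).
by apply: cc_norm_le; exact: line_bv.
Qed.

(** Coordinates of degree n are bounded by the n-th power of the length. *)
Lemma cc_norm_coef g (e : R) (l : N.-bseq 'I_d) : e <= 1 -> (cc g < e%:E)%E ->
  `|(g - 1) l| <= e.
Proof.
move=> e1 /cc_norm_lt[x [cx gx lx]].
have dr := continuous_bv_driver ler01 cx.
have pe : plen x 0 1 < e.
  have [_ lx1] := cx; rewrite -lte_fin -(plenE (lexx 0) ler01 (lexx 1) lx1)//.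
have p0 : 0 <= plen x 0 1 by have [[w0 _] _ _] := dr; apply: w0.
have e0 : 0 <= e by apply: le_trans p0 (ltW pe).
rewrite coefB; have [l0|l0] := posnP (size l).
  have -> : l = [bseq] by apply/val_inj/nilP/eqP.
  by rewrite -gx tsig_coef0 coef_one subrr normr0.
rewrite [(1 : A) l]ffunE eqn0Ngt l0/= subr0 -gx.
apply: le_trans (tsig_bound _ dr ler01 (lexx 1)) _.
have p1 := le_trans (ltW pe) e1.
case: (size l) l0 => // n _; rewrite exprS (le_trans _ (ltW pe))//.
by rewrite ler_piMr// exprn_ile1.
Qed.

Lemma nrm_le_cc : exists2 C : R, 0 <= C & forall g (e : R), e <= 1 -> (cc g < e%:E)%E ->
  nrm (g - 1) <= C * e.
Proof.
exists #|{: N.-bseq 'I_d}|%:R => // g e e1 ge.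
apply: (@le_trans _ _ (\sum_(l : N.-bseq 'I_d) e)).
  by apply: ler_sum => l _; exact: cc_norm_coef.
by rewrite sumr_const mulr_natl.
Qed.

End cc_norm.

(** * Polygonal paths and brackets *)

Section chow.
Context {R : realType} {d N : nat}.
Local Notation A := (tens R d N).
Local Notation G := (@free_nilpotent_group R d N).
Local Notation cc := (@cc_norm R d N).
Implicit Types (g h k : A) (l : seq ('I_d * R)) (s t : R).

(** The signature of the polygonal path that moves by s along the axis i for
each pair (i, s) of l. *)
Definition polygon l : A := \prod_(q <- l) (texp (q.2 *: word [:: q.1] : A) : A).
Definition polygon_length l : R := \sum_(q <- l) `|q.2|.
Definition backwards l := rev [seq (q.1, - q.2) | q <- l].

Lemma lie_letter_scale i s : free_nilpotent_lie (s *: word [:: i] : A).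
Proof. by apply: FnLie_Z; exact: FnLie_letter. Qed.

Lemma polygon_group l : G (polygon l).
Proof.
rewrite /polygon; elim/big_rec: _ => [|q g _ Gg]; first exact: group1.
apply: groupM => //; exists (q.2 *: word [:: q.1] : A) => //.
exact: lie_letter_scale.
Qed.

Lemma polygon_cat l1 l2 : polygon (l1 ++ l2) = polygon l1 * polygon l2.
Proof. exact: big_cat. Qed.

Lemma polygon1 i s : polygon [:: (i, s)] = texp (s *: word [:: i] : A).
Proof. by rewrite /polygon big_seq1. Qed.

Lemma polygon_length_cat l1 l2 :
  polygon_length (l1 ++ l2) = polygon_length l1 + polygon_length l2.
Proof. exact: big_cat. Qed.

Lemma backwards_cons q l : backwards (q :: l) = backwards l ++ [:: (q.1, - q.2)].
Proof. by rewrite /backwards /= rev_cons cats1. Qed.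

Lemma backwards_length l : polygon_length (backwards l) = polygon_length l.
Proof.
elim: l => // q l IH; rewrite backwards_cons polygon_length_cat IH.
by rewrite /polygon_length big_seq1 big_cons normrN addrC.
Qed.

Lemma polygon_backwards l : polygon l * polygon (backwards l) = 1.
Proof.
elim: l => [|[i s] l IH]; first by rewrite /polygon !big_nil mulr1.
rewrite backwards_cons polygon_cat polygon1 -cat1s polygon_cat polygon1.
rewrite -mulrA (mulrA (polygon l)) IH mul1r/= scaleNr texpMN//.
exact/lie_deg1/lie_letter_scale.
Qed.

Lemma backwardsK l : backwards (backwards l) = l.
Proof.
rewrite /backwards map_rev revK -map_comp -[RHS]map_id; apply: eq_map.
by case=> i s /=; rewrite opprK.
Qed.

Lemma backwards_polygon l : polygon (backwards l) * polygon l = 1.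
Proof. by rewrite -{2}[l]backwardsK polygon_backwards. Qed.

Lemma cc_norm_polygon l : (cc (polygon l) <= (polygon_length l)%:E)%E.
Proof.
elim: l => [|[i s] l IH].
  by rewrite /polygon /polygon_length !big_nil [cc _]cc_norm1.
rewrite -cat1s polygon_cat polygon_length_cat EFinD.
apply: le_trans (cc_normM _ _) _; apply: leeD => //.
by rewrite polygon1 /polygon_length big_seq1; exact: cc_norm_line.
Qed.

(** The commutator polygon of a word given in reverse order: a bracket with
the letter i becomes a group commutator with a segment along i. The innermost
letter gets the signed length t, all others s; adjusting t alone reaches any
coefficient, of any sign, with no n-th roots. *)
Fixpoint bracket_polygon t s (w : seq 'I_d) : seq ('I_d * R) :=
  match w with
  | [::] => [::]
  | [:: i] => [:: (i, t)]
  | i :: w' => bracket_polygon t s w' ++ [:: (i, s)] ++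
      backwards (bracket_polygon t s w') ++ [:: (i, - s)]
  end.

Lemma bracket_polygon_length t s w :
  polygon_length (bracket_polygon t s w) <= 3 ^+ size w * (`|t| + `|s|).
Proof.
have X0 : 0 <= `|t| + `|s| by rewrite addr_ge0.
elim: w => [|i [_|j w IH]].
- by rewrite /polygon_length big_nil mulr_ge0.
- rewrite /polygon_length big_seq1/= expr1.
  have := normr_ge0 t; have := normr_ge0 s; lra.
rewrite -[bracket_polygon t s _]/(bracket_polygon t s (j :: w) ++ [:: (i, s)] ++
  backwards (bracket_polygon t s (j :: w)) ++ [:: (i, - s)]).
rewrite !polygon_length_cat backwards_length {2 4}/polygon_length !big_seq1/= normrN.
have : 1 <= 3 ^+ size w :> R by rewrite exprn_ege1// ler1n.
move: IH; rewrite /= !exprS; set a := polygon_length _; set b := 3 ^+ _.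
have := normr_ge0 t; have := normr_ge0 s; nra.
Qed.

(** The commutator of group elements is, to lowest order, the bracket of their
lowest-degree parts, because a b a' b' - 1 = [a - 1, b - 1] a' b'. *)
Lemma commutator_lead m (a a' b b' P Q : A) : a * a' = 1 -> b * b' = 1 ->
  a [bseq] = 1 -> b [bseq] = 1 ->
  deg_ge m.+1 P -> deg_ge 1 Q -> deg_ge m.+2 (a - 1 - P) -> deg_ge 2 (b - 1 - Q) ->
  deg_ge m.+3 (a * b * a' * b' - 1 - (P * Q - Q * P)).
Proof.
move=> aa bb a1 b1 hP hQ hp hq.
have ha' : deg_ge m.+1 (a - 1).
  rewrite -(subrK P (a - 1)); apply: deg_geD => //; exact: deg_ge_le hp.
have hb' : deg_ge 1 (b - 1).
  rewrite -(subrK Q (b - 1)); apply: deg_geD => //; exact: deg_ge_le hq.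
have hab : deg_ge 1 (a' * b' - 1).
  apply: subr1_deg_ge1; have := congr1 (fun z : A => z [bseq]) aa.
  have := congr1 (fun z : A => z [bseq]) bb.
  by rewrite /= !coefM0 a1 b1 !mul1r coef_one => -> ->; rewrite mulr1.
have hc : deg_ge m.+3 ((a - 1) * (b - 1) - P * Q).
  have -> : (a - 1) * (b - 1) - P * Q = (a - 1 - P) * (b - 1) + P * (b - 1 - Q).
    by rewrite [(_ - P) * _]mulrBl [P * (_ - Q)]mulrBr subrKA.
  apply: deg_geD; first by rewrite -[m.+3]addn1; exact: deg_geM.
  by rewrite -[m.+3]addn2; exact: deg_geM.
have hc' : deg_ge m.+3 ((b - 1) * (a - 1) - Q * P).
  have -> : (b - 1) * (a - 1) - Q * P = (b - 1) * (a - 1 - P) + (b - 1 - Q) * P.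
    by rewrite [(_ - Q) * _]mulrBl [_ * (_ - P)]mulrBr subrKA.
  apply: deg_geD; first by rewrite -[m.+3]add1n; exact: deg_geM.
  by rewrite -[m.+3]add2n; exact: deg_geM.
have comm : a * b - b * a = (a - 1) * (b - 1) - (b - 1) * (a - 1).
  rewrite !(mulrBl, mulrBr) !mulr1 !mul1r.
  by apply/ffunP => v; rewrite !(coefD, coefN); ring.
have baab : b * a * (a' * b') = 1 by rewrite -mulrA (mulrA a) aa mul1r.
have K : (a * b - b * a) * (a' * b' - 1) = a * b * a' * b' - 1 - (a * b - b * a).
  by rewrite mulrBr mulr1 mulrBl baab !mulrA.
rewrite comm in K.
have -> : a * b * a' * b' - 1 - (P * Q - Q * P) =
    ((a - 1) * (b - 1) - P * Q) - ((b - 1) * (a - 1) - Q * P)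
    + ((a - 1) * (b - 1) - (b - 1) * (a - 1)) * (a' * b' - 1).
  by rewrite K; apply/ffunP => v; rewrite !(coefD, coefN); ring.
apply: deg_geD; first exact: deg_geB.
rewrite -[m.+3]addn1; apply: deg_geM => //; apply: deg_geB.
  by rewrite -[m.+2]addn1; exact: deg_geM.
by rewrite -[m.+2]add1n; exact: deg_geM.
Qed.

Lemma texp_lead (c : A) : deg_ge 1 c -> deg_ge 2 ((texp c : A) - 1 - c).
Proof.
move=> hc; have := texpD_deg (@deg_ge0 R d N 1) hc.
by rewrite add0r [texp 0]texp0.
Qed.

(** By induction with [commutator_lead]; each letter after the innermost one
contributes a factor s. *)
Lemma bracket_polygon_lead t s w : w != [::] ->
  deg_ge (size w).+1 (polygon (bracket_polygon t s w) - 1 -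
    (t * s ^+ (size w).-1) *: rbracket w).
Proof.
elim: w => // i [_ _|j w IH _].
  rewrite /= polygon1 expr0 mulr1; apply: texp_lead.
  exact/lie_deg1/lie_letter_scale.
rewrite -[bracket_polygon t s _]/(bracket_polygon t s (j :: w) ++ [:: (i, s)] ++
  backwards (bracket_polygon t s (j :: w)) ++ [:: (i, - s)]).
set l := bracket_polygon t s (j :: w) in IH *.
rewrite !polygon_cat !mulrA.
set P := (t * s ^+ (size (j :: w)).-1) *: rbracket (j :: w) in IH.
pose Q : A := s *: word [:: i].
have -> : (t * s ^+ (size [:: i, j & w]).-1) *: rbracket [:: i, j & w] = P * Q - Q * P.
  rewrite rbracket_cons scale0r addr0 /P /Q -!scalerAl -!scalerAr !scalerA.
  by rewrite scalerBr /= exprS; congr (_ *: _ - _ *: _); ring.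
have hQ : deg_ge 1 Q by exact/lie_deg1/lie_letter_scale.
apply: (@commutator_lead (size w)) => //.
- exact: polygon_backwards.
- by rewrite !polygon1 scaleNr texpMN.
- exact/group_coef/polygon_group.
- exact/group_coef/polygon_group.
- exact: deg_geZ (@rbracket_deg _ _ _ (j :: w)).
- exact: IH.
- by rewrite polygon1; exact: texp_lead.
Qed.

End chow.

(** * Small group elements have small norm *)

Section chow_small.
Context {R : realType} {d N : nat}.
Local Notation A := (tens R d N).
Local Notation G := (@free_nilpotent_group R d N).
Local Notation cc := (@cc_norm R d N).
Implicit Types (g h k : A) (s t e : R).
Implicit Types (c : N.-bseq 'I_d -> R) (ws : seq (N.-bseq 'I_d)).

(** Polygons that realise the brackets of the words in ws with coefficients c,
run one after the other; n + 1 is the common length of the words. *)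
Definition bracket_product n c s ws :=
  flatten [seq bracket_polygon (c w / s ^+ n) s (rev w) | w : N.-bseq 'I_d <- ws].

Lemma bracket_product_length n c s dl ws : 0 < s ->
  (forall w, w \in ws -> size w = n.+1) ->
  (forall w, w \in ws -> `|c w| <= dl) -> dl <= s ^+ n.+1 ->
  polygon_length (bracket_product n c s ws) <= (size ws)%:R * (3 ^+ n.+1 * (2 * s)).
Proof.
move=> s0 + + dls; elim: ws => [|w ws IH] szw cw.
  by rewrite /polygon_length big_nil mul0r.
rewrite -[bracket_product _ _ _ _]/(bracket_polygon (c w / s ^+ n) s (rev w) ++
  bracket_product n c s ws) polygon_length_cat /= -add1n natrD mulrDl mul1r.
apply: lerD; last first.
  by apply: IH => v vws; [apply: szw|apply: cw]; rewrite inE vws orbT.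
apply: le_trans (bracket_polygon_length _ _ _) _.
rewrite size_rev szw ?mem_head// ler_wpM2l ?exprn_ge0//.
rewrite mulr_natl mulr2n (gtr0_norm s0) lerD2r normrM normfV.
rewrite (gtr0_norm (exprn_gt0 n s0)) ler_pdivrMr ?exprn_gt0// -exprS.
exact: le_trans (cw w (mem_head _ _)) dls.
Qed.

Lemma bracket_product_lead n c s ws : 0 < s ->
  (forall w, w \in ws -> size w = n.+1) ->
  deg_ge n.+1 (polygon (bracket_product n c s ws) - 1 : A) /\
  deg_ge n.+2 (polygon (bracket_product n c s ws) - 1 -
    \sum_(w <- ws) c w *: rbracket (rev w) : A).
Proof.
move=> s0; elim: ws => [|w ws IH] szw.
  by rewrite /polygon !big_nil subrr subr0; split; exact: deg_ge0.
rewrite -[bracket_product _ _ _ _]/(bracket_polygon (c w / s ^+ n) s (rev w) ++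
  bracket_product n c s ws) polygon_cat big_cons.
have [|h1 h2] := IH; first by move=> v vws; apply: szw; rewrite inE vws orbT.
have sw : size (rev w) = n.+1 by rewrite size_rev szw// mem_head.
have wn : rev w != [::] by rewrite -size_eq0 sw.
have := @bracket_polygon_lead R d N (c w / s ^+ n) s _ wn; rewrite sw succnK.
rewrite divfK ?expf_neq0 ?gt_eqF//.
set a : A := polygon _; set b : A := polygon _ in h1 h2 *.
set P : A := c w *: _; set Q : A := \sum_(_ <- _) _ in h2 * => hp.
have hP : deg_ge n.+1 P by rewrite -sw; apply: deg_geZ; exact: rbracket_deg.
have h3 : deg_ge n.+1 (a - 1).
  by rewrite -(subrK P (a - 1)); apply: deg_geD => //; exact: deg_ge_le hp.
have h4 : deg_ge n.+2 ((a - 1) * (b - 1)).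
  by apply: deg_ge_le (deg_geM h3 h1); rewrite addnS ltnS leq_addr.
have e : a * b - 1 = (a - 1) + (b - 1) + (a - 1) * (b - 1).
  rewrite mulrBr mulr1 mulrBl mul1r.
  by apply/ffunP => v; rewrite !(coefD, coefN); ring.
rewrite e; split.
  by apply: deg_geD; [exact: deg_geD|exact: deg_ge_le h4].
have -> : a - 1 + (b - 1) + (a - 1) * (b - 1) - (P + Q) =
   (a - 1 - P) + (b - 1 - Q) + (a - 1) * (b - 1).
  by apply/ffunP => v; rewrite !(coefD, coefN); ring.
by apply: deg_geD => //; exact: deg_geD.
Qed.

Lemma nrm1 : nrm (1 : A) <= 1.
Proof. by rewrite -word_nil nrm_word. Qed.

(** Cancel the part of g of degree n + 1 by a short polygon h built from
[group_lead]. What remains, h^-1 g, is still in the group, still close to 1,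
and has no part of degree n + 1 or less besides the constant 1. *)
Lemma chow_step n :
  (forall e, 0 < e -> exists2 dl : R, 0 < dl & forall g, G g -> deg_ge n.+2 (g - 1) ->
    nrm (g - 1) <= dl -> (cc g <= e%:E)%E) ->
  forall e, 0 < e -> exists2 dl : R, 0 < dl & forall g, G g -> deg_ge n.+1 (g - 1) ->
    nrm (g - 1) <= dl -> (cc g <= e%:E)%E.
Proof.
move=> IH e e0; have e2 : 0 < e / 2 by rewrite divr_gt0.
have [d1 d10 H1] := IH _ e2.
have [C C0 HC] := @nrm_le_cc R d N.
pose ws := [seq w : N.-bseq 'I_d <- enum {: N.-bseq 'I_d} | size w == n.+1].
have szw w : w \in ws -> size w = n.+1 by rewrite mem_filter => /andP[/eqP].
pose B : R := (size ws)%:R * 3 ^+ n.+1.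
have B0 : 0 <= B by rewrite mulr_ge0// exprn_ge0.
pose eta := Num.min (Num.min 1 (e / 2)) (d1 / (4 * C + 1)).
have C4 : 0 < 4 * C + 1 by rewrite ltr_wpDl// mulr_ge0.
have eta0 : 0 < eta by rewrite !lt_min ltr01 e2/= divr_gt0.
have eta1 : eta <= 1 by rewrite /eta !ge_min lexx.
have etae : eta <= e / 2 by rewrite /eta !ge_min lexx orbT.
have etad : 2 * C * eta <= d1 / 2.
  have : eta <= d1 / (4 * C + 1) by rewrite /eta !ge_min lexx !orbT.
  by rewrite ler_pdivlMr// => h; have := mulr_ge0 C0 (ltW eta0); lra.
(* The side s of the polygons is fixed first, so that their total length 2 B s
   stays below eta; g is then taken so close to 1 that the innermost sides t
   are no longer than s. *)
pose s := eta / (4 * (B + 1)).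
have B4 : 0 < 4 * (B + 1) by rewrite mulr_gt0// ltr_wpDl.
have s0 : 0 < s by rewrite divr_gt0.
have Bs : B * (2 * s) < eta.
  have : s * (4 * (B + 1)) = eta by rewrite /s divfK// gt_eqF.
  by have := mulr_ge0 B0 (ltW s0); lra.
pose dl := Num.min (Num.min 1 (d1 / 2)) (s ^+ n.+1).
have dl0 : 0 < dl by rewrite !lt_min ltr01 divr_gt0//= exprn_gt0.
exists dl => // g Gg hg ng.
have dl1 : dl <= 1 by rewrite /dl !ge_min lexx.
have dld : dl <= d1 / 2 by rewrite /dl !ge_min lexx orbT.
have dls : dl <= s ^+ n.+1 by rewrite /dl !ge_min lexx !orbT.
(* Coefficients of the lowest-degree part of g on brackets. *)
pose c (w : N.-bseq 'I_d) := n.+1%:R^-1 * g w.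
have cw w : w \in ws -> `|c w| <= dl.
  move=> /szw wn; rewrite /c normrM normfV normr_nat.
  have -> : g w = (g - 1) w by rewrite coefB [(1 : A) w]ffunE wn subr0.
  apply: le_trans (le_trans (coef_le_nrm _ w) ng).
  by rewrite ler_piMl// invf_le1// ler1n.
pose l := bracket_product n c s ws.
have ll : polygon_length l < eta.
  apply: le_lt_trans (bracket_product_length s0 szw cw dls) _.
  by rewrite mulrA.
have [_ hl] := bracket_product_lead c s0 szw.
have Gl : G (polygon l) by exact: polygon_group.
have ccl := cc_norm_polygon (N := N) l.
pose h' : A := polygon (backwards l); pose h : A := polygon l.
have h'h : h' * h = 1 by exact: backwards_polygon.
have hh' : h * h' = 1 by exact: polygon_backwards.
have -> : g = h * (h' * g) by rewrite mulrA hh' mul1r.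
apply: (le_trans (cc_normM _ _)).
apply: (@le_trans _ _ ((e / 2)%:E + (e / 2)%:E)%E); last by rewrite -EFinD -splitr.
apply: leeD.
  by apply: (le_trans ccl); rewrite lee_fin (le_trans (ltW ll)).
apply: H1.
- by apply: groupM => //; exact: polygon_group.
- rewrite -h'h -mulrBr; apply: deg_geMl.
  have hg2 := group_lead Gg hg; rewrite -/l -/h in hl.
  have -> : g - h = (g - 1 - \sum_(w <- ws) c w *: rbracket (rev w)) -
      (h - 1 - \sum_(w <- ws) c w *: rbracket (rev w)).
    by apply/ffunP => v; rewrite !(coefD, coefN); ring.
  apply: deg_geB => //; move: hg2; congr (deg_ge _ (_ - _)).
  rewrite scaler_sumr /ws big_filter big_enum_cond.
  by apply: eq_big => [w|w _]; rewrite ?scalerA.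
have h'1 : nrm (h' - 1) <= C * eta.
  apply: HC => //; apply: le_lt_trans (cc_norm_polygon _) _.
  by rewrite backwards_length lte_fin.
have -> : h' * g - 1 = (h' - 1) * (g - 1) + (h' - 1) + (g - 1).
  rewrite mulrBl mulrBr !mulr1 mul1r.
  by apply/ffunP => v; rewrite !(coefD, coefN); ring.
have n1 := nrm_ge0 (h' - 1); have n2 := nrm_ge0 (g - 1).
apply: le_trans (nrmD _ _) _.
apply: (@le_trans _ _ (2 * C * eta + dl)); last by lra.
apply: lerD => //; apply: le_trans (nrmD _ _) _.
have := nrmM (h' - 1) (g - 1); have := ler_pM n1 n2 h'1 (le_trans ng dl1).
lra.
Qed.

(** Repeated use of [chow_step], which raises the degree below which g - 1
vanishes, starting from the case where this degree exceeds N and g is the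
identity. *)
Theorem chow e : 0 < e -> exists2 dl : R, 0 < dl & forall g, G g ->
  nrm (g - 1) <= dl -> (cc g <= e%:E)%E.
Proof.
move=> e0; suff [dl dl0 H] : exists2 dl : R, 0 < dl & forall g, G g ->
    deg_ge 1 (g - 1) -> nrm (g - 1) <= dl -> (cc g <= e%:E)%E.
  by exists dl => // g Gg; apply: H => //; exact/subr1_deg_ge1/group_coef.
suff H n : (n <= N)%N -> forall e, 0 < e -> exists2 dl : R, 0 < dl & forall g, G g ->
    deg_ge (N - n).+1 (g - 1) -> nrm (g - 1) <= dl -> (cc g <= e%:E)%E.
  by have := H N (leqnn N) e e0; rewrite subnn.
elim: n => [_ {}e {}e0|n IH nN].
  exists 1 => // g _; rewrite subn0 => /deg_ge_eq0/eqP; rewrite subr_eq0.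
  by move=> /eqP -> _; rewrite [cc _]cc_norm1 lee_fin ltW.
apply: chow_step; rewrite -subSn//; exact: IH (ltnW nN).
Qed.

(** The norm is not invariant under conjugation, but conjugation is linear in
k - 1: bound the coordinates of the conjugate and come back to the norm with
[chow]. *)
Theorem cc_norm_conj M e : 0 < e -> exists2 dl : R, 0 < dl & forall k h : A,
  (cc k < dl%:E)%E -> G h -> nrm h <= M -> nrm (tinv h : A) <= M ->
  (cc ((tinv h : A) * k * h)%R <= e%:E)%E.
Proof.
move=> e0; have [d1 d10 H] := chow e0; have [C C0 HC] := @nrm_le_cc R d N.
have M0 : 0 <= M ^+ 2 := sqr_ge0 M.
have X0 : 0 < M ^+ 2 * C + 1 by rewrite ltr_wpDl// mulr_ge0.
(* The conjugate differs from 1 by at most M^2 C times the size of k; the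
   added 1 avoids a division by zero. *)
exists (Num.min 1 (d1 / (M ^+ 2 * C + 1))); first by rewrite lt_min ltr01 divr_gt0.
move=> k h kd Gh hM hM'; have h1 := group_coef Gh.
have Gk : G k by apply: cc_norm_group; apply: lt_trans kd (ltry _).
apply: H; first by apply: groupM => //; apply: groupM => //; exact: groupV.
have -> : (tinv h : A) * k * h - 1 = (tinv h : A) * (k - 1) * h.
  by rewrite mulrBr mulr1 mulrBl mulVt.
have nk := HC _ _ _ kd.
apply: le_trans (nrmM _ _) _.
apply: (@le_trans _ _ (M * nrm (k - 1) * M)).
  apply: ler_pM; rewrite ?nrm_ge0//; apply: le_trans (nrmM _ _) _.
  by rewrite ler_wpM2r// nrm_ge0.
rewrite mulrAC -expr2; apply: (@le_trans _ _ (M ^+ 2 * (C * (d1 / (M ^+ 2 * C + 1))))).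
  rewrite ler_wpM2l//; apply: le_trans (nk _) _; first by rewrite ge_min lexx.
  by rewrite ler_wpM2l// ge_min lexx orbT.
rewrite !mulrA ler_pdivrMr//.
by rewrite [leLHS]mulrC ler_pM2l// lerDl.
Qed.

End chow_small.

(** * Variation across a time *)

Section pvar.
Context {R : realType} {d : nat} {N : nat}.
Local Notation A := (tens R d N).
Local Notation cc := (@cc_norm R d N).
Implicit Types (X Y : R -> A) (p s t u v e : R).
Local Open Scope ereal_scope.

Lemma le_poweR p (x y : \bar R) : (0 <= p)%R -> 0 <= x -> x <= y -> x `^ p <= y `^ p.
Proof.
move=> p0 x0 xy; apply: gt0_ler_poweR; rewrite // in_itv/= ?leey ?andbT//.
exact: le_trans xy.
Qed.

Lemma poweRK p (x : \bar R) : (0 < p)%R -> 0 <= x -> (x `^ p) `^ p^-1 = x.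
Proof. by move=> p0 x0; rewrite -poweRrM divff ?gt_eqF// poweRe1. Qed.

Lemma poweRVK p (x : \bar R) : (0 < p)%R -> 0 <= x -> (x `^ p^-1) `^ p = x.
Proof. by move=> p0 x0; rewrite -poweRrM mulVf ?gt_eqF// poweRe1. Qed.

Lemma pvar_ge1 p (F : R -> R -> \bar R) s u v t : (0 < p)%R ->
  (s <= u)%R -> (u < v)%R -> (v <= t)%R -> (forall u v, 0 <= F u v) ->
  F u v <= partition_sup (fun u v => F u v `^ p) s t `^ p^-1.
Proof.
move=> p0 su uv vt F0; rewrite -[leLHS](poweRK p0)//.
apply: le_poweR; first by rewrite invr_ge0 ltW.
  exact: poweR_ge0.
by apply: (partition_sup1 (F := fun u v => F u v `^ p)) => // *; exact: poweR_ge0.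
Qed.

Lemma partition_sup_pvar p (F : R -> R -> \bar R) s t : (0 < p)%R -> (s <= t)%R ->
  partition_sup (fun u v => F u v `^ p) s t =
  (partition_sup (fun u v => F u v `^ p) s t `^ p^-1) `^ p.
Proof.
move=> p0 st; rewrite poweRVK// partition_sup_ge0// => *; exact: poweR_ge0.
Qed.

(** The case of p-th powers of [partition_sup_split]. The bound c enters once,
as a partition has at most one interval that straddles th. *)
Lemma pvar_split p (F F1 F2 : R -> R -> \bar R) (a b c : \bar R) T th :
  (1 <= p)%R -> (0 <= th)%R -> (th <= T)%R -> 0 <= c ->
  (forall u v, 0 <= F u v) -> (forall u v, 0 <= F1 u v) -> (forall u v, 0 <= F2 u v) ->
  partition_sup (fun u v => F1 u v `^ p) 0 T `^ p^-1 <= a ->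
  partition_sup (fun u v => F2 u v `^ p) 0 T `^ p^-1 <= b ->
  (forall u v, (0 <= u)%R -> (u < v)%R -> (v <= th)%R -> F u v = F1 u v) ->
  (forall u v, (th <= u)%R -> (u < v)%R -> (v <= T)%R -> F u v = F2 u v) ->
  (forall u v, (0 <= u)%R -> (u < th)%R -> (th < v)%R -> (v <= T)%R -> F u v <= c) ->
  partition_sup (fun u v => F u v `^ p) 0 T <= a `^ p + c `^ p + b `^ p.
Proof.
move=> p1 th0 thT c0 F0 F10 F20 Fa Fb E1 E2 E12.
have p0 : (0 < p)%R by exact: lt_le_trans p1.
have T0 : (0 <= T)%R by exact: le_trans thT.
have pow0 (G : R -> R -> \bar R) u v : 0 <= G u v `^ p by exact: poweR_ge0.
apply: (@le_trans _ _ (partition_sup (fun u v => F1 u v `^ p) 0 th + c `^ p +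
  partition_sup (fun u v => F2 u v `^ p) th T)).
  apply: partition_sup_split => //; try exact: poweR_ge0.
  - by move=> u v u0 uv vth; rewrite E1.
  - by move=> u v u0 uv vth; rewrite E2.
  move=> u v u0 uth thv vT; apply: (@le_trans _ _ (c `^ p)).
    by apply: le_poweR; [exact: ltW|exact: F0|exact: E12].
  apply: (@le_trans _ _ (F1 u th `^ p + c `^ p)); first by rewrite leeDr.
  by rewrite leeDl.
apply: leeD; first apply: leeD => //.
  apply: le_trans (partition_sup_sub (lexx _) th0 thT (pow0 F1)) _.
  rewrite (partition_sup_pvar _ p0 T0); apply: le_poweR => //; first exact: ltW.
  exact: poweR_ge0.
apply: le_trans (partition_sup_sub th0 thT (lexx _) (pow0 F2)) _.
rewrite (partition_sup_pvar _ p0 T0); apply: le_poweR => //; first exact: ltW.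
exact: poweR_ge0.
Qed.

End pvar.

(** * Bounds and continuity of tensor-valued paths *)

Section boundedness.
Context {R : realType} {d N : nat}.
Local Notation A := (tens R d N).

Lemma continuous_path_bounded (X : R -> A) a b : a <= b ->
  (forall w, {within `[a, b], continuous (fun t => X t w)}) ->
  exists2 M, 0 <= M & forall t, a <= t -> t <= b -> nrm (X t) <= M.
Proof.
move=> ab cX; have H (w : N.-bseq 'I_d) : {M | 0 <= M & forall t, a <= t -> t <= b -> `|X t w| <= M}.
  apply: cid2; have [c1 _ H1] := EVT_max ab (cX w).
  have [c2 _ H2] := EVT_min ab (cX w).
  exists (`|X c1 w| + `|X c2 w|); first by rewrite addr_ge0.
  move=> t at_ tb; have tab : t \in `[a, b]%R by rewrite in_itv/= at_.
  have := H1 t tab; have := H2 t tab; have := ler_norm (X c1 w).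
  have := ler_norm (- X c2 w); rewrite normrN; have := normr_ge0 (X c1 w); have := normr_ge0 (X c2 w).
  by rewrite ler_norml => *; apply/andP; split; lra.
exists (\sum_w s2val (H w)); first by apply: sumr_ge0 => w _; exact: (s2valP (H w)).
by move=> t at_ tb; apply: ler_sum => w _; exact: (s2valP' (H w)).
Qed.

Lemma nrm_tinv (a : A) M : nrm a <= M ->
  nrm (tinv a : A) <= \sum_(k < N.+1) (1 + M) ^+ k.
Proof.
move=> aM; rewrite tinvE; apply: le_trans (nrm_sum _ _ _) _.
apply: ler_sum => -[k _] _ /=.
have h : nrm (1 - a) <= 1 + M.
  by apply: le_trans (nrmB _ _) _; apply: lerD => //; exact: nrm1.
elim: k => [|k IH]; first by rewrite !expr0 nrm1.
rewrite !exprS; apply: le_trans (nrmM _ _) _.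
by apply: ler_pM; rewrite ?nrm_ge0.
Qed.

End boundedness.

Section continuity_paste.
Context {R : realType} {d N : nat}.
Local Notation A := (tens R d N).
Implicit Types (a b c u v t e : R).

Lemma ucontD (f g : R -> R) a b : ucont f a b -> ucont g a b ->
  ucont (fun t => f t + g t) a b.
Proof.
move=> uf ug e e0; have e2 : 0 < e / 2 by rewrite divr_gt0.
have [d1 d10 H1] := uf _ e2; have [d2 d20 H2] := ug _ e2.
exists (Num.min d1 d2); first by rewrite lt_min d10.
move=> u v; rewrite lt_min => /andP[uv1 uv2] au uv vb.
rewrite opprD addrACA (le_trans (ler_normD _ _))// [leRHS]splitr.
by rewrite lerD ?H1 ?H2.
Qed.

Lemma ucontMl (k : R) (f : R -> R) a b : ucont f a b -> ucont (fun t => k * f t) a b.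
Proof.
move=> uf e e0; have e1 : 0 < e / (`|k| + 1) by rewrite divr_gt0// ltr_wpDl.
have [dl dl0 H] := uf _ e1; exists dl => // u v uv au uv' vb.
rewrite -mulrBr normrM (@le_trans _ _ (`|k| * (e / (`|k| + 1))))//.
  by rewrite ler_wpM2l ?H.
by rewrite mulrA ler_pdivrMr ?ltr_wpDl// mulrC ler_pM2l// lerDl.
Qed.

Lemma ucont_sum (J : Type) (r : seq J) (F : J -> R -> R) a b :
  (forall j, ucont (F j) a b) -> ucont (fun t => \sum_(j <- r) F j t) a b.
Proof.
move=> uF; elim: r => [|j r IH].
  by move=> e e0; exists 1 => // u v *; rewrite !big_nil subrr normr0 ltW.
move=> e e0; have [dl dl0 H] := ucontD (uF j) IH e0; exists dl => // u v *.
by rewrite !big_cons H.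
Qed.

Lemma ucontMl_coef (g : A) (X : R -> A) a b (w : N.-bseq 'I_d) :
  (forall w, ucont (fun t => X t w) a b) -> ucont (fun t => (g * X t) w) a b.
Proof.
move=> uX; rewrite (_ : (fun t => _) = fun t => \sum_(i < (size w).+1)
    g (insub_bseq N (take i w)) * X t (insub_bseq N (drop i w))).
  by apply: ucont_sum => i; apply: ucontMl.
by apply/funext => t; rewrite tens_coefM.
Qed.

Lemma ucont_within_real (f : R -> R) a b : ucont f a b ->
  {within `[a, b], continuous f}.
Proof.
move=> uf; have ux (i : 'I_1) : ucont (fun t => (\row_(_ < 1) f t) 0 i) a b.
  by apply: ucont_ext uf => *; rewrite !mxE.
have := @within_coord R 1 (fun t => \row_(_ < 1) f t) a b 0 (ucont_within ux).
have -> // : (fun t => (\row_(_ < 1) f t) 0 0) = f by apply/funext => t; rewrite mxE.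
Qed.

End continuity_paste.

(** * Concatenation of geometric rough paths *)

Section increments.
Context {R : realType} {d N : nat}.
Local Notation A := (tens R d N).
Local Notation cc := (@cc_norm R d N).
Implicit Types (g h a : A) (X : R -> A) (u v : R).

Lemma incrE X u v : incr X u v = (tinv (X u) : A) * X v :> A.
Proof. by []. Qed.

Lemma incr_coef0 X u v : X u [bseq] = 1 -> X v [bseq] = 1 ->
  (incr X u v : A) [bseq] = 1.
Proof. by move=> u1 v1; rewrite incrE coefM0 coef_tinv// v1 mulr1. Qed.

Lemma incr_tsig (x : R -> 'rV[R]_d) T u v : continuous_bv 0 T x ->
  0 <= u -> u <= v -> v <= T -> incr (signature N x 0) u v = tsig x u v :> A.
Proof.
move=> cx u0 uv vT; have T0 : 0 <= T by apply: le_trans vT; apply: le_trans uv.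
rewrite incrE -![signature _ _ _ _]/(tsig _ _ _).
rewrite (chen_identity (continuous_bv_driver T0 cx) (lexx 0) u0 uv vT) mulrA.
by rewrite mulVt ?mul1r// tsig_coef0.
Qed.

Lemma incr_mull a X u v : a [bseq] = 1 -> X u [bseq] = 1 ->
  incr (fun t => a * X t) u v = incr X u v :> A.
Proof.
move=> a1 u1; rewrite !incrE tinvM// mulrA -(mulrA (tinv (X u) : A)).
by rewrite mulVt// mulr1.
Qed.

(** h1^-1 g1^-1 g2 h2 is the product of h1^-1 h2 and of the conjugate of g1^-1
g2 by h2. *)
Lemma cc_distM g1 g2 h1 h2 : g1 [bseq] = 1 -> g2 [bseq] = 1 -> h1 [bseq] = 1 ->
  h2 [bseq] = 1 ->
  (cc_dist (g1 * h1)%R (g2 * h2)%R <=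
    cc_dist h1 h2 + cc ((tinv h2 : A) * ((tinv g1 : A) * g2) * h2)%R)%E.
Proof.
move=> g11 g21 h11 h21; apply: le_trans (cc_normM _ _).
rewrite /cc_dist -!tmulE tinvM// -/(_ * _) !tmulE !mulrA.
by rewrite -(mulrA (tinv h1 : A) h2) mulrVt// mulr1.
Qed.

End increments.

Section concatenation_rough.
Context {R : realType} {d : nat} (p T : R).
Local Notation N := (Num.truncn p).
Local Notation A := (tens R d N).
Local Notation cc := (@cc_norm R d N).

(** The deterministic statement at a time th in [0, T]. Only the behaviour of
X on [0, T] is prescribed, so that it also covers concatenation times after T,
with th = T. *)
Lemma geometric_rough_path_concat (X1 X2 X : R -> A) (th : R) :
  1 <= p -> 0 <= th -> th <= T ->
  geometric_rough_path p T X1 -> geometric_rough_path p T X2 ->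
  (forall t, 0 <= t -> t <= th -> X t = X1 t) ->
  (forall t, th <= t -> t <= T -> X t = X1 th * tinv (X2 th) * X2 t) ->
  geometric_rough_path p T X.
Proof.
move=> p1 th0 thT [X10 G1 c1 v1 [x1 [bx1 lx1]]] [X20 G2 c2 v2 [x2 [bx2 lx2]]] XL XR.
have T0 : 0 <= T := le_trans th0 thT.
have p0 : 0 < p by exact: lt_le_trans p1.
have {}G1 t : 0 <= t -> t <= T -> free_nilpotent_group (X1 t).
  by move=> t0 tT; apply: G1; rewrite in_itv/= t0.
have {}G2 t : 0 <= t -> t <= T -> free_nilpotent_group (X2 t).
  by move=> t0 tT; apply: G2; rewrite in_itv/= t0.
have X11 t (t0 : 0 <= t) (tT : t <= T) := group_coef (G1 t t0 tT).
have X21 t (t0 : 0 <= t) (tT : t <= T) := group_coef (G2 t t0 tT).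
pose a : A := X1 th * tinv (X2 th).
have a1 : a [bseq] = 1 by rewrite coefM0 X11// coef_tinv ?mulr1// X21.
have EL u v : 0 <= u -> u <= v -> v <= th -> incr X u v = incr X1 u v.
  by move=> u0 uv vth; rewrite /incr !XL// ?(le_trans u0)// (le_trans uv).
have ER u v : th <= u -> u <= v -> v <= T -> incr X u v = incr X2 u v.
  move=> thu uv vT; rewrite -(incr_mull v a1 (X21 u (le_trans th0 thu) (le_trans uv vT))).
  by rewrite /incr !XR// ?(le_trans thu)// (le_trans uv).
have EM u v : 0 <= u -> u <= th -> th <= v -> v <= T ->
    incr X u v = (incr X1 u th : A) * incr X2 th v :> A.
  by move=> u0 uth thv vT; rewrite !incrE XL// XR// !mulrA.
have I1 u v : 0 <= u -> u <= v -> v <= T -> (incr X1 u v : A) [bseq] = 1.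
  by move=> u0 uv vT; apply: incr_coef0; apply: X11 => //; lra.
have I2 u v : 0 <= u -> u <= v -> v <= T -> (incr X2 u v : A) [bseq] = 1.
  by move=> u0 uv vT; apply: incr_coef0; apply: X21 => //; lra.
split.
- by rewrite XL// X10.
- move=> t; rewrite in_itv/= => /andP[t0 tT].
  have [tth|/ltW tht] := leP t th; first by rewrite XL//; exact: G1.
  rewrite XR//; apply: groupM; last exact: G2.
  by apply: groupM; [exact: G1|apply: groupV; exact: G2].
- move=> w; apply: ucont_within_real; apply: (@ucont_paste _ _ _ th).
    apply: (@ucont_ext _ (fun t => X1 t w)).
      by move=> u v u0 uv vth; rewrite !XL// ?(le_trans u0)// (le_trans uv).
    exact: ucont_sub (lexx 0) thT (within_ucont (c1 w)).
  apply: (@ucont_ext _ (fun t => (a * X2 t) w)).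
    by move=> u v thu uv vT; rewrite !XR// ?(le_trans thu)// (le_trans uv).
  apply: ucontMl_coef => w'.
  exact: ucont_sub th0 (lexx T) (within_ucont (c2 w')).
- rewrite /pvar_norm; apply: poweR_lty.
  set V1 := pvar_norm p 0 T X1 in v1; set V2 := pvar_norm p 0 T X2 in v2.
  have V10 : (0 <= V1)%E by exact: poweR_ge0.
  have V20 : (0 <= V2)%E by exact: poweR_ge0.
  have h := @pvar_split R p (fun u v => cc (incr X u v)) (fun u v => cc (incr X1 u v))
    (fun u v => cc (incr X2 u v)) V1 V2 (V1 + V2)%E T th p1 th0 thT.
  apply: (@le_lt_trans _ _ (V1 `^ p + (V1 + V2) `^ p + V2 `^ p)%E); last first.
    by rewrite !lte_add_pinfty// poweR_lty// lte_add_pinfty.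
  apply: h => //; try (move=> *; exact: cc_norm_ge0).
  + exact: adde_ge0.
  + by move=> u v u0 uv vth; rewrite EL// ltW.
  + by move=> u v thu uv vT; rewrite ER// ltW.
  move=> u v u0 uth thv vT; rewrite EM ?(ltW uth) ?(ltW thv)//.
  apply: le_trans (cc_normM _ _) _; apply: leeD.
    by apply: (pvar_ge1 (F := fun u v => cc (incr X1 u v))) => // *; exact: cc_norm_ge0.
  by apply: (pvar_ge1 (F := fun u v => cc (incr X2 u v))) => // *; exact: cc_norm_ge0.
pose x m := paste th (x1 m) (x2 m).
have bx1' m := continuous_bv_sub (lexx 0) th0 thT (bx1 m).
have bx2' m := continuous_bv_sub th0 thT (lexx T) (bx2 m).
have bx m : continuous_bv 0 T (x m) := paste_bv th0 thT (bx1' m) (bx2' m).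
exists x; split => //.
pose F m u v := cc_dist (incr (signature N (x m) 0) u v) (incr X u v).
pose F1 m u v := cc_dist (incr (signature N (x1 m) 0) u v) (incr X1 u v).
pose F2 m u v := cc_dist (incr (signature N (x2 m) 0) u v) (incr X2 u v).
have FL m u v : 0 <= u -> u < v -> v <= th -> F m u v = F1 m u v.
  move=> u0 uv vth; have vT := le_trans vth thT.
  rewrite /F /F1 (EL u v u0 (ltW uv) vth); apply: (congr1 (fun g => cc_dist g _)).
  rewrite [LHS](incr_tsig (bx m) u0 (ltW uv) vT) [RHS](incr_tsig (bx1 m) u0 (ltW uv) vT).
  apply: (tsig_ext (ltW uv)
    (continuous_bv_driver (ltW uv) (continuous_bv_sub u0 (ltW uv) vT (bx m)))
    (continuous_bv_driver (ltW uv) (continuous_bv_sub u0 (ltW uv) vT (bx1 m)))).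
  by move=> r s ur rs sv; rewrite pasteL//; lra.
have FR m u v : th <= u -> u < v -> v <= T -> F m u v = F2 m u v.
  move=> thu uv vT; have u0 := le_trans th0 thu.
  rewrite /F /F2 (ER u v thu (ltW uv) vT); apply: (congr1 (fun g => cc_dist g _)).
  rewrite [LHS](incr_tsig (bx m) u0 (ltW uv) vT) [RHS](incr_tsig (bx2 m) u0 (ltW uv) vT).
  apply: (tsig_ext (ltW uv)
    (continuous_bv_driver (ltW uv) (continuous_bv_sub u0 (ltW uv) vT (bx m)))
    (continuous_bv_driver (ltW uv) (continuous_bv_sub u0 (ltW uv) vT (bx2 m)))).
  by move=> r s ur rs sv; rewrite pasteR//; lra.
have SM m u v : 0 <= u -> u <= th -> th <= v -> v <= T ->
    incr (signature N (x m) 0) u v =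
    (incr (signature N (x1 m) 0) u th : A) * incr (signature N (x2 m) 0) th v :> A.
  move=> u0 uth thv vT; have uv := le_trans uth thv.
  rewrite (incr_tsig (bx m) u0 uv vT) (incr_tsig (bx1 m) u0 uth thT).
  rewrite (incr_tsig (bx2 m) th0 thv vT); apply: tsig_paste => //.
    exact: continuous_bv_sub (bx1 m).
  exact: continuous_bv_sub (bx2 m).
have [M2 M20 HM2] := continuous_path_bounded T0 c2.
pose K := \sum_(k < N.+1) (1 + M2) ^+ k.
have K0 : 0 <= K by apply: sumr_ge0 => k _; rewrite exprn_ge0// addr_ge0.
have hM v : th <= v -> v <= T -> nrm (incr X2 th v : A) <= K * M2.
  move=> thv vT; rewrite incrE; apply: le_trans (nrmM _ _) _.
  apply: ler_pM; rewrite ?nrm_ge0//; last by apply: HM2 => //; exact: le_trans thv.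
  by apply: nrm_tinv; exact: HM2.
have hM' v : th <= v -> v <= T -> nrm (tinv (incr X2 th v) : A) <= K * M2.
  move=> thv vT; have v0 := le_trans th0 thv.
  rewrite incrE tinvM ?coef_tinv ?X21// tinvK ?X21//; apply: le_trans (nrmM _ _) _.
  apply: ler_pM; rewrite ?nrm_ge0//; last by apply: HM2.
  by apply: nrm_tinv; exact: HM2.
have near0 (u_ : nat -> \bar R) (eta : R) : 0 < eta -> u_ @ \oo --> 0%E ->
    \forall m \near \oo, (u_ m < eta%:E)%E.
  move=> eta0 cu; have h : nbhs 0%E [set y : \bar R | (y < eta%:E)%E].
    by apply: open_ereal_lt'; rewrite lte_fin.
  exact: cu h.
(* With eta = e / 4 the two sides contribute at most eta each and the
   straddling interval at most 2 eta; since p >= 1, the sum of the p-th powers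
   is at most the p-th power of e. *)
have small e : 0 < e -> \forall m \near \oo, (pvar_dist p 0 T (signature N (x m) 0) X <= e%:E)%E.
  move=> e0; pose eta := e / 4; have eta0 : 0 < eta by rewrite divr_gt0.
  have [dl dl0 Hdl] := @cc_norm_conj R d N (K * M2) _ eta0.
  pose rho := Num.min eta dl; have rho0 : 0 < rho by rewrite lt_min eta0.
  have {}lx1 := near0 _ _ rho0 lx1; have {}lx2 := near0 _ _ rho0 lx2.
  near=> m.
  have h1 : (pvar_dist p 0 T (signature N (x1 m) 0) X1 < rho%:E)%E by near: m.
  have h2 : (pvar_dist p 0 T (signature N (x2 m) 0) X2 < rho%:E)%E by near: m.
  have rho_eta : (rho%:E <= eta%:E)%E by rewrite lee_fin ge_min lexx.
  have rho_dl : (rho%:E <= dl%:E)%E by rewrite lee_fin ge_min lexx orbT.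
  have key u v : 0 <= u -> u < th -> th < v -> v <= T -> (F m u v <= (eta *+ 2)%:E)%E.
    move=> u0 uth thv vT; have uth' := ltW uth; have thv' := ltW thv.
    rewrite /F [X in cc_dist X _](SM m u v u0 uth' thv' vT).
    rewrite [X in cc_dist _ X](EM u v u0 uth' thv' vT).
    have cs1 : (incr (signature N (x1 m) 0) u th : A) [bseq] = 1.
      by rewrite (incr_tsig (bx1 m) u0 uth' thT) tsig_coef0.
    have cs2 : (incr (signature N (x2 m) 0) th v : A) [bseq] = 1.
      by rewrite (incr_tsig (bx2 m) th0 thv' vT) tsig_coef0.
    apply: le_trans (cc_distM cs1 (I1 u th u0 uth' thT) cs2 (I2 th v th0 thv' vT)) _.
    rewrite mulr2n EFinD; apply: leeD.
      apply: le_trans (le_trans _ (ltW h2)) rho_eta.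
      by apply: (pvar_ge1 (F := F2 m)) => // *; exact: cc_norm_ge0.
    apply: Hdl.
    - apply: lt_le_trans _ rho_dl; apply: le_lt_trans h1.
      by apply: (pvar_ge1 (F := F1 m)) => // *; exact: cc_norm_ge0.
    - apply: groupM; last by apply: G2 => //; lra.
      by apply: groupV; exact: G2.
    - exact: hM.
    - exact: hM'.
  have e0' : (0 <= e%:E)%E by rewrite lee_fin ltW.
  rewrite /pvar_dist -[leRHS](poweRK p0 e0').
  apply: le_poweR; rewrite ?invr_ge0 ?(ltW p0)//.
    by apply: partition_sup_ge0 => // *; exact: poweR_ge0.
  apply: (@le_trans _ _ (eta%:E `^ p + (eta *+ 2)%:E `^ p + eta%:E `^ p)%E).
    apply: (@pvar_split R p (F m) (F1 m) (F2 m) _ _ _ T th p1 th0 thT) => //;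
      try (move=> *; exact: cc_norm_ge0).
    + by rewrite lee_fin mulrn_wge0// ltW.
    + by apply: le_trans (ltW h1) rho_eta.
    + by apply: le_trans (ltW h2) rho_eta.
    + exact: FL.
    + exact: FR.
  rewrite !poweR_EFin -!EFinD lee_fin.
  have q1 : eta `^ p <= 4^-1 * e `^ p.
    have -> : eta = 4^-1 * e by rewrite mulrC.
    by apply: ge1r_powRZ; rewrite ?invr_gt0 ?invf_le1 ?ler1n ?ltr0n ?(ltW e0)//=.
  have q2 : (eta *+ 2) `^ p <= 2^-1 * e `^ p.
    have -> : eta *+ 2 = 2^-1 * e by rewrite /eta -mulr_natl; lra.
    by apply: ge1r_powRZ; rewrite ?invr_gt0 ?invf_le1 ?ler1n ?ltr0n ?(ltW e0)//=.
  lra.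
move=> B [r /= r0 rB]; apply: filterS (small (r / 2) _); last by rewrite divr_gt0.
move=> m hm; rewrite -[_ m]/(B (pvar_dist p 0 T (signature N (x m) 0) X)).
have := poweR_ge0 (partition_sup (fun u v => F m u v `^ p)%E 0 T) p^-1.
rewrite -/(pvar_dist p 0 T (signature N (x m) 0) X); move: hm.
case: (pvar_dist _ _ _ _ _) => [y| |]//=; rewrite !lee_fin => yr y0.
apply: rB; rewrite /ball/= sub0r normrN ger0_norm//.
by apply: le_lt_trans yr _; rewrite ltr_pdivrMr// ltr_pMr// ltr1n.
Unshelve. all: by end_near. Qed.

Lemma geometric_rough_path_concatenation (X1 X2 : R -> A) (th : R) :
  1 <= p -> 0 < T -> 0 <= th ->
  geometric_rough_path p T X1 -> geometric_rough_path p T X2 ->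
  geometric_rough_path p T (concatenation X1 X2 th).
Proof.
move=> p1 T0 th0 g1 g2.
have [X10 G1 _ _ _] := g1; have [_ G2 _ _ _] := g2.
pose s := Num.min th T.
have s0 : 0 <= s by rewrite le_min th0 ltW.
have sT : s <= T by rewrite ge_min lexx orbT.
have in0 t : incr X1 0 t = X1 t by rewrite /incr X10 tinv1 tmul1.
have c2 t : 0 <= t -> t <= T -> (X2 t) [bseq] = 1.
  by move=> t0 tT; apply/group_coef/G2; rewrite in_itv/= t0.
have before t : t < th -> concatenation X1 X2 th t = X1 t.
  by move=> tth; rewrite /concatenation tth leNgt tth /= scale1r scale0r addr0 in0.
have after t : th <= t ->
    concatenation X1 X2 th t = X1 th * ((tinv (X2 th) : A) * X2 t).
  by move=> tht; rewrite /concatenation tht ltNge tht /= scale1r scale0r add0r in0.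
apply: (geometric_rough_path_concat p1 s0 sT g1 g2) => t.
  move=> t0; rewrite le_min => /andP[]; rewrite le_eqVlt => /predU1P[-> thT|tth _].
    by rewrite after// mulVt ?mulr1// c2.
  exact: before.
rewrite /s; have [thT|Tth] := leP th T => tht tT.
  by rewrite after// mulrA.
have -> : t = T by apply/le_anti; rewrite tht tT.
by rewrite before// -mulrA mulVt ?mulr1// c2// ltW.
Qed.

End concatenation_rough.

Theorem lemma3p6 (R : realType) (d : nat) (hd : (1 <= d)%N) (p T : R)
    (p1 : 1 <= p) (T0 : 0 < T)
    (disp : measure_display) (W : measurableType disp) (P : probability W R)
    (X1 X2 : {RV P >-> grough_path d p1 T0}) (theta : {RV P >-> R})
    (theta_ge0 : forall w : W, 0 <= theta w)
    (theta_mean : ('E_P[theta] < +oo)%E)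
    (laws_neq : ~ same_law X1 X2)
    (indep : mutually_independent3 X1 X2 theta) :
  {ae P, forall w : W,
    geometric_rough_path p T (concatenation (X1 w) (X2 w) (theta w))}.
Proof.
apply: aeW => w; apply: geometric_rough_path_concatenation => //.
  exact: groughP.
exact: groughP.
Qed.
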